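(* Let $n>k\ge 1$ be relatively prime integers, let $(\eta\,|\,\tau)\in\mathbb{C}\times\mathbb{H}$, and let $\begin{pmatrix} a&b\\ c&d\end{pmatrix}\in\mathrm{SL}(2,\mathbb{Z})$. Then there is an isomorphism of graded $\mathbb{C}$-algebras $$Q_{n,k}\Big(\frac{\eta}{c\tau+d}\,\Big|\,\frac{a\tau+b}{c\tau+d}\Big)\;\cong\; Q_{n,k}(\eta\,|\,\tau).$$
   Context: Notation: $e(z):=e^{2\pi i z}$; $\mathbb{H}$ is the open upper half plane; $\mathbb{Z}_n:=\mathbb{Z}/n\mathbb{Z}$; for $\tau\in\mathbb{H}$, $\Lambda_\tau:=\mathbb{Z}+\mathbb{Z}\tau$. Theta functions. For $\tau\in\mathbb{H}$ put $\theta(z):=\sum_{m\in\mathbb{Z}}(-1)^m e\big(mz+\tfrac12 m(m-1)\tau\big)$ and, for $\alpha\in\mathbb{Z}$, $$\theta_\alpha(z):=e\Big(\alpha z+\tfrac{\alpha}{2n}+\tfrac{\alpha(\alpha-n)}{2n}\tau\Big)\prod_{m=0}^{n-1}\theta\Big(z+\tfrac{m}{n}+\tfrac{\alpha}{n}\tau\Big).$$ The function $\theta_\alpha$ depends only on $\alpha$ modulo $n$, and $\theta_0,\dots,\theta_{n-1}$ is a basis of the space $\Theta_n(\Lambda_\tau)$ of holomorphic $f:\mathbb{C}\to\mathbb{C}$ with $f(z+1)=f(z)$ and $f(z+\tau)=-e(-nz)f(z)$. Indices are read in $\mathbb{Z}_n$. The operator $R$. Let $V$ be a complex vector space with basis $x_i$,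 $i\in\mathbb{Z}_n$. For $\eta\in\mathbb{C}\setminus\frac1n\Lambda_\tau$ and $z\in\mathbb{C}$, $R_{n,k}(z,\eta\,|\,\tau):V\otimes V\to V\otimes V$ is the linear operator, holomorphic in $z$ (apparent singularities are removable), given by $$R_{n,k}(z,\eta\,|\,\tau)(x_i\otimes x_j):=\frac{\theta_0(-z)\cdots\theta_{n-1}(-z)}{\theta_1(0)\cdots\theta_{n-1}(0)}\sum_{r\in\mathbb{Z}_n}\frac{\theta_{j-i+r(k-1)}(-z+\eta)}{\theta_{j-i-r}(-z)\,\theta_{kr}(\eta)}\;x_{j-r}\otimes x_{i+r}.$$ The function $\eta\mapsto R_{n,k}(\eta,\eta\,|\,\tau)$ on $\mathbb{C}\setminus\frac1n\Lambda_\tau$ extends uniquely to a holomorphic function $\mathbb{C}\to\mathrm{End}_{\mathbb{C}}(V^{\otimes2})$; the extension is also denoted $R_{n,k}(\eta,\eta\,|\,\tau)$. The algebra. For all $\eta\in\mathbb{C}$, $Q_{n,k}(\eta\,|\,\tau):=TV/(\text{image of }R_{n,k}(\eta,\eta\,|\,\tau))$, where $TV$ is the tensor algebra of $V$ and one quotients by the two-sided ideal generated by the image; it is graded with $V$ in degree one. *)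

(* Defs.v *)
From HB Require Import structures.
From mathcomp Require Import all_boot all_order all_algebra.
From mathcomp Require Import all_classical all_reals all_analysis.
From mathcomp Require Import complex.
(* The notations of these two clash with those of MathComp-Analysis. *)
From mathcomp Require Import -(notations) finmap monalg.

Set Implicit Arguments.
Unset Strict Implicit.
Unset Printing Implicit Defensive.

Import Order.TTheory GRing.Theory Num.Theory.
Import numFieldNormedType.Exports.

Local Open Scope classical_set_scope.
Local Open Scope ring_scope.
Local Open Scope complex_scope.

(* R[i] has no topology in the libraries; this is the one given by its norm. *)
HB.instance Definition _ (R : rcfType) := NormedModule.copy R[i] R[i]^o.

HB.mixin Record isMulrClosedIdeal (A : nzRingType) (S : A -> bool) := {
  idealMl_subproof : forall a : A, {in S, forall u, u * a \in S}
}.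

(* MathComp's [idealr] is a proper additive subgroup stable by [a * _]. *)
#[short(type="twoSidedIdeal")]
HB.structure Definition TwoSidedIdeal (A : nzRingType) :=
  {S of Idealr A S & isMulrClosedIdeal A S}.

Section QuotientAlgebra.
Variables (K : fieldType) (A : algType K) (I : twoSidedIdeal A).

Definition quot_alg := Quotient.quot I.
HB.instance Definition _ := GRing.Zmodule.on quot_alg.

Definition quot_pi (a : A) : quot_alg := (\pi_(Quotient.quot I) a)%qT.
Definition quot_repr (x : quot_alg) : A := repr (x : Quotient.quot I).

Lemma quot_reprK : cancel quot_repr quot_pi.
Proof. by move=> x; rewrite /quot_pi /quot_repr reprK. Qed.

Lemma quot_piP a b : reflect (quot_pi a = quot_pi b) (a - b \in (I : pred A)).
Proof. by rewrite Quotient.idealrBE; apply: eqP. Qed.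

Lemma quot_piD : {morph quot_pi : a b / a + b}.
Proof. by move=> a b; rewrite /quot_pi [LHS]Quotient.pi_add. Qed.

Lemma quot_pi0 : quot_pi 0 = 0.
Proof. by apply: (addrI (quot_pi 0)); rewrite -quot_piD !addr0. Qed.

Definition quot_one : quot_alg := quot_pi 1.
Definition quot_mul (x y : quot_alg) := quot_pi (quot_repr x * quot_repr y).
Definition quot_scale (c : K) (x : quot_alg) := quot_pi (c *: quot_repr x).

Lemma quot_repr_pi a : quot_repr (quot_pi a) - a \in (I : pred A).
Proof. by apply/quot_piP; rewrite quot_reprK. Qed.

Lemma quot_piM a b : quot_pi (a * b) = quot_mul (quot_pi a) (quot_pi b).
Proof.
apply/esym/quot_piP; set a' := quot_repr _; set b' := quot_repr _.
have -> : a' * b' - a * b = a' * (b' - b) + (a' - a) * b.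
  by rewrite mulrBr mulrBl addrA subrK.
by rewrite rpredD //; [apply: idealMr | apply: idealMl_subproof];
  exact: quot_repr_pi.
Qed.

Lemma quot_piZ c a : quot_pi (c *: a) = quot_scale c (quot_pi a).
Proof.
apply/esym/quot_piP; rewrite -scalerBr -[X in c *: X]mul1r scalerAl.
by rewrite idealMr ?quot_repr_pi.
Qed.

Lemma quot_mulA : associative quot_mul.
Proof.
move=> x y z; rewrite -[x]quot_reprK -[y]quot_reprK -[z]quot_reprK.
by rewrite -!quot_piM mulrA.
Qed.
Lemma quot_mul1x : left_id quot_one quot_mul.
Proof. by move=> x; rewrite -[x]quot_reprK -quot_piM mul1r. Qed.
Lemma quot_mulx1 : right_id quot_one quot_mul.
Proof. by move=> x; rewrite -[x]quot_reprK -quot_piM mulr1. Qed.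
Lemma quot_mulDl : left_distributive quot_mul +%R.
Proof.
move=> x y z; rewrite -[x]quot_reprK -[y]quot_reprK -[z]quot_reprK.
by rewrite -quot_piD -!quot_piM -quot_piD mulrDl.
Qed.
Lemma quot_mulDr : right_distributive quot_mul +%R.
Proof.
move=> x y z; rewrite -[x]quot_reprK -[y]quot_reprK -[z]quot_reprK.
by rewrite -quot_piD -!quot_piM -quot_piD mulrDr.
Qed.
Lemma quot_one_neq0 : quot_one != 0.
Proof. by apply/eqP; rewrite -quot_pi0 => /quot_piP; rewrite subr0 idealr1. Qed.

HB.instance Definition _ := GRing.Zmodule_isNzRing.Build quot_alg
  quot_mulA quot_mul1x quot_mulx1 quot_mulDl quot_mulDr quot_one_neq0.

Lemma quot_scaleA a b x : quot_scale a (quot_scale b x) = quot_scale (a * b) x.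
Proof. by rewrite -[x]quot_reprK -!quot_piZ scalerA. Qed.
Lemma quot_scale1 : left_id 1 quot_scale.
Proof. by move=> x; rewrite -[x]quot_reprK -quot_piZ scale1r. Qed.
Lemma quot_scaleDr : right_distributive quot_scale +%R.
Proof.
move=> c x y; rewrite -[x]quot_reprK -[y]quot_reprK -quot_piD -!quot_piZ.
by rewrite -quot_piD scalerDr.
Qed.
Lemma quot_scaleDl x : {morph quot_scale^~ x : a b / a + b}.
Proof. by move=> a b; rewrite -[x]quot_reprK -!quot_piZ -quot_piD scalerDl. Qed.

HB.instance Definition _ := GRing.Zmodule_isLmodule.Build K quot_alg
  quot_scaleA quot_scale1 quot_scaleDr quot_scaleDl.

Lemma quot_scaleAl c (x y : quot_alg) : c *: (x * y) = (c *: x) * y.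
Proof.
rewrite -[x]quot_reprK -[y]quot_reprK.
by rewrite -[LHS]/(quot_scale _ (quot_mul _ _)) -quot_piM -quot_piZ
  -[RHS]/(quot_mul (quot_scale _ _) _) -quot_piZ -quot_piM scalerAl.
Qed.
HB.instance Definition _ := GRing.Lmodule_isLalgebra.Build K quot_alg
  quot_scaleAl.

Lemma quot_scaleAr c (x y : quot_alg) : c *: (x * y) = x * (c *: y).
Proof.
rewrite -[x]quot_reprK -[y]quot_reprK.
by rewrite -[LHS]/(quot_scale _ (quot_mul _ _)) -quot_piM -quot_piZ
  -[RHS]/(quot_mul _ (quot_scale _ _)) -quot_piZ -quot_piM scalerAr.
Qed.
HB.instance Definition _ := GRing.Lalgebra_isAlgebra.Build K quot_alg
  quot_scaleAr.

Lemma quot_pi_zmod : zmod_morphism quot_pi.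
Proof.
move=> a b; apply: (addIr (quot_pi b)); rewrite -quot_piD subrK.
by rewrite subrK.
Qed.
HB.instance Definition _ := GRing.isZmodMorphism.Build A quot_alg quot_pi
  quot_pi_zmod.
Lemma quot_pi_monoid : monoid_morphism quot_pi.
Proof. by split => // a b; rewrite quot_piM. Qed.
HB.instance Definition _ := GRing.isMonoidMorphism.Build A quot_alg quot_pi
  quot_pi_monoid.
Lemma quot_pi_scalable : scalable quot_pi.
Proof. by move=> c a; rewrite quot_piZ. Qed.
HB.instance Definition _ := GRing.isScalable.Build K A quot_alg *:%R quot_pi
  quot_pi_scalable.

End QuotientAlgebra.

Record gradedAlg (K : fieldType) := GradedAlg {
  ga_alg :> algType K;
  ga_deg : nat -> set ga_alg;
  ga_deg_linear : forall d (c : K) x y,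
    ga_deg d x -> ga_deg d y -> ga_deg d (c *: x + y);
  ga_deg1 : ga_deg 0 1;
  ga_degM : forall d e x y, ga_deg d x -> ga_deg e y -> ga_deg (d + e) (x * y);
  ga_deg_span : forall x, exists N (f : nat -> ga_alg),
    (forall d, ga_deg d (f d)) /\ x = \sum_(d < N) f d;
  ga_deg_indep : forall N (f : nat -> ga_alg),
    (forall d, ga_deg d (f d)) -> \sum_(d < N) f d = 0 ->
    forall d, (d < N)%N -> f d = 0
}.

Definition graded_iso (K : fieldType) (A B : gradedAlg K) : Prop :=
  exists f : {lrmorphism A -> B},
    bijective f /\ forall d x, ga_deg d x <-> ga_deg d (f x).

Section GeneratedIdeal.
Variables (A : nzRingType) (S : set A).

Definition ideal_gen : pred A := fun u =>
  `[< exists s : seq (A * A * A), (forall t, t \in s -> S t.1.2) /\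
        u = \sum_(t <- s) t.1.1 * t.1.2 * t.2 >].

Lemma ideal_gen_zmod : zmod_closed ideal_gen.
Proof.
split; first by apply/asboolP; exists [::]; rewrite big_nil.
move=> u v /asboolP[s [sS ->]] /asboolP[t [tS ->]]; apply/asboolP.
exists (s ++ [seq ((- x.1.1, x.1.2), x.2) | x <- t]); split.
  move=> x; rewrite mem_cat => /orP[/sS//|/mapP[y /tS yS ->]]; exact: yS.
rewrite big_cat big_map /= -sumrN; congr (_ + _).
by apply: eq_bigr => x _; rewrite !mulNr.
Qed.

Lemma ideal_genMr a : {in ideal_gen, forall u, a * u \in ideal_gen}.
Proof.
move=> u /asboolP[s [sS ->]]; apply/asboolP.
exists [seq ((a * x.1.1, x.1.2), x.2) | x <- s]; split.
  by move=> x /mapP[y /sS yS ->].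
by rewrite big_map mulr_sumr; apply: eq_bigr => x _; rewrite !mulrA.
Qed.

Lemma ideal_genMl a : {in ideal_gen, forall u, u * a \in ideal_gen}.
Proof.
move=> u /asboolP[s [sS ->]]; apply/asboolP.
exists [seq (x.1, x.2 * a) | x <- s]; split.
  by move=> x /mapP[y /sS yS ->].
by rewrite big_map mulr_suml; apply: eq_bigr => x _; rewrite !mulrA.
Qed.

End GeneratedIdeal.

Section TensorAlgebra.
Variables (K : fieldType) (J : finType).

(* A word [:: j1; ..; jd] stands for x_j1 (x) .. (x) x_jd, so that the product,
   which concatenates words, is the tensor product. *)
Definition tensor_alg := malg (fmonom J) K.
HB.instance Definition _ := GRing.Lalgebra.on tensor_alg.

Lemma tensor_scaleAr (c : K) (u v : tensor_alg) : c *: (u * v) = u * (c *: v).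
Proof.
rewrite [u * v]malgME [RHS](@malgMEw _ _ (msupp u) (msupp v)) //; last first.
  exact: msuppZ_le.
rewrite scaler_sumr; apply: eq_bigr => k _; rewrite scaler_sumr.
apply: eq_bigr => l _; apply/malgP => m.
by rewrite mcoeffZ !mcoeffU mcoeffZ mulrCA mulrnAr.
Qed.
HB.instance Definition _ := GRing.Lalgebra_isAlgebra.Build K tensor_alg
  tensor_scaleAr.

Definition tensor_gen (j : J) : tensor_alg := mkmalgU (fmu j) 1.

Definition tensor_deg (d : nat) : set tensor_alg :=
  [set u | forall w : fmonom J, mcoeff w u != 0 -> size w = d].

Definition tensor_proj d (u : tensor_alg) : tensor_alg :=
  \sum_(w <- msupp u | size w == d) mkmalgU w (mcoeff w u).

Lemma mcoeff_tensor_proj d u w :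
  mcoeff w (tensor_proj d u) = if size w == d then mcoeff w u else 0.
Proof.
rewrite /tensor_proj raddf_sum /=.
under eq_bigr do rewrite mcoeffU.
have [w_in|w_out] := boolP (w \in msupp u); last first.
  rewrite (mcoeff_outdom w_out) if_same big1_seq // => v /andP[_ v_in].
  by case: eqP => // vw; rewrite -vw v_in in w_out.
have [wd|wd] := boolP (size w == d); last first.
  by rewrite big1 // => v vd; case: eqP => // vw; rewrite -vw vd in wd.
rewrite (big_rem w) //= wd eqxx mulr1n big1_seq ?addr0 // => v /andP[_].
rewrite mem_rem_uniq ?fset_uniq // => /andP[/= vw _].
by rewrite (negbTE vw).
Qed.

Lemma tensor_proj_is_zmod_morphism d : zmod_morphism (tensor_proj d).
Proof.
move=> u v; apply/malgP => w; rewrite mcoeffB !mcoeff_tensor_proj mcoeffB.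
by case: ifP => // _; rewrite subrr.
Qed.
HB.instance Definition _ d := GRing.isZmodMorphism.Build tensor_alg tensor_alg
  (tensor_proj d) (tensor_proj_is_zmod_morphism d).

Lemma tensor_deg_proj d u : tensor_deg d (tensor_proj d u).
Proof.
by move=> w; rewrite mcoeff_tensor_proj; case: (size w =P d); rewrite ?eqxx.
Qed.

Lemma tensor_proj_deg d e u :
  tensor_deg d u -> tensor_proj e u = if d == e then u else 0.
Proof.
move=> ud; apply/malgP => w; rewrite mcoeff_tensor_proj.
have [w0|/ud->] := eqVneq (mcoeff w u) 0; last first.
  by case: eqP; rewrite ?mcoeff0.
by rewrite w0; case: eqP; case: eqP => *; rewrite ?mcoeff0 ?w0.
Qed.

End TensorAlgebra.

Section QuadraticAlgebra.
Variables (K : fieldType) (N : nat).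

(* V has basis x_i, i : 'I_N; a matrix t stands for the element
   \sum_(i, j) t i j x_i (x) x_j of V (x) V. *)
Definition tensor2 (t : 'M[K]_N) : tensor_alg K 'I_N :=
  \sum_i \sum_j t i j *: (tensor_gen K i * tensor_gen K j).

(* An endomorphism of V (x) V is a matrix acting on the right of the row
   vectors mxvec t. *)
Variable E : 'M[K]_(N * N).

Definition quad_rel : set (tensor_alg K 'I_N) :=
  [set tensor2 (vec_mx (mxvec t *m E)) | t in [set: 'M[K]_N]].

Definition quad_ideal : pred (tensor_alg K 'I_N) := ideal_gen quad_rel.

Lemma tensor_degZD d (c : K) (u v : tensor_alg K 'I_N) :
  tensor_deg d u -> tensor_deg d v -> tensor_deg d (c *: u + v).
Proof.
move=> ud vd w; rewrite mcoeffD mcoeffZ.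
have [->|/ud//] := eqVneq (mcoeff w u) 0.
by rewrite mulr0 add0r => /vd.
Qed.

Lemma tensor_deg0 d : tensor_deg d (0 : tensor_alg K 'I_N).
Proof. by move=> w; rewrite mcoeff0 eqxx. Qed.

Lemma tensor_deg_sum d (T : Type) (r : seq T) (P : pred T)
    (F : T -> tensor_alg K 'I_N) :
  (forall i, P i -> tensor_deg d (F i)) ->
  tensor_deg d (\sum_(i <- r | P i) F i).
Proof.
move=> Fd; apply: (big_ind (tensor_deg d)) => //; first exact: tensor_deg0.
by move=> x y xd yd; rewrite -[x]scale1r; apply: tensor_degZD.
Qed.

Lemma tensor_degU (w : fmonom 'I_N) (c : K) :
  tensor_deg (size w) (mkmalgU w c : tensor_alg K 'I_N).
Proof.
by move=> v; rewrite mcoeffU; case: (w =P v) => [->|]; rewrite ?eqxx.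
Qed.

Lemma tensor_degM d e (u v : tensor_alg K 'I_N) :
  tensor_deg d u -> tensor_deg e v -> tensor_deg (d + e) (u * v).
Proof.
move=> ud ve w; rewrite mcoeff_neq0 => /msuppM_le[w1 [w2 []]].
by rewrite -!mcoeff_neq0 => /ud <- /ve <- ->; rewrite fmM size_cat.
Qed.

Lemma tensor_deg1 : tensor_deg 0 (1 : tensor_alg K 'I_N).
Proof.
by move=> w; rewrite mcoeff1; case: (w =P mone) => [->|]; rewrite ?fm1 ?eqxx.
Qed.

Lemma quad_rel_deg u : quad_rel u -> tensor_deg 2 u.
Proof.
case=> t _ <-; do 2![apply: tensor_deg_sum => ? _]; rewrite -[_ *: _]addr0.
apply: tensor_degZD; last exact: tensor_deg0.
have gen1 i : tensor_deg 1 (tensor_gen K i : tensor_alg K 'I_N).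
  by have := @tensor_degU (fmu i) 1; rewrite fmU.
exact: (tensor_degM (gen1 _) (gen1 _)).
Qed.

Let tmono w c : tensor_alg K 'I_N := mkmalgU w c.

Lemma quad_ideal_proj (d : nat) u :
  u \in quad_ideal -> tensor_proj d u \in quad_ideal.
Proof.
have quadD : {in quad_ideal &, forall u v, u + v \in quad_ideal}.
  have [q0 qB] := ideal_gen_zmod quad_rel.
  move=> x y xq yq; rewrite -[y]opprK qB // -sub0r qB //.
have quad0 : 0 \in quad_ideal by have [] := ideal_gen_zmod quad_rel.
move=> /asboolP[s [sS ->]]; rewrite big_seq raddf_sum.
apply: (big_ind (fun x => x \in quad_ideal)) => // -[[a g] b] /sS /= gS.
have -> : a * g * b = \sum_(w <- msupp a) \sum_(v <- msupp b)
    tmono w (mcoeff w a) * g * tmono v (mcoeff v b).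
  have tE (t : tensor_alg K 'I_N) :
      t = \sum_(w <- msupp t) tmono w (mcoeff w t).
    exact: monalgE.
  by rewrite {1}[a]tE {1}[b]tE [_ * g]mulr_suml [LHS]mulr_suml;
  apply: eq_bigr => w _; rewrite [LHS]mulr_sumr.
rewrite raddf_sum; apply: (big_ind (fun x => x \in quad_ideal)) => // w _.
rewrite raddf_sum; apply: (big_ind (fun x => x \in quad_ideal)) => // v _.
have md := tensor_degM (tensor_degM (@tensor_degU w (mcoeff w a))
  (quad_rel_deg gS)) (@tensor_degU v (mcoeff v b)).
rewrite -[X in X \in _]/(tensor_proj d _) (tensor_proj_deg _ md).
case: ifP => // _.
apply: ideal_genMl; apply: ideal_genMr; apply/asboolP; exists [:: ((1, g), 1)].
by split; [move=> x; rewrite inE => /eqP-> | rewrite big_seq1 mul1r mulr1].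
Qed.

Lemma quad_ideal1 : 1 \notin quad_ideal.
Proof.
apply/negP => /asboolP[s [sS]] /(congr1 (mcoeff mone)).
rewrite raddf_sum /= big_seq big1 ?rmorph1;
  last move=> [[a g] b] /sS /= /quad_rel_deg g2.
  by move/eqP; rewrite oner_eq0.
have /eqP g0 : mcoeff mone g == 0.
  by apply/negPn/negP => /g2; rewrite fm1.
by rewrite !rmorphM /= g0 mulr0 mul0r.
Qed.

HB.instance Definition _ :=
  GRing.isZmodClosed.Build _ quad_ideal (ideal_gen_zmod quad_rel).
HB.instance Definition _ := isProperIdeal.Build _ quad_ideal
  (conj quad_ideal1 (@ideal_genMr _ quad_rel)).
HB.instance Definition _ := isMulrClosedIdeal.Build _ quad_ideal
  (@ideal_genMl _ quad_rel).

Local Notation quad_quot := (quot_alg quad_ideal).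

Definition quad_deg d : set quad_quot :=
  [set quot_pi quad_ideal u | u in @tensor_deg K 'I_N d].

Lemma quad_deg_linear d (c : K) x y :
  quad_deg d x -> quad_deg d y -> quad_deg d (c *: x + y).
Proof.
move=> [u ud <-] [v vd <-]; exists (c *: u + v); first exact: tensor_degZD.
by rewrite linearP.
Qed.

Lemma quad_deg1 : quad_deg 0 1.
Proof. by exists 1; [exact: tensor_deg1 | rewrite rmorph1]. Qed.

Lemma quad_degM d e x y :
  quad_deg d x -> quad_deg e y -> quad_deg (d + e) (x * y).
Proof.
move=> [u ud <-] [v ve <-]; exists (u * v); first exact: tensor_degM.
by rewrite rmorphM.
Qed.

Lemma quad_deg_span x : exists M (f : nat -> quad_quot),
  (forall d, quad_deg d (f d)) /\ x = \sum_(d < M) f d.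
Proof.
pose u := quot_repr x.
exists (\max_(w <- msupp u) (size w).+1).
exists (fun d => quot_pi quad_ideal (tensor_proj d u)); split.
  by move=> d; exists (tensor_proj d u) => //; exact: tensor_deg_proj.
rewrite -raddf_sum -[LHS]quot_reprK -/u; congr quot_pi; apply/malgP => w.
rewrite raddf_sum /=; under eq_bigr do rewrite mcoeff_tensor_proj.
have [w_in|/mcoeff_outdom->] := boolP (w \in msupp u); last first.
  by rewrite big1 // => i _; rewrite if_same.
have wM : (size w < \max_(v <- msupp u) (size v).+1)%N.
  by rewrite (big_rem w) //= leq_maxl.
rewrite (bigD1 (Ordinal wM)) //= eqxx big1 ?addr0 // => i.
by case: (size w =P i) => // wi; rewrite -val_eqE /= wi eqxx.
Qed.

Lemma quad_deg_indep M (f : nat -> quad_quot) :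
  (forall d, quad_deg d (f d)) -> \sum_(d < M) f d = 0 ->
  forall d, (d < M)%N -> f d = 0.
Proof.
move=> fd f0 d dM.
have [d'|g gP] := choice (P := fun d v =>
  tensor_deg d v /\ quot_pi quad_ideal v = f d).
  by have [u ud uf] := fd d'; exists u.
have /(@quad_ideal_proj d) : \sum_(i < M) g i \in quad_ideal.
  rewrite -[X in X \in _]subr0; apply/quot_piP.
  rewrite raddf_sum raddf0 -[RHS]f0; apply: eq_bigr => i _; exact: (gP i).2.
rewrite raddf_sum (bigD1 (Ordinal dM)) //= big1 => [|i di]; last first.
  by rewrite (tensor_proj_deg _ (gP i).1) ifN.
rewrite addr0 (tensor_proj_deg _ (gP d).1) eqxx -[X in X \in _]subr0.
by move/quot_piP; rewrite raddf0 (gP d).2.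
Qed.

Definition quad_alg : gradedAlg K := GradedAlg quad_deg_linear quad_deg1
  quad_degM quad_deg_span quad_deg_indep.

End QuadraticAlgebra.

Section Theta.
Variable R : realType.
Local Notation C := R[i].

Definition cexp (z : C) : C :=
  (expR (complex.Re z))%:C * (cos (complex.Im z) +i* sin (complex.Im z)).

Definition e2pi (z : C) : C := cexp (2%:R * pi%:C * (0 +i* 1) * z).

(* The sum over the integers is the sum of the two series over 0, 1, 2, ..
   and over -1, -2, .. (Negz m is -(m + 1)). *)
Definition bisum (u : int -> C) : C :=
  limn (series (fun m : nat => u (Posz m)))
  + limn (series (fun m : nat => u (Negz m))).

Definition theta (tau z : C) : C :=
  bisum (fun m : int => (-1) ^ m
    * e2pi (m%:~R * z + (m * (m - 1))%:~R / 2%:R * tau)).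

Definition theta_ (n : nat) (tau : C) (alpha : int) (z : C) : C :=
  e2pi (alpha%:~R * z + alpha%:~R / (2 * n)%:R
        + (alpha * (alpha - n%:Z))%:~R / (2 * n)%:R * tau)
  * \prod_(m < n) theta tau (z + m%:R / n%:R + alpha%:~R / n%:R * tau).

(* Well defined because theta_ depends only on alpha modulo n. *)
Definition thetaZ (n : nat) (tau : C) (alpha : 'Z_n) (z : C) : C :=
  theta_ n tau (Posz alpha) z.

Definition frac_lattice (n : nat) (tau : C) : set C :=
  [set z | exists a b : int, z = (a%:~R + b%:~R * tau) / n%:R].

Definition entire (V : normedModType C) (f : C -> V) : Prop :=
  forall z, derivable f z 1.

(* The entire function that agrees with f outside D, which is unique when the
   complement of D is dense; 0 if there is none. *)
Definition entire_ext (V : normedModType C) (D : set C) (f : C -> V) : C -> V :=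
  xget (fun=> 0) [set g | entire g /\ forall z, ~ D z -> g z = f z].

Section Operator.
(* 'Z_n is convertible to the index type of the matrices below. *)
Variables n k : nat.
Local Notation N := (Zp_trunc n).+2.

(* The image of x_i (x) x_j; delta_mx p q stands for x_p (x) x_q.  The zeros of
   the denominators lie in frac_lattice. *)
Definition Rmx_basis (z eta tau : C) (i j : 'Z_n) : 'M[C]_N :=
  ((\prod_(al : 'Z_n) thetaZ tau al (- z))
     / (\prod_(al : 'Z_n | al != 0) thetaZ tau al 0))
  *: \sum_(r : 'Z_n)
       (thetaZ tau (j - i + r * (k%:R - 1)) (- z + eta)
         / (thetaZ tau (j - i - r) (- z) * thetaZ tau (k%:R * r) eta))
       *: delta_mx (j - r) (i + r).

Definition Rmx_formula (z eta tau : C) : 'M[C]_(N * N) :=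
  lin_mx (fun t : 'M[C]_N => \sum_i \sum_j t i j *: Rmx_basis z eta tau i j).

(* Meant for eta outside frac_lattice. *)
Definition Rmx (z eta tau : C) : 'M[C]_(N * N) :=
  entire_ext (frac_lattice n tau) (fun w => Rmx_formula w eta tau) z.

(* Rmx w w tau has its intended meaning only for w outside frac_lattice, which
   is where entire_ext uses it. *)
Definition Rmx_diag (eta tau : C) : 'M[C]_(N * N) :=
  entire_ext (frac_lattice n tau) (fun w => Rmx w w tau) eta.

Definition Qnk (eta tau : C) : gradedAlg C := quad_alg (Rmx_diag eta tau).

End Operator.
End Theta.

(* Main.v *)
From HB Require Import structures.
Require Import Defs.
From mathcomp Require Import all_boot all_order all_algebra.
From mathcomp Require Import all_classical all_reals all_analysis.
From mathcomp Require Import complex.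
From mathcomp Require Import -(notations) finmap monalg.
From mathcomp Require Import ring lra zify.

Set Implicit Arguments.
Unset Strict Implicit.
Unset Printing Implicit Defensive.

Import Order.TTheory GRing.Theory Num.Theory numFieldNormedType.Exports.
Local Open Scope classical_set_scope.
Local Open Scope ring_scope.
Local Open Scope complex_scope.

(** Rescaling R(eta, eta) by a non-zero number and conjugating it by W (x) W, for an
    invertible matrix W, changes its image, hence the ideal of relations, only by
    the change of basis W of V. It therefore suffices to find such relations between
    the operators at (eta, tau) and at the transformed point, and to do so for the
    two generators of SL(2, Z) (quad_alg_iso_conj, Qnk_modular).

    For tau |-> tau + 1, each theta_a is multiplied by a phase that is quadratic in
    a, and W is the diagonal matrix of the k-th powers of these phases
    (Rmx_formulaD1).

    For tau |-> -1/tau, W is the matrix of the finite Fourier transform e2pi(-k s i/n)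
    (Rmx_formula_inversion). The reason is that the coefficients
    theta_{a+b}(x+y) / (theta_a(x) theta_b(y)) of R are transformed into each other
    by a double finite Fourier transform in a and b (kern_inversion): they are
    finite Fourier transforms of Kronecker's function
    theta(x+y) / (theta(x) theta(y)) at points shifted by l/n and b tau/n, and
    inversion exchanges these two kinds of shifts (kern_kron, kron_kern,
    kron_inversion).

    These identities between theta functions rest on one principle, theta_unique:
    theta spans the space of functions with its quasi-periods. The principle is
    proved with discrete Fourier coefficients over the points z + j/N, for
    functions that have locally uniform first-order expansions, so that neither
    integrals nor Cauchy's theorem occur. The second ingredient is that theta has
    no zeros off the lattice; this follows from the triple product, obtained as a
    limit of finite q-binomial identities (theta_triple_prod, theta_neq0).

    R is given by formulas only off a lattice. The factor between the two operators
    is entire without zeros, so that an entire extension on one side yields one on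
    the other, and extensions are unique because the complement of the lattice is
    dense (entire_ext_conj, Rmx_diag_transfer). *)

(** * Modulus and exponential *)

Section ComplexExp.
Variable R : realType.
Local Notation C := R[i].
Implicit Types z w : C.

(** The norm of R[i] takes its values in R[i]; estimates are made in R instead. *)
Definition abs z : R := Normc.normc z.

Lemma absE z : (abs z)%:C = `|z|. Proof. by []. Qed.
Lemma abs_ge0 z : 0 <= abs z.
Proof. by case: z => a b; rewrite sqrtr_ge0. Qed.
Lemma absM z w : abs (z * w) = abs z * abs w.
Proof. exact: Normc.normcM. Qed.
Lemma absD z w : abs (z + w) <= abs z + abs w.
Proof. exact: le_normcD. Qed.
Lemma absN z : abs (- z) = abs z.
Proof. exact: normcN. Qed.
Lemma absBC z w : abs (z - w) = abs (w - z).
Proof. by rewrite -absN opprB. Qed.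
Lemma absB z w : abs (z - w) <= abs z + abs w.
Proof. by rewrite -(absN w); apply: absD. Qed.
Lemma abs0 : abs 0 = 0.
Proof. exact: Normc.normc0. Qed.
Lemma abs1 : abs 1 = 1.
Proof. exact: Normc.normc1. Qed.
Lemma absV z : abs z^-1 = (abs z)^-1.
Proof. exact: Normc.normcV. Qed.
Lemma absX z n : abs (z ^+ n) = abs z ^+ n.
Proof. by elim: n => [|n IH]; rewrite ?abs1 // !exprS absM IH. Qed.
Lemma abs_eq0 z : (abs z == 0) = (z == 0).
Proof.
by apply/eqP/eqP => [/Normc.eq0_normc|->//]; rewrite ?abs0.
Qed.
Lemma abs_gt0 z : (0 < abs z) = (z != 0).
Proof. by rewrite lt_neqAle abs_ge0 andbT eq_sym abs_eq0. Qed.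
Lemma abs_real (r : R) : abs r%:C = `|r|.
Proof. by rewrite /abs /= expr0n addr0 sqrtr_sqr. Qed.
Lemma abs_nat n : abs n%:R = n%:R.
Proof. by rewrite -(rmorph_nat (real_complex R)) abs_real normr_nat. Qed.
Lemma abs_int (m : int) : abs m%:~R = `|m|%N%:R.
Proof.
by case: m => m; rewrite ?NegzE ?rmorphN ?absN /= abs_nat ?absz_nat ?abszN.
Qed.
Lemma abs_sum (I : Type) (r : seq I) (P : pred I) (F : I -> C) :
  abs (\sum_(i <- r | P i) F i) <= \sum_(i <- r | P i) abs (F i).
Proof.
elim/big_rec2: _ => [|i y x _ le]; first by rewrite abs0.
by apply: le_trans (absD _ _) _; rewrite lerD2l.
Qed.
Lemma abs_prod (I : Type) (r : seq I) (P : pred I) (F : I -> C) :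
  abs (\prod_(i <- r | P i) F i) = \prod_(i <- r | P i) abs (F i).
Proof. by apply: big_morph; [exact: absM | exact: abs1]. Qed.
Lemma abs_ReIm z : abs z <= `|complex.Re z| + `|complex.Im z|.
Proof.
case: z => a b; rewrite [complex.Re _]/= [complex.Im _]/=.
have -> : a +i* b = a%:C + b%:C * 'i by simpc.
apply: le_trans (absD _ _) _; rewrite absM !abs_real.
by rewrite /abs /= expr0n expr1n add0r sqrtr1 mulr1.
Qed.
Lemma abs_sqr z : abs z ^+ 2 = complex.Re z ^+ 2 + complex.Im z ^+ 2.
Proof. by case: z => a b; rewrite /abs /= sqr_sqrtr // addr_ge0 ?sqr_ge0. Qed.
Lemma Re_abs z : `|complex.Re z| <= abs z.
Proof.
rewrite -(@ler_pXn2r _ 2%N) ?nnegrE ?abs_ge0 // abs_sqr real_normK ?num_real //.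
by rewrite lerDl sqr_ge0.
Qed.
Lemma Im_abs z : `|complex.Im z| <= abs z.
Proof.
rewrite -(@ler_pXn2r _ 2%N) ?nnegrE ?abs_ge0 // abs_sqr real_normK ?num_real //.
by rewrite lerDr sqr_ge0.
Qed.

Lemma cexpD z w : cexp (z + w) = cexp z * cexp w.
Proof.
case: z w => a b [c d]; rewrite /cexp /= expRD sinD cosD.
by apply/eqP; rewrite eq_complex /=; apply/andP; split; apply/eqP; ring.
Qed.
Lemma cexp0 : cexp (0 : C) = 1.
Proof. by rewrite /cexp /= expR0 cos0 sin0; simpc. Qed.
Lemma abs_cexp z : abs (cexp z) = expR (complex.Re z).
Proof.
rewrite absM abs_real ger0_norm ?expR_ge0 //.
by rewrite /abs /= cos2Dsin2 sqrtr1 mulr1.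
Qed.
Lemma cexp_neq0 z : cexp z != 0.
Proof. by rewrite -abs_gt0 abs_cexp expR_gt0. Qed.
Lemma cexpN z : cexp (- z) = (cexp z)^-1.
Proof.
apply: (mulfI (cexp_neq0 z)); rewrite -cexpD subrr cexp0 mulfV //.
exact: cexp_neq0.
Qed.

Lemma normr_sin_le (x : R) : `|sin x| <= `|x|.
Proof.
wlog x0 : x / 0 < x.
  move=> H; have [|x0|<-] := ltrgtP 0 x; first exact: H.
    by have := H (- x); rewrite oppr_gt0 sinN !normrN; exact.
  by rewrite sin0.
have [|c _] := @MVT _ sin cos 0 x x0.
- by apply: continuous_subspaceT => y; apply: continuous_sin.
rewrite sin0 !subr0 => ->; rewrite normrM.
by rewrite ler_piMl // cos_max.
Qed.

Lemma one_minus_cos (x : R) : 1 - cos x = 2 * sin (x / 2) ^+ 2.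
Proof.
have := cos_mulr2n (x / 2); have -> : x / 2 *+ 2 = x by field.
by move=> ->; have := cos2Dsin2 (x / 2); rewrite -mulr_natr; lra.
Qed.

(** Both bounds on 1 - cos x come from 1 - cos x = 2 sin^2 (x / 2). *)
Lemma normr_cosB1_sqr (x : R) : `|cos x - 1| <= x ^+ 2.
Proof.
have s := normr_sin_le (x / 2).
have -> : `|cos x - 1| = 2 * `|sin (x / 2)| ^+ 2.
  by rewrite distrC one_minus_cos normrM normrX ger0_norm.
have := normr_ge0 (sin (x / 2)).
have : `|x / 2| ^+ 2 = x ^+ 2 / 4 by rewrite real_normK ?num_real //; field.
have := normr_ge0 (x/2).
move: s; set u := `|sin _|; set v := `|x / 2|; nra.
Qed.

Lemma normr_cosB1 (x : R) : `|cos x - 1| <= `|x|.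
Proof.
have s := normr_sin_le (x / 2).
have -> : `|cos x - 1| = 2 * `|sin (x / 2)| ^+ 2.
  by rewrite distrC one_minus_cos normrM normrX ger0_norm.
have := sin_max (x / 2).
have -> : `|x| = 2 * `|x / 2| by rewrite normrM (ger0_norm (x := 2^-1)) //; field.
have := normr_ge0 (sin (x/2)).
move: s; set u := `|sin _|; set v := `|x / 2|; nra.
Qed.

Lemma normr_sinB (x : R) : `|sin x - x| <= x ^+ 2.
Proof.
wlog x0 : x / 0 < x.
  move=> H; have [|x0|<-] := ltrgtP 0 x; first exact: H.
    by have := H (- x); rewrite oppr_gt0 sqrrN sinN -opprD normrN; exact.
  by rewrite sin0 subrr normr0 expr0n.
have [|c c0x] := @MVT _ (fun y => sin y - y) (fun y => cos y - 1) 0 x x0.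
- apply: continuous_subspaceT => y; apply: cvgB; last exact: cvg_id.
  exact: continuous_sin.
rewrite sin0 !subr0 => ->; rewrite normrM (gtr0_norm x0) expr2.
apply: ler_wpM2r; first exact: ltW.
apply: le_trans (normr_cosB1 _) _.
by move: c0x; rewrite in_itv /= => /andP[c0 cx]; rewrite gtr0_norm // ltW.
Qed.

Lemma normr_expRB1 (a : R) : `|expR a - 1| <= `|a| * expR `|a|.
Proof.
have h1 := expR_ge1Dx a; have h2 := expR_ge1Dx (- a).
have e0 := expR_gt0 a.
have h3 : expR a * expR (- a) = 1 by rewrite -expRD subrr expR0.
have [a0|a0] := leP 0 a.
  rewrite !ger0_norm //; last lra.
  nra.
rewrite ler0_norm; last by have : expR a < 1; [rewrite expR_lt1|lra].
rewrite (ltr0_norm a0).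
have : 1 <= expR (- a) by lra.
nra.
Qed.

Lemma normr_expRB1B (a : R) : `|expR a - 1 - a| <= a ^+ 2 * expR `|a|.
Proof.
have h1 := expR_ge1Dx a; rewrite ger0_norm; last lra.
have h2 := expR_ge1Dx (- a).
have e0 := expR_gt0 a.
have h3 : expR a * expR (- a) = 1 by rewrite -expRD subrr expR0.
have : expR a - 1 - a <= a * (expR a - 1) by nra.
move/le_trans; apply; apply: le_trans (ler_norm _) _.
rewrite normrM -real_normK ?num_real // expr2 -mulrA.
by apply: ler_wpM2l => //; apply: normr_expRB1.
Qed.

(** Real and imaginary parts are estimated separately through the real bounds
    above; the constant 5 leaves room for the mixed term |a| |b| <= a^2 + b^2. *)
Lemma cexp_taylor z :
  abs (cexp z - 1 - z) <= 5 * abs z ^+ 2 * expR (abs z).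
Proof.
apply: le_trans (abs_ReIm _) _; rewrite abs_sqr.
have := Re_abs z; set E := expR (abs z).
have -> : complex.Re (cexp z - 1 - z)
  = expR (complex.Re z) * cos (complex.Im z) - 1 - complex.Re z.
  by case: (z) => a b /=; ring.
have -> : complex.Im (cexp z - 1 - z)
  = expR (complex.Re z) * sin (complex.Im z) - complex.Im z.
  by case: (z) => a b /=; ring.
move: (complex.Re z) (complex.Im z) => a b ar.
have e1 : expR `|a| <= E by rewrite ler_expR.
have E0 : 0 < E := expR_gt0 _.
have E1 : 1 <= E by rewrite -expR0 ler_expR abs_ge0.
have e2 : expR a <= E by apply: le_trans e1; rewrite ler_expR ler_norm.
have -> : expR a * cos b - 1 - a = expR a * (cos b - 1) + (expR a - 1 - a).
  by ring.
have -> : expR a * sin b - b = (expR a - 1) * sin b + (sin b - b) by ring.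
have t1 : `|expR a * (cos b - 1)| <= E * b ^+ 2.
  rewrite normrM (ger0_norm (expR_ge0 a)).
  by apply: ler_pM => //; exact: normr_cosB1_sqr.
have t2 : `|expR a - 1 - a| <= a ^+ 2 * E.
  by apply: le_trans (normr_expRB1B a) _; rewrite ler_wpM2l ?sqr_ge0.
have t3 : `|(expR a - 1) * sin b| <= (`|a| * E) * `|b|.
  rewrite normrM; apply: ler_pM => //; last exact: normr_sin_le.
  by apply: le_trans (normr_expRB1 a) _; rewrite ler_wpM2l.
have t4 := normr_sinB b.
apply: le_trans (lerD (ler_normD _ _) (ler_normD _ _)) _.
have : `|a| * `|b| <= a ^+ 2 + b ^+ 2.
  rewrite -(real_normK (num_real a)) -(real_normK (num_real b)).
  by have := sqr_ge0 (`|a| - `|b|); rewrite sqrrB; have := normr_ge0 a; have := normr_ge0 b; nra.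
have := sqr_ge0 a; have := sqr_ge0 b.
move: t1 t2 t3 t4; move: `|_ * (cos b - 1)| `|_ - 1 - a| `|_ * sin b| `|_ - b|.
move: (`|a|) (`|b|) => u v p q s t; move: (a ^+ 2) (b ^+ 2) => A B *.
have : (u * v) * E <= (A + B) * E by rewrite ler_wpM2r // ltW.
nra.
Qed.

End ComplexExp.

(** * Two-sided series *)

Section WindowSums.
Variable R : realType.
Local Notation C := R[i].

Lemma cvgC_abs (s : nat -> C) (l : C) :
  s @ \oo --> l <->
  forall e : R, 0 < e -> exists M0, forall M, (M0 <= M)%N -> abs (s M - l) < e.
Proof.
split.
  move=> /cvgrPdist_lt sl e e0; have [|M0 _ H] := sl e%:C; first by rewrite ltcR.
  by exists M0 => M /H /=; rewrite -absE ltcR absBC.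
move=> H; apply/cvgrPdist_lt => e; rewrite ltcE /= => /andP[/eqP e1 e2].
have [M0 HM] := H _ e2; exists M0 => // M /= /HM.
by rewrite absBC -ltcR absE /=; case: (e) e1 => a b /= ->.
Qed.

Lemma cvgC_bound (s : nat -> C) (l : C) (K : R) :
  (forall M, abs (s M - l) <= K / M.+1%:R) -> s @ \oo --> l.
Proof.
move=> H; apply/cvgC_abs => e e0.
have [M0 HM0] : exists M0 : nat, `|K| / e < M0%:R.
  by exists (Num.bound (`|K| / e)); rewrite archi_boundP // divr_ge0 // ltW.
exists M0 => M MM; apply: le_lt_trans (H M) _.
rewrite ltr_pdivrMr ?ltr0n //; apply: le_lt_trans (ler_norm _) _.
rewrite mulrC -ltr_pdivrMr //; apply: lt_le_trans HM0 _.
by rewrite ler_nat leqW.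
Qed.

(** Sums over the windows -M, .., M: Negz m is -(m + 1). Unlike the two halves of
    bisum, windows behave well under shifts of the index. *)
Definition wsum (V : nmodType) (u : int -> V) (M : nat) : V :=
  \sum_(m < M.+1) u (Posz m) + \sum_(m < M) u (Negz m).

Lemma wsumS (V : nmodType) (u : int -> V) M :
  wsum u M.+1 = wsum u M + (u (Posz M.+1) + u (Negz M)).
Proof. by rewrite /wsum big_ord_recr [X in _ + X]big_ord_recr /= addrACA. Qed.

Lemma wsumD (V : nmodType) (u v : int -> V) M :
  wsum (fun m => u m + v m) M = wsum u M + wsum v M.
Proof. by rewrite /wsum !big_split /= addrACA. Qed.

Lemma wsumB (V : zmodType) (u v : int -> V) M :
  wsum (fun m => u m - v m) M = wsum u M - wsum v M.
Proof. by rewrite wsumD /wsum !sumrN -opprD. Qed.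

Lemma wsumZ (a : C) u M : wsum (fun m => a * u m) M = a * wsum u M.
Proof. by rewrite /wsum -!mulr_sumr mulrDr. Qed.

Lemma ler_wsum (g h : int -> R) M :
  (forall m : int, (`|m| <= M)%N -> g m <= h m) -> wsum g M <= wsum h M.
Proof.
by move=> H; apply: lerD; apply: ler_sum => i _; apply: H; rewrite ?NegzE ?abszN absz_nat // -ltnS.
Qed.

Lemma eq_wsum (V : nmodType) (g h : int -> V) M :
  (forall m : int, (`|m| <= M)%N -> g m = h m) -> wsum g M = wsum h M.
Proof.
move=> H; congr (_ + _); apply: eq_bigr => i _; apply: H;
by rewrite ?NegzE ?abszN absz_nat // -ltnS.
Qed.

Lemma abs_wsum (u : int -> C) M : abs (wsum u M) <= wsum (fun m => abs (u m)) M.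
Proof. by apply: le_trans (absD _ _) _; apply: lerD; apply: abs_sum. Qed.

(** Absolute summability over the integers, for non-negative families. *)
Definition wsummable (g : int -> R) :=
  (forall m, 0 <= g m) /\ exists B, forall M, wsum g M <= B.

Lemma wsummable_le g h : wsummable h -> (forall m, 0 <= g m <= h m) -> wsummable g.
Proof.
move=> [h0 [B HB]] gh; split; first by move=> m; have /andP[] := gh m.
exists B => M; apply: le_trans (HB M); apply: ler_wsum => m _.
by have /andP[] := gh m.
Qed.

Lemma wsummableZ (a : R) g : 0 <= a -> wsummable g -> wsummable (fun m => a * g m).
Proof.
move=> a0 [g0 [B HB]]; split=> [m|]; first exact: mulr_ge0.
exists (a * B) => M; apply: le_trans (ler_wpM2l a0 (HB M)).
by rewrite /wsum mulrDr !mulr_sumr.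
Qed.

Lemma wsum_monotone (g : int -> R) : (forall m, 0 <= g m) ->
  forall M M', (M <= M')%N -> wsum g M <= wsum g M'.
Proof.
move=> g0 M M' /subnK <-; elim: (_ - _)%N => [|k IH] //.
by rewrite addSn wsumS; apply: le_trans IH _; rewrite lerDl addr_ge0.
Qed.

Lemma wsummable_tail g : wsummable g -> forall e, 0 < e -> exists M0,
  forall M, wsum g M - wsum g M0 < e.
Proof.
move=> [g0 [B HB]] e e0.
pose S : set R := [set wsum g M | M in [set: nat]].
have hS : has_sup S by split; [exists (wsum g 0), 0%N | exists B => _ [M _ <-]].
have [_ [M0 _ <-] H] := sup_adherent e0 hS.
exists M0 => M; rewrite ltrBlDl -ltrBlDr; apply: le_lt_trans H.
by rewrite lerB // ub_le_sup //; [case: hS | exists M].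
Qed.

Lemma wsum_drop (V : zmodType) (u : int -> V) (M0 M : nat) : (M0 <= M)%N ->
  wsum u M - wsum u M0 = wsum (fun m => if (`|m| <= M0)%N then 0 else u m) M.
Proof.
move=> MM; rewrite -(subnK MM); elim: (_ - _)%N => [|k IH].
  rewrite subrr (eq_wsum (h := fun=> 0)).
    by rewrite /wsum !big1_eq addr0.
  by move=> m ->.
rewrite addSn !wsumS -IH addrAC; congr (_ + _).
by rewrite !ifN // ?NegzE ?abszN ?absz_nat -ltnNge ltnS leq_addl.
Qed.

(** Dominated convergence for series (Tannery): outside a fixed window the sums
    of v and u are bounded by the tail of g, and inside it there are finitely
    many terms. *)
Lemma wsum_tannery g (v : nat -> int -> C) (u : int -> C) : wsummable g ->
  (forall (M : nat) (m : int), (`|m| <= M)%N -> abs (v M m) <= g m) ->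
  (forall m, abs (u m) <= g m) ->
  (forall m, v ^~ m @ \oo --> u m) ->
  (fun M => wsum (v M) M - wsum u M) @ \oo --> (0 : C).
Proof.
move=> sg vg ug vu; apply/cvgC_abs => e e0.
have e4 : 0 < e / 4 by lra.
have [M0 HM0] := wsummable_tail sg e4.
have cv0 : (fun M => wsum (v M) M0 - wsum u M0) @ \oo --> (0 : C).
  rewrite -[X in _ --> X](subrr (wsum u M0)); apply: cvgB; last exact: cvg_cst.
  by apply: cvgD; apply: cvg_big => [|i _]; first [exact: add_continuous | exact: vu].
have [M1 HM1] := (cvgC_abs _ _).1 cv0 _ e4.
exists (maxn M0 M1) => M; rewrite geq_max => /andP[MM0 MM1].
have tl w : (forall m : int, (`|m| <= M)%N -> abs (w m) <= g m) ->
  abs (wsum w M - wsum w M0) <= wsum g M - wsum g M0.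
  move=> wg; rewrite !wsum_drop //; apply: le_trans (abs_wsum _ _) _.
  by apply: ler_wsum => m mM; case: ifP => _; rewrite ?abs0 // wg.
have t1 := tl _ (vg M); have t2 := tl _ (fun m _ => ug m).
have t3 := HM0 M; have t4 := HM1 _ MM1.
rewrite subr0; rewrite subr0 in t4.
have -> : wsum (v M) M - wsum u M = (wsum (v M) M - wsum (v M) M0)
  - (wsum u M - wsum u M0) + (wsum (v M) M0 - wsum u M0) by ring.
apply: le_lt_trans (absD _ _) _.
apply: le_lt_trans (lerD (absB _ _) (lexx _)) _; lra.
Qed.

(** Comparison with h gives the convergence of the real and imaginary parts. *)
Lemma cvg_half_series (v : nat -> C) (h : nat -> R) (B : R) :
  (forall m, abs (v m) <= h m) -> (forall M, \sum_(m < M) h m <= B) ->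
  (fun M => \sum_(m < M) v m) @ \oo --> limn (series v).
Proof.
move=> vh hB.
have sE : (fun M => \sum_(m < M) v m) = series v.
  by apply/funext => M; rewrite /series /= big_mkord.
rewrite sE; suff : cvgn (series v) by [].
have h0 m : 0 <= h m by apply: le_trans (vh m); apply: abs_ge0.
have cvh : cvgn (series h).
  apply: nondecreasing_is_cvgn.
    by apply: nondecreasing_series => k _ _.
  by exists B => _ [M _ <-]; rewrite /series /= big_mkord.
have part (p : C -> R) : (forall z, `|p z| <= abs z) ->
    cvgn (series (fun m => p (v m))).
  move=> pa; apply: normed_cvg; apply: (series_le_cvg _ _ _ cvh) => // k /=.
    exact: normr_ge0.
  exact: le_trans (pa _) (vh _).
have cr := part (@complex.Re R) (@Re_abs R).
have ci := part (@complex.Im R) (@Im_abs R).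
apply/cvg_ex; exists (limn (series (fun m => complex.Re (v m)))
  +i* limn (series (fun m => complex.Im (v m)))).
apply/cvgC_abs => e e0; have e2 : 0 < e / 2 by lra.
move/cvgrPdist_lt : cr => /(_ _ e2) [N1 _ H1].
move/cvgrPdist_lt : ci => /(_ _ e2) [N2 _ H2].
exists (maxn N1 N2) => M; rewrite geq_max => /andP[/H1 /= h1 /H2 /= h2].
have sv : series v M = series (fun m => complex.Re (v m)) M
    +i* series (fun m => complex.Im (v m)) M.
  rewrite /series /=; elim: (M) => [|k IH]; first by rewrite !big_geq.
  by rewrite !big_nat_recr //= IH; case: (v k).
apply: le_lt_trans (abs_ReIm _) _; rewrite sv /= distrC [X in _ + X]distrC.
by rewrite [e]splitr ltrD.
Qed.

(** Connects bisum with window sums, to which dominated convergence and shifts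
    apply. *)
Lemma bisum_cvg (u : int -> C) g : wsummable g -> (forall m, abs (u m) <= g m) ->
  wsum u @ \oo --> bisum u.
Proof.
move=> [g0 [B gB]] ug; apply: cvgD.
  have := @cvg_half_series (fun m => u (Posz m)) (fun m => g (Posz m)) B.
  move=> /(_ (fun m => ug _)) H.
  have := H; rewrite -(cvg_shiftS (fun M => \sum_(m < M) u (Posz m))); apply.
  move=> M; apply: le_trans (gB M); rewrite /wsum big_ord_recr /=.
  by rewrite -addrA lerDl addr_ge0 // sumr_ge0.
apply: cvg_half_series (fun m => ug _) (_ : forall M, _ <= B) => M.
by apply: le_trans (gB M); rewrite lerDr sumr_ge0.
Qed.

Lemma abs_bisum (u : int -> C) g B :
  (forall m, 0 <= g m) -> (forall M, wsum g M <= B) ->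
  (forall m, abs (u m) <= g m) -> abs (bisum u) <= B.
Proof.
move=> g0 gB ug; have sg : wsummable g by split=> //; exists B.
rewrite leNgt; apply/negP => H.
have [M0 HM0] := (cvgC_abs _ _).1 (bisum_cvg sg ug) (abs (bisum u) - B) ltac:(lra).
have := HM0 M0 (leqnn _).
have : abs (wsum u M0) <= B.
  apply: le_trans (abs_wsum _ _) _; apply: le_trans (gB M0).
  exact: ler_wsum.
have := absB (wsum u M0 - bisum u) (wsum u M0).
by rewrite addrAC subrr add0r absN; lra.
Qed.

Lemma bisum_linear (a : C) (u v : int -> C) g :
  wsummable g -> (forall m, abs (u m) <= g m) ->
  (forall m, abs (v m) <= g m) ->
  bisum (fun m => a * u m + v m) = a * bisum u + bisum v.
Proof.
move=> sg ug vg; apply: (cvg_unique (@norm_hausdorff _ _) _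
  (_ : wsum (fun m => a * u m + v m) @ \oo --> _)).
  have sg2 : wsummable (fun m => (abs a + 1) * g m).
    by apply: wsummableZ => //; rewrite addr_ge0 ?abs_ge0.
  apply: (bisum_cvg sg2) => m; apply: le_trans (absD _ _) _.
  by rewrite mulrDl mul1r absM lerD // ler_wpM2l ?abs_ge0.
have -> : wsum (fun m => a * u m + v m) = (fun M => a * wsum u M + wsum v M).
  by apply/funext => M; rewrite wsumD wsumZ.
apply: cvgD; last exact: bisum_cvg sg vg.
by apply: cvgM; [exact: cvg_cst | exact: bisum_cvg sg ug].
Qed.

Lemma wsum_shift (u : int -> C) M :
  wsum (fun m => u (m + 1)) M = wsum u M + (u (Posz M.+1) - u (- Posz M)).
Proof.
elim: M => [|M IH].
  rewrite /wsum !big_ord_recr !big_ord0 /= oppr0 !add0r !addr0.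
  by rewrite addrC subrK.
rewrite !wsumS IH.
have -> : Posz M.+1 + 1 = Posz M.+2 by rewrite -PoszD addn1.
have -> : Negz M + 1 = - Posz M by rewrite NegzE -addn1 PoszD opprD subrK.
by rewrite !NegzE; ring.
Qed.

(** A shift changes a window sum by two boundary terms, which tend to 0 because
    they are part of the tail of a summable family. *)
Lemma bisum_shift (u : int -> C) g : wsummable g ->
  (forall m, abs (u m) <= g m) -> (forall m, abs (u (m + 1)) <= g m) ->
  bisum (fun m => u (m + 1)) = bisum u.
Proof.
move=> sg ug u1g; apply: (cvg_unique (@norm_hausdorff _ _)
   (bisum_cvg sg u1g)).
have -> : wsum (fun m => u (m + 1)) =
  (fun M => wsum u M + (u (Posz M.+1) - u (- Posz M))).
  by apply/funext => M; exact: wsum_shift.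
rewrite -[bisum u]addr0; apply: cvgD; first exact: bisum_cvg sg ug.
apply/cvgC_abs => e e0; have [M0 H] := wsummable_tail sg e0.
exists M0.+1 => -[//|M]; rewrite ltnS => MM; rewrite subr0.
apply: le_lt_trans (H M.+2); rewrite !wsumS -NegzE.
apply: le_trans (absB _ _) _.
have := ug (Posz M.+2); have := ug (Negz M).
case: sg => g0 _; have := wsum_monotone g0 MM.
by have := g0 (Posz M.+1); have := g0 (Negz M.+1); lra.
Qed.

End WindowSums.

(** * The theta series *)

Section ThetaSeries.
Variable R : realType.
Local Notation C := R[i].
Implicit Types z w tau : C.

Definition twopii : C := 2%:R * (pi%:C : C) * (0 +i* 1).

Lemma e2piE z : e2pi z = cexp (twopii * z). Proof. by []. Qed.
Lemma Re_twopii z : complex.Re (twopii * z) = - (2 * pi * complex.Im z).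
Proof. by case: z => a b; rewrite /twopii -(rmorph_nat (real_complex R)) /=; ring. Qed.
Lemma Im_twopii z : complex.Im (twopii * z) = 2 * pi * complex.Re z.
Proof. by case: z => a b; rewrite /twopii -(rmorph_nat (real_complex R)) /=; ring. Qed.
Lemma abs_twopii : abs twopii = 2 * pi.
Proof.
rewrite !absM abs_nat abs_real ger0_norm ?pi_ge0 //.
by rewrite /abs /= expr0n add0r expr1n sqrtr1 mulr1.
Qed.
Lemma e2piD z w : e2pi (z + w) = e2pi z * e2pi w.
Proof. by rewrite !e2piE mulrDr cexpD. Qed.
Lemma e2pi0 : e2pi (0 : C) = 1. Proof. by rewrite e2piE mulr0 cexp0. Qed.
Lemma e2piN z : e2pi (- z) = (e2pi z)^-1.
Proof. by rewrite !e2piE mulrN cexpN. Qed.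
Lemma e2pi_neq0 z : e2pi z != 0. Proof. exact: cexp_neq0. Qed.
Lemma abs_e2pi z : abs (e2pi z) = expR (- (2 * pi * complex.Im z)).
Proof. by rewrite e2piE abs_cexp Re_twopii. Qed.
Lemma e2pi1 : e2pi (1 : C) = 1.
Proof.
rewrite e2piE /cexp Re_twopii Im_twopii /= mulr0 oppr0 expR0 mulr1.
by rewrite [2 * pi]mulr_natl cos2pi sin2pi; simpc.
Qed.
Lemma e2pi_half : e2pi (2%:R^-1 : C) = -1.
Proof.
rewrite e2piE /cexp Re_twopii Im_twopii -(rmorph_nat (real_complex R)) -fmorphV /=.
rewrite mulr0 oppr0 expR0; have -> : 2 * pi / 2 = pi :> R by field.
by rewrite cospi sinpi; simpc.
Qed.
Lemma e2pi_real (x : R) :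
  e2pi (x%:C : C) = cos (2 * pi * x) +i* sin (2 * pi * x).
Proof.
by rewrite e2piE /cexp Re_twopii Im_twopii /= mulr0 oppr0 expR0 mul1r.
Qed.
Lemma e2piMn z n : e2pi (z *+ n) = e2pi z ^+ n.
Proof. by elim: n => [|n IH]; rewrite ?e2pi0 // mulrS exprS e2piD IH. Qed.
Lemma e2piMz z (m : int) : e2pi (m%:~R * z) = e2pi z ^ m.
Proof.
case: m => m; rewrite ?NegzE.
  by rewrite -[Posz m]/(m%:Z) mulr_natl e2piMn.
by rewrite mulrNz mulNr e2piN mulr_natl e2piMn -exprnN.
Qed.
Lemma e2pi_int (m : int) : e2pi (m%:~R : C) = 1.
Proof. by rewrite -[m%:~R]mulr1 e2piMz e2pi1 exp1rz. Qed.
Lemma e2piDint z (m : int) : e2pi (z + m%:~R) = e2pi z.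
Proof. by rewrite e2piD e2pi_int mulr1. Qed.

(** Reduction to the fractional part of x, where sin (pi y) > 0 unless y = 0. *)
Lemma sin_pi_eq0 (x : R) : sin (pi * x) = 0 -> exists m : int, x = m%:~R.
Proof.
move=> s0; exists (Num.floor x).
have /andP[h1 h2] := mem_rg1_floor x; set y := x - (Num.floor x)%:~R.
suff : y = 0 by move/eqP; rewrite subr_eq0 => /eqP.
have y0 : 0 <= y by rewrite subr_ge0.
have y1 : y < 1 by rewrite ltrBlDl.
have sy : sin (pi * y) = 0.
  rewrite /y; move: (Num.floor x) => m.
  have per (n : nat) (a : R) : sin a = 0 -> sin (a + pi *+ n) = 0.
    move=> sa; elim: n => [|n IH]; first by rewrite addr0.
    by rewrite mulrSr addrA sinDpi IH oppr0.
  rewrite mulrBr; case: m => n.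
    rewrite -[RHS]oppr0 -[in RHS](per n (- (pi * x))) ?sinN ?s0 ?oppr0 //.
    by rewrite -sinN opprD opprK mulr_natr.
  by rewrite NegzE mulrNz mulrN opprK mulr_natr per.
apply/eqP; rewrite eq_le y0 andbT leNgt; apply/negP => y0'.
have : 0 < sin (pi * y).
  apply: sin_gt0_pi; rewrite mulr_gt0 ?pi_gt0 //=.
  by rewrite -[ltRHS]mulr1 ltr_pM2l ?pi_gt0.
by rewrite sy ltxx.
Qed.

Lemma e2pi_eq1 z : e2pi z = 1 -> exists m : int, z = m%:~R.
Proof.
move=> ez; have := abs_e2pi z; rewrite ez abs1 => /esym.
have p0 := @pi_gt0 R.
rewrite -[RHS]expR0 => /expR_inj /eqP.
rewrite oppr_eq0 mulf_eq0 mulf_eq0 pnatr_eq0 /= (gt_eqF p0) /= => /eqP im0.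
have := congr1 (@complex.Re R) ez.
rewrite e2piE /cexp Re_twopii Im_twopii im0 mulr0 oppr0 expR0 /= mul0r mul1r subr0.
move=> c1; have := one_minus_cos (2 * pi * complex.Re z); rewrite c1 subrr.
have -> : 2 * pi * complex.Re z / 2 = pi * complex.Re z by field.
move=> /esym/eqP; rewrite mulf_eq0 pnatr_eq0 /= sqrf_eq0 => /eqP/sin_pi_eq0[m em].
exists m; case: z em im0 {ez c1} => a b /= -> ->.
by rewrite -(rmorph_int (real_complex R)).
Qed.

Lemma e2pi_taylor w :
  abs (e2pi w - 1 - twopii * w)
    <= 5 * (2 * pi * abs w) ^+ 2 * expR (2 * pi * abs w).
Proof. by rewrite -abs_twopii -absM; apply: cexp_taylor. Qed.

Lemma normr_intz (m : int) : `|m%:~R : R| = `|m|%N%:R.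
Proof.
by case: m => m; rewrite ?NegzE ?rmorphN ?normrN /= normr_nat ?absz_nat ?abszN.
Qed.

Lemma wsummable_geo : wsummable (fun m : int => (expR (-1) : R) ^+ `|m|%N).
Proof.
set q : R := expR (-1).
have q0 : 0 < q := expR_gt0 _.
have q1 : q < 1 by rewrite expR_lt1; lra.
split=> [m|]; first by rewrite exprn_ge0 // ltW.
have geo M : \sum_(m < M) q ^+ m <= (1 - q)^-1.
  have := subrX1 q M; rewrite -(big_mkord xpredT (fun i => q ^+ i)) => e.
  have qM : 0 <= q ^+ M by rewrite exprn_ge0 // ltW.
  rewrite big_mkord in e *.
  rewrite -[leRHS]mul1r ler_pdivlMr ?subr_gt0 //.
  by move: e; set S := \sum_(_ < _) _; nra.
exists ((1 - q)^-1 + (1 - q)^-1) => M; apply: lerD; first exact: geo.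
apply: le_trans (geo M); apply: ler_sum => i _.
rewrite NegzE abszN absz_nat exprS ler_piMl ?exprn_ge0 //; exact: ltW.
Qed.

(** Dominates the m-th term of theta on the strip 2 pi |Im z| <= A when
    t = Im tau; see tterm_le. *)
Definition gauss (A t : R) (m : int) : R :=
  expR (A * `|m|%N%:R - pi * t * (m * (m - 1))%:~R).

(** The quadratic exponent beats any linear one: completing the square bounds
    A k - pi t (k^2 - k) + k by the constant D, leaving the geometric series of
    ratio exp (-1). *)
Lemma wsummable_gauss A t : 0 < t -> wsummable (gauss A t).
Proof.
move=> t0; set s := pi * t; have s0 : 0 < s by rewrite mulr_gt0 ?pi_gt0.
set D := (A + s + 1) ^+ 2 / (4 * s).
apply: (wsummable_le (wsummableZ (expR_ge0 D) wsummable_geo)) => m.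
rewrite expR_ge0 /= -expRM_natr -expRD ler_expR.
have -> : (m * (m - 1))%:~R = (m%:~R ^+ 2 - m%:~R : R).
  by rewrite intrM intrB; ring.
have hm : (m%:~R : R) ^+ 2 = `|m|%N%:R ^+ 2.
  by rewrite -normr_intz real_normK ?num_real.
have lm : (m%:~R : R) <= `|m|%N%:R by rewrite -normr_intz ler_norm.
rewrite hm; move: lm; move: (m%:~R : R) (`|m|%N%:R : R) => x k xk.
have : A * k - s * (k ^+ 2 - x) + k <= D.
  rewrite /D ler_pdivlMr; last by rewrite mulr_gt0.
  have := sqr_ge0 (A + s + 1 - 2 * s * k).
  by have : s * x <= s * k; [rewrite ler_pM2l | nra].
by rewrite -/s; lra.
Qed.

Definition tterm tau z (m : int) : C :=
  (-1) ^ m * e2pi (m%:~R * z + (m * (m - 1))%:~R / 2%:R * tau).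

Lemma thetaE tau z : theta tau z = bisum (tterm tau z). Proof. by []. Qed.

Lemma abs_signz (m : int) : abs ((-1 : C) ^ m) = 1.
Proof.
by case: m => m; rewrite ?NegzE -?exprnN ?absV absX absN abs1 expr1n ?invr1.
Qed.

Lemma abs_tterm tau z m : abs (tterm tau z m) =
  expR (- (2 * pi * m%:~R * complex.Im z)
        - pi * complex.Im tau * (m * (m - 1))%:~R).
Proof.
rewrite absM abs_signz mul1r abs_e2pi; congr expR.
have Imint (k : int) (w : C) : complex.Im (k%:~R * w) = k%:~R * complex.Im w.
  by rewrite -(rmorph_int (real_complex R)); case: w => a b /=; ring.
have -> (x y : C) : complex.Im (x + y) = complex.Im x + complex.Im y.
  by case: x; case: y.
rewrite Imint -(mulrA _ _ tau) Imint.
have -> : complex.Im (2%:R^-1 * tau) = complex.Im tau / 2.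
  by rewrite -(rmorph_nat (real_complex R)) -fmorphV; case: tau => a b /=; ring.
by field.
Qed.

Lemma tterm_le tau z m (A : R) : 2 * pi * `|complex.Im z| <= A ->
  abs (tterm tau z m) <= gauss A (complex.Im tau) m.
Proof.
move=> hA; rewrite abs_tterm ler_expR lerD2r.
apply: le_trans (ler_norm _) _; rewrite normrN !normrM.
rewrite (ger0_norm (pi_ge0 R)) (ger0_norm (x := 2)) //.
rewrite normr_intz.
by rewrite mulrAC ler_wpM2r.
Qed.

Lemma tterm_le0 tau z m :
  abs (tterm tau z m) <= gauss (2 * pi * abs z) (complex.Im tau) m.
Proof. by apply: tterm_le; rewrite ler_wpM2l ?Im_abs // mulr_ge0 ?pi_ge0. Qed.

Lemma theta_cvg tau z : 0 < complex.Im tau ->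
  wsum (tterm tau z) @ \oo --> theta tau z.
Proof.
by move=> t0; apply: bisum_cvg (wsummable_gauss _ t0) (tterm_le0 tau z).
Qed.

Lemma thetaD1 tau z : theta tau (z + 1) = theta tau z.
Proof.
rewrite !thetaE; congr bisum; apply/funext => m; rewrite /tterm.
by rewrite mulrDr mulr1 addrAC e2piDint.
Qed.

Lemma thetaDint tau z (m : int) : theta tau (z + m%:~R) = theta tau z.
Proof.
case: m => m; rewrite ?NegzE.
  elim: m => [|m IH]; first by rewrite addr0.
  by rewrite -addn1 PoszD intrD addrA thetaD1.
elim: m => [|m IH].
  by rewrite -thetaD1 subrK.
by rewrite -[m.+2]addn1 PoszD opprD intrD addrA -[LHS]thetaD1 subrK.
Qed.

(** The numbers m (m - 1) / 2 in the exponents of theta are integers, whence its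
    invariance under tau |-> tau + 1. *)
Lemma pronic_half_int (m : int) : exists k : int, (m * (m - 1))%:~R / 2%:R = k%:~R :> C.
Proof.
have : (2 %| m * (m - 1))%Z.
  by have := divz_eq m 2; have := ltz_pmod m (d := 2) isT; have := modz_ge0 m (d:= 2) isT;
   move=> *; apply/dvdzP; exists ((m %/ 2)%Z * (2 * (m %/ 2)%Z + 2 * (m %% 2)%Z - 1)); nia.
by move=> /dvdzP[k ->]; exists k; rewrite intrM; field.
Qed.

Lemma theta_tauD1 tau z : theta (tau + 1) z = theta tau z.
Proof.
rewrite !thetaE; congr bisum; apply/funext => m; rewrite /tterm.
have [k ->] := pronic_half_int m.
by rewrite mulrDr mulr1 addrA e2piDint.
Qed.

Lemma bisum0 : bisum (fun=> 0 : C) = 0.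
Proof.
apply/eqP; rewrite -abs_eq0 eq_le abs_ge0 andbT.
apply: (@abs_bisum _ _ (fun=> 0)) => // [M|m]; last by rewrite abs0.
by rewrite /wsum !big1_eq addr0.
Qed.

Lemma bisumZ (a : C) (u : int -> C) g :
  wsummable g -> (forall m, abs (u m) <= g m) ->
  bisum (fun m => a * u m) = a * bisum u.
Proof.
move=> sg ug; rewrite -[RHS]addr0 -bisum0 -(bisum_linear a sg) //; last first.
  by move=> m; rewrite abs0; case: sg.
by congr bisum; apply/funext => m; rewrite addr0.
Qed.

(** Translation by tau turns the m-th term of the series into the (m+1)-st,
    up to a factor independent of m. *)
Lemma thetaDtau tau z : 0 < complex.Im tau ->
  theta tau (z + tau) = - e2pi (- z) * theta tau z.
Proof.
move=> t0.
have E m : tterm tau (z + tau) m = - e2pi (- z) * tterm tau z (m + 1).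
  rewrite /tterm exprzDr ?unitrN1 // expr1z mulrN1 !mulNr mulrN opprK (mulrCA (e2pi (- z))) -e2piD.
  by congr (_ * e2pi _); rewrite !intrM intrB intrD; field.
set A := 2 * pi * abs z; set B := 2 * pi * abs (z + tau).
(* g must dominate the series of z and its shift, which is the series of z + tau
   up to the factor e2pi z. *)
pose K := 1 + abs (e2pi z).
pose g m := gauss A (complex.Im tau) m + K * gauss B (complex.Im tau) m.
have K0 : 0 <= K by rewrite addr_ge0 ?abs_ge0.
have sg : wsummable g.
  have [a0 [BA hA]] := wsummable_gauss A t0.
  have [b0 [BB hB]] := wsummableZ K0 (wsummable_gauss B t0).
  split=> [m|]; first by rewrite addr_ge0.
  by exists (BA + BB) => M; rewrite wsumD lerD.
have g0 m : 0 <= gauss A (complex.Im tau) m by apply: expR_ge0.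
have g1 m : 0 <= gauss B (complex.Im tau) m by apply: expR_ge0.
have ug m : abs (tterm tau z m) <= g m.
  by apply: le_trans (tterm_le0 _ _ _) _; rewrite lerDl mulr_ge0.
have ug1 m : abs (tterm tau z (m + 1)) <= g m.
  have -> : tterm tau z (m + 1) = - e2pi z * tterm tau (z + tau) m.
    by rewrite E mulrA mulrNN -e2piD subrr e2pi0 mul1r.
  rewrite absM absN; apply: le_trans (_ : K * abs (tterm tau (z + tau) m) <= _).
    by rewrite ler_wpM2r ?abs_ge0 // lerDr.
  apply: le_trans (ler_wpM2l K0 (tterm_le0 _ _ _)) _.
  by rewrite lerDr.
rewrite !thetaE -(bisum_shift sg ug ug1) -(bisumZ _ sg ug1).
by congr bisum; apply/funext => m; rewrite E.
Qed.

End ThetaSeries.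

(** * The zeros of theta *)

Local Opaque e2pi cexp abs.

Section TripleProduct.
Variable R : realType.
Local Notation C := R[i].
Variables (tau : C) (tau_gt0 : 0 < complex.Im tau).

Definition qpow (a : int) : C := e2pi (a%:~R * tau).
Definition qnorm : R := expR (- (2 * pi * complex.Im tau)).

Lemma qpowD a b : qpow (a + b) = qpow a * qpow b.
Proof. by rewrite /qpow intrD mulrDl e2piD. Qed.
Lemma qpow0 : qpow 0 = 1. Proof. by rewrite /qpow mul0r e2pi0. Qed.
Lemma abs_qpow (n : nat) : abs (qpow n) = qnorm ^+ n.
Proof. by rewrite /qpow -[Posz n]/(n%:Z) mulr_natl e2piMn absX abs_e2pi. Qed.
Lemma qnorm_gt0 : 0 < qnorm. Proof. exact: expR_gt0. Qed.
Lemma qnorm_lt1 : qnorm < 1.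
Proof. by rewrite expR_lt1 oppr_lt0 !mulr_gt0 ?pi_gt0. Qed.
Lemma qnorm_le1 : qnorm <= 1. Proof. exact: ltW qnorm_lt1. Qed.
Lemma qnormX_ge0 n : 0 <= qnorm ^+ n. Proof. by rewrite exprn_ge0 // ltW // qnorm_gt0. Qed.

#[local] Hint Resolve qnorm_gt0 qnorm_lt1 qnorm_le1 qnormX_ge0 : core.

(** From 1 - x >= exp (- x / (1 - a)) on [0, a]. *)
Lemma prod_1B_ge (x : nat -> R) (a : R) N : a < 1 -> (forall j, 0 <= x j <= a) ->
  expR (- (\sum_(j < N) x j) / (1 - a)) <= \prod_(j < N) (1 - x j).
Proof.
move=> a1 xa; elim: N => [|N IH].
  by rewrite !big_ord0 oppr0 mul0r expR0.
rewrite !big_ord_recr /= opprD mulrDl expRD.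
have /andP[x0 x1] := xa N.
apply: ler_pM => //; try exact: expR_ge0.
rewrite mulNr expRN -[leRHS]invrK lef_pV2 ?posrE ?expR_gt0 ?invr_gt0 ?subr_gt0 //.
  apply: le_trans (expR_ge1Dx _); rewrite -[leLHS]mul1r ler_pdivrMr ?subr_gt0 //; last lra.
  have : x N <= x N / (1 - a) * (1 - x N) by rewrite mulrAC ler_pdivlMr ?subr_gt0 // ler_wpM2l //; lra.
  by lra.
lra.
Qed.

Lemma sum_geo_le (N : nat) : \sum_(j < N) qnorm ^+ j <= (1 - qnorm)^-1.
Proof.
have := subrX1 qnorm N; rewrite -(big_mkord xpredT (fun i => qnorm ^+ i)) big_mkord => e.
rewrite -[leRHS]mul1r ler_pdivlMr ?subr_gt0 //.
by move: e (qnormX_ge0 N); set S := \sum_(_ < _) _; nra.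
Qed.

(** The q-Pochhammer symbol (q; q)_n; its inverse is extended by 0 to negative
    indices, so that inv_qpochB1 holds for all integers. *)
Definition qpoch n : C := \prod_(j < n) (1 - qpow (Posz j.+1)).
Definition inv_qpoch (a : int) : C := if a is Posz n then (qpoch n)^-1 else 0.

Lemma one_subr_qpow_neq0 n : 1 - qpow (Posz n.+1) != 0.
Proof.
rewrite subr_eq0 eq_sym; apply/eqP => /(congr1 (@abs R)).
rewrite abs1 abs_qpow => e; have : qnorm ^+ n.+1 < 1 by rewrite exprn_ilt1 // ltW.
by rewrite e ltxx.
Qed.

Lemma qpoch_neq0 n : qpoch n != 0.
Proof. by apply/prodf_neq0 => i _; apply: one_subr_qpow_neq0. Qed.

Lemma inv_qpochB1 a : inv_qpoch (a - 1) = (1 - qpow a) * inv_qpoch a.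
Proof.
case: a => [[|n]|n].
- by rewrite qpow0 subrr mul0r.
- have -> : Posz n.+1 - 1 = Posz n by rewrite -addn1 PoszD addrK.
  by rewrite /= /qpoch big_ord_recr /= invfM mulrCA mulfV ?mulr1 // one_subr_qpow_neq0.
- by rewrite NegzE -opprD -PoszD addn1 -NegzE /= mulr0.
Qed.

Lemma qpoch_bounds : exists2 d : R, 0 < d & exists D : R,
  forall n, d <= abs (qpoch n) <= D.
Proof.
exists (expR (- (qnorm / (1 - qnorm)) / (1 - qnorm))); first exact: expR_gt0.
exists (expR (qnorm / (1 - qnorm))) => n; rewrite /qpoch abs_prod.
have S : \sum_(j < n) qnorm ^+ j.+1 <= qnorm / (1 - qnorm).
  under eq_bigr do rewrite exprS.
  by rewrite -mulr_sumr ler_pM2l // sum_geo_le.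
apply/andP; split.
  apply: le_trans (_ : \prod_(j < n) (1 - qnorm ^+ j.+1) <= _); last first.
    apply: ler_prod => j _; rewrite subr_ge0 exprn_ile1 ?(ltW qnorm_gt0) //=.
    have := absD (1 - qpow (Posz j.+1)) (qpow (Posz j.+1)).
    by rewrite subrK abs1 abs_qpow; lra.
  apply: le_trans (_ : expR (- (\sum_(j < n) qnorm ^+ j.+1) / (1 - qnorm)) <= _).
    by rewrite ler_expR ler_pM2r ?invr_gt0 ?subr_gt0 // lerN2.
  apply: (@prod_1B_ge (fun j => qnorm ^+ j.+1)) => // j.
  by rewrite qnormX_ge0 /= exprS ler_piMr ?exprn_ile1 ?ltW.
apply: le_trans (_ : \prod_(j < n) expR (qnorm ^+ j.+1) <= _).
  apply: ler_prod => j _; rewrite abs_ge0 /=.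
  by apply: le_trans (absB _ _) _; rewrite abs1 abs_qpow expR_ge1Dx.
by rewrite -expR_sum ler_expR.
Qed.

Lemma wsum_eq0 (u : int -> C) M : (forall m : int, (`|m| <= M)%N -> u m = 0) ->
  wsum u M = 0.
Proof.
move=> u0; rewrite (@eq_wsum _ _ (fun=> 0)) //.
by rewrite /wsum !big1_eq addr0.
Qed.

Definition triple_prod z N : C :=
  \prod_(m < N) ((1 - qpow m * e2pi z) * (1 - qpow (Posz m.+1) * e2pi (- z))).

(** The q-binomial coefficient [2N, N + k] divided by (q; q)_2N. *)
Definition triple_coef (N : nat) (k : int) : C := inv_qpoch (Posz N + k) * inv_qpoch (Posz N - k).

Lemma triple_coef_out N (k : int) : (N < `|k|)%N -> triple_coef N k = 0.
Proof.
move=> Nk; rewrite /triple_coef; case: k Nk => k; rewrite ?NegzE ?abszN absz_nat => Nk.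
  have -> : Posz N - Posz k = Negz (k - N).-1 by lia.
  by rewrite mulr0.
have -> : Posz N - Posz k.+1 = Negz (k - N) by lia.
by rewrite mul0r.
Qed.

Lemma tterm_up z k : e2pi z * tterm tau z k = - qpow (- k) * tterm tau z (k + 1).
Proof.
rewrite /tterm exprzDr ?unitrN1 // expr1z mulrN1 !mulNr mulrN opprK /qpow.
rewrite mulrCA [RHS]mulrCA -!e2piD.
by congr (_ * e2pi _); rewrite !intrM intrB intrD intrN; field.
Qed.

Lemma tterm_down z k : e2pi (- z) * tterm tau z (k + 1) = - qpow k * tterm tau z k.
Proof.
apply: (mulfI (e2pi_neq0 z)); rewrite mulrA -e2piD subrr e2pi0 mul1r mulrCA.
by rewrite tterm_up mulrA mulrNN -qpowD subrr qpow0 mul1r.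
Qed.

(** The finite Jacobi triple product, a form of the q-binomial theorem. Each new
    pair of factors shifts the index of the sum by one in either direction, and
    the claim becomes a three-term relation between the coefficients for N and
    N + 1. *)
Lemma finite_triple z N M : (N <= M)%N ->
  triple_prod z N = qpoch (2 * N) * wsum (fun k => triple_coef N k * tterm tau z k) M.
Proof.
elim: N M => [|N IH] M NM.
  rewrite /triple_prod /qpoch !big_ord0 mul1r.
  rewrite /wsum big_ord_recl /= [X in _ + X + _]big1 => [|i _]; last first.
    by rewrite triple_coef_out ?mul0r.
  rewrite [X in _ + X]big1 => [|i _]; last by rewrite triple_coef_out ?mul0r.
  rewrite !addr0 /triple_coef /= /qpoch big_ord0 /tterm !mul0r addr0 e2pi0.
  by rewrite invr1 expr0z !mulr1.
rewrite /triple_prod big_ord_recr /= -/(triple_prod z N) (IH M (ltnW NM)).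
set f := fun k => triple_coef N k * tterm tau z k.
(* The boundary terms of the shifts vanish because M > N. *)
have up : e2pi z * wsum f M
    = wsum (fun k => - qpow (1 - k) * triple_coef N (k - 1) * tterm tau z k) M.
  have := wsum_shift (fun k => - qpow (1 - k) * triple_coef N (k - 1) * tterm tau z k) M.
  rewrite [triple_coef N (Posz M.+1 - 1)]triple_coef_out; last by rewrite -(addn1 M) PoszD addrK absz_nat.
  rewrite [triple_coef N (- Posz M - 1)]triple_coef_out; last first.
    by rewrite -opprD -PoszD abszN absz_nat addn1 ltnW.
  rewrite mulr0 mul0r mulr0 mul0r subrr addr0 => <-.
  rewrite -wsumZ; apply: eq_wsum => k _.
  by rewrite /f mulrCA tterm_up addrK opprD addrCA subrr addr0 mulrCA mulrA.
have down : e2pi (- z) * wsum f M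
    = wsum (fun k => - qpow k * triple_coef N (k + 1) * tterm tau z k) M.
  have := wsum_shift (fun k => - qpow (k - 1) * triple_coef N k * tterm tau z (k - 1)) M.
  rewrite [triple_coef N (Posz M.+1)]triple_coef_out; last by rewrite absz_nat ltnW.
  rewrite [triple_coef N (- Posz M)]triple_coef_out; last by rewrite abszN absz_nat.
  rewrite mulr0 mul0r mulr0 mul0r subrr addr0 => e.
  rewrite -wsumZ.
  transitivity (wsum (fun k => - qpow (k - 1) * triple_coef N k * tterm tau z (k - 1)) M).
    apply: eq_wsum => k _; rewrite /f mulrCA.
    by have := tterm_down z (k - 1); rewrite subrK => ->; rewrite mulrCA mulrA.
  by rewrite -e; apply: eq_wsum => k _; rewrite addrK.
set W := wsum f M in up down *.
have e0 : e2pi z * e2pi (- z) = 1 by rewrite -e2piD subrr e2pi0.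
have -> : qpoch (2 * N) * W * ((1 - qpow N * e2pi z) * (1 - qpow (Posz N.+1) * e2pi (- z)))
  = qpoch (2 * N) * ((1 + qpow N * qpow (Posz N.+1)) * W - qpow N * (e2pi z * W)
     - qpow (Posz N.+1) * (e2pi (- z) * W)).
  transitivity (qpoch (2 * N) * ((1 + qpow N * qpow (Posz N.+1)
      * (e2pi z * e2pi (- z))) * W - qpow N * (e2pi z * W)
     - qpow (Posz N.+1) * (e2pi (- z) * W))); first by ring.
  by rewrite e0 mulr1.
rewrite up down.
have -> : qpoch (2 * N.+1)
    = qpoch (2 * N) * ((1 - qpow (Posz (2 * N).+1)) * (1 - qpow (Posz (2 * N).+2))).
  by rewrite mulnS add2n /qpoch !big_ord_recr /= mulrA.
rewrite -[RHS]mulrA; congr (_ * _).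
pose g1 k := - qpow (1 - k) * triple_coef N (k - 1) * tterm tau z k.
pose g2 k := - qpow k * triple_coef N (k + 1) * tterm tau z k.
rewrite -/g1 -/g2 -(wsumZ _ f) -(wsumZ _ g1) -(wsumZ _ g2).
rewrite -wsumB -wsumB -(wsumZ _ (fun k => triple_coef N.+1 k * tterm tau z k)).
apply: eq_wsum => k _; rewrite /g1 /g2 /f {g1 g2 f up down W}.
(* Everything is a polynomial in A, B and q^-1 times the coefficient for N + 1. *)
pose A := qpow (Posz N + k + 1); pose B := qpow (Posz N - k + 1).
have cN : triple_coef N k = (1 - A) * (1 - B) * triple_coef N.+1 k.
  rewrite /triple_coef -addn1 PoszD.
  have -> : Posz N + k = Posz N + 1 + k - 1 by ring.
  have -> : Posz N - k = Posz N + 1 - k - 1 by ring.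
  rewrite !inv_qpochB1 /A /B.
  have -> : Posz N + k + 1 = Posz N + 1 + k by ring.
  have -> : Posz N - k + 1 = Posz N + 1 - k by ring.
  by rewrite mulrACA.
have cNm : triple_coef N (k - 1) = (1 - A * qpow (-1)) * (1 - A) * triple_coef N.+1 k.
  rewrite /triple_coef -addn1 PoszD.
  have -> : Posz N + (k - 1) = Posz N + 1 + k - 1 - 1 by ring.
  have -> : Posz N - (k - 1) = Posz N + 1 - k by ring.
  rewrite !inv_qpochB1 /A -qpowD.
  have -> : Posz N + k + 1 = Posz N + 1 + k by ring.
  by rewrite !mulrA.
have cNp : triple_coef N (k + 1) = (1 - B * qpow (-1)) * (1 - B) * triple_coef N.+1 k.
  rewrite /triple_coef -addn1 PoszD.
  have -> : Posz N + (k + 1) = Posz N + 1 + k by ring.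
  have -> : Posz N - (k + 1) = Posz N + 1 - k - 1 - 1 by ring.
  rewrite !inv_qpochB1 /B -qpowD.
  have -> : Posz N - k + 1 = Posz N + 1 - k by ring.
  by rewrite mulrC -!mulrA; congr (_ * _); congr (_ * _); rewrite mulrC.
rewrite cN cNm cNp.
have hB : qpow N * qpow (1 - k) = B by rewrite -qpowD; congr qpow; ring.
have hA : qpow (Posz N.+1) * qpow k = A.
  by rewrite -qpowD; congr qpow; rewrite -addn1 PoszD; ring.
have -> : qpow N * (- qpow (1 - k) * ((1 - A * qpow (-1)) * (1 - A) * triple_coef N.+1 k) * tterm tau z k)
   = - B * ((1 - A * qpow (-1)) * (1 - A) * triple_coef N.+1 k) * tterm tau z k.
  by rewrite -hB; ring.
have -> : qpow (Posz N.+1) * (- qpow k * ((1 - B * qpow (-1)) * (1 - B) * triple_coef N.+1 k) * tterm tau z k)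
   = - A * ((1 - B * qpow (-1)) * (1 - B) * triple_coef N.+1 k) * tterm tau z k.
  by rewrite -hA; ring.
have -> : qpow N * qpow (Posz N.+1) = A * B * qpow (-1).
  by rewrite -!qpowD; congr qpow; rewrite -addn1 PoszD; ring.
have -> : qpow (Posz (2 * N).+1) = A * B * qpow (-1).
  by rewrite -!qpowD; congr qpow; rewrite -addn1 PoszD PoszM; ring.
have -> : qpow (Posz (2 * N).+2) = A * B.
  by rewrite -!qpowD; congr qpow; rewrite -addn2 PoszD PoszM; ring.
ring.
Qed.

Lemma qpow_cvg0 (k : int) : (fun N : nat => qpow (Posz N + k)) @ \oo --> (0 : C).
Proof.
rewrite -[0 in X in _ --> X](mul0r (qpow k)).
have -> : (fun N : nat => qpow (Posz N + k)) = (fun N => qpow N * qpow k).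
  by apply/funext => N; rewrite qpowD.
apply: cvgM; last exact: cvg_cst.
apply/cvgC_abs => e e0.
have : (fun N => qnorm ^+ N) @ \oo --> 0 by apply: cvg_expr; rewrite ger0_norm ?ltW.
move=> /cvgrPdist_lt /(_ e e0) [N0 _ H]; exists N0 => N /H /=.
by rewrite subr0 sub0r normrN ger0_norm ?abs_qpow ?qnormX_ge0.
Qed.

Lemma inv_qpoch_ratio (k : int) :
  (fun N : nat => inv_qpoch (Posz N + k) * qpoch N) @ \oo --> (1 : C).
Proof.
have oneB j : (fun N : nat => 1 - qpow (Posz N + j)) @ \oo --> (1 : C).
  by have := cvgB (cvg_cst (1 : C)) (qpow_cvg0 j); rewrite subr0; apply.
elim: k => [|k IH|k IH].
- have -> : (fun N : nat => inv_qpoch (Posz N + 0) * qpoch N) = fun=> 1.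
    by apply/funext => N; rewrite addr0 /= mulVf ?qpoch_neq0.
  exact: cvg_cst.
- have E (N : nat) : inv_qpoch (Posz N + Posz k.+1) * qpoch N =
     (1 - qpow (Posz N + Posz k.+1))^-1 * (inv_qpoch (Posz N + k) * qpoch N).
    have -> : Posz N + Posz k = Posz N + Posz k.+1 - 1.
      by rewrite -addn1 PoszD; ring.
    by rewrite inv_qpochB1 -PoszD addnS -mulrA mulKf ?one_subr_qpow_neq0.
  under eq_fun do rewrite E.
  by have := cvgM (cvgV (oner_neq0 _) (oneB (Posz k.+1))) IH; rewrite invr1 mulr1; apply.
- have E (N : nat) : inv_qpoch (Posz N + - Posz k.+1) * qpoch N =
     (1 - qpow (Posz N + - Posz k)) * (inv_qpoch (Posz N + - Posz k) * qpoch N).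
    have -> : Posz N - Posz k.+1 = Posz N - Posz k - 1.
      by rewrite -addn1 PoszD; ring.
    by rewrite inv_qpochB1 -mulrA.
  under eq_fun do rewrite E.
  by have := cvgM (oneB (- Posz k)) IH; rewrite mulr1; apply.
Qed.

(** The limit N -> oo of the finite identity, multiplied by (q; q)_N^2 so that its
    coefficients are bounded and tend to 1. *)
Lemma theta_triple_prod z :
  (fun N => qpoch N ^+ 2 / qpoch (2 * N) * triple_prod z N) @ \oo --> theta tau z.
Proof.
pose v N k := inv_qpoch (Posz N + k) * qpoch N * (inv_qpoch (Posz N - k) * qpoch N)
   * tterm tau z k.
have -> : (fun N => qpoch N ^+ 2 / qpoch (2 * N) * triple_prod z N) =
  (fun N => wsum (v N) N).
  apply/funext => N; rewrite (finite_triple z (leqnn N)).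
  rewrite mulrA mulfVK ?qpoch_neq0 // -wsumZ; apply: eq_wsum => k _.
  by rewrite /v /triple_coef; ring.
have [d d0 [D dD]] := qpoch_bounds.
have D0 : 0 <= D by have /andP[_] := dD 0%N; apply: le_trans; apply: abs_ge0.
pose K := 1 + (d^-1 * D) ^+ 2.
have K1 : 1 <= K by rewrite lerDl sqr_ge0.
pose g m := K * gauss (2 * pi * abs z) (complex.Im tau) m.
have sg : wsummable g by apply: wsummableZ; [lra | exact: wsummable_gauss].
have rb a N : abs (inv_qpoch a * qpoch N) <= d^-1 * D.
  rewrite absM; apply: ler_pM; rewrite ?abs_ge0 //; last by case/andP: (dD N).
  case: a => n; last by rewrite [inv_qpoch _]/= abs0 invr_ge0 ltW.
  rewrite [inv_qpoch _]/=; have /andP[dn _] := dD n.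
  by rewrite absV lef_pV2 ?posrE // (lt_le_trans d0).
have : (fun N => wsum (v N) N - wsum (tterm tau z) N) @ \oo --> (0 : C).
  apply: (wsum_tannery sg) => [N k _|k|k].
  - rewrite absM absM; apply: ler_pM; rewrite ?abs_ge0 ?tterm_le0 ?mulr_ge0 ?abs_ge0 //.
    apply: le_trans (_ : (d^-1 * D) ^+ 2 <= _); last by rewrite lerDr.
    by rewrite expr2 ler_pM ?abs_ge0.
  - apply: le_trans (tterm_le0 _ _ _) _.
    by rewrite -[leLHS]mul1r ler_wpM2r ?expR_ge0.
  - have := cvgM (cvgM (inv_qpoch_ratio k) (inv_qpoch_ratio (- k)))
      (cvg_cst (tterm tau z k)).
    by rewrite !mul1r; apply.
move=> h; have := cvgD h (@theta_cvg _ tau z tau_gt0); rewrite add0r.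
have -> : (fun N => wsum (v N) N - wsum (tterm tau z) N) + wsum (tterm tau z)
  = (fun N => wsum (v N) N) by apply/funext => N; rewrite fctE subrK.
by apply.
Qed.

(** The first factor of the product vanishes at 0. *)
Lemma theta0 : theta tau 0 = 0.
Proof.
apply/esym; move: (@theta_triple_prod 0); apply: cvg_unique; first exact: norm_hausdorff.
apply/cvgC_abs => e e0; exists 1%N => -[//|N] _.
rewrite /triple_prod big_ord_recl /= qpow0 e2pi0 mulr1 subrr !mul0r mulr0 subr0.
by rewrite abs0.
Qed.

(** A product of non-zero factors that tend to 1 geometrically stays away from 0:
    only finitely many of them are far from 1. *)
Lemma prod_1B_away0 (x : nat -> C) (A : R) :
  (forall m, abs (x m) <= A * qnorm ^+ m) -> (forall m, 1 - x m != 0) ->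
  exists2 d : R, 0 < d &
    exists N0, forall N, (N0 <= N)%N -> d <= abs (\prod_(m < N) (1 - x m)).
Proof.
move=> xA x1; have A0 : 0 <= A by have := xA 0%N; rewrite mulr1; apply: le_trans; apply: abs_ge0.
have [N0 HN0] : exists N0, forall m, (N0 <= m)%N -> A * qnorm ^+ m <= 2^-1.
  have : (fun N => A * qnorm ^+ N) @ \oo --> A * 0.
    by apply: cvgM; [exact: cvg_cst | apply: cvg_expr; rewrite ger0_norm ?ltW].
  rewrite mulr0 => /cvgrPdist_lt /(_ 2^-1 ltac:(by [])) [N0 _ H].
  exists N0 => m /H /=; rewrite sub0r normrN ger0_norm ?mulr_ge0 //; exact: ltW.
pose d := abs (\prod_(m < N0) (1 - x m)) * expR (- (A / (1 - qnorm)) / (1 - 2^-1)).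
exists d.
  rewrite mulr_gt0 ?expR_gt0 // abs_gt0; apply/prodf_neq0 => i _; exact: x1.
exists N0 => N /subnKC <-; rewrite big_split_ord /= absM.
apply: ler_wpM2l; first exact: abs_ge0.
pose y j := A * qnorm ^+ (N0 + j).
apply: le_trans (_ : expR (- (\sum_(j < N - N0) y j) / (1 - 2^-1)) <= _).
  rewrite ler_expR ler_pM2r ?invr_gt0; last lra.
  rewrite lerN2 -mulr_sumr ler_wpM2l //; apply: le_trans (sum_geo_le (N - N0)).
  by apply: ler_sum => j _; rewrite exprD ler_piMl // exprn_ile1 // ltW.
apply: le_trans (prod_1B_ge _ _ _) _; first lra.
  by move=> j; rewrite mulr_ge0 //= HN0 // leq_addr.
rewrite abs_prod; apply: ler_prod => j _.
have := HN0 (N0 + j)%N (leq_addr _ _) => hj; rewrite subr_ge0.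
apply/andP; split; first by rewrite /y; lra.
have := absD (1 - x (N0 + j)%N) (x (N0 + j)%N); rewrite subrK abs1.
by have := xA (N0 + j)%N; rewrite /y; lra.
Qed.

(** Off the lattice no factor of the triple product vanishes, so that the partial
    products are bounded below. *)
Lemma theta_neq0 z : (forall a b : int, z <> a%:~R + b%:~R * tau) ->
  theta tau z != 0.
Proof.
move=> zL.
have [d d0 [D dD]] := qpoch_bounds.
have D0 : 0 < D by have /andP[h1 h2] := dD 0%N; lra.
have ne w : (forall a b : int, w <> a%:~R + b%:~R * tau) ->
    forall (m : int), 1 - qpow m * e2pi w != 0.
  move=> wL m; rewrite subr_eq0 eq_sym -e2piD; apply/eqP => /e2pi_eq1[a ea].
  by apply: (wL a (- m)); rewrite -ea intrN; ring.
have zNL : forall a b : int, - z <> a%:~R + b%:~R * tau.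
  by move=> a b e; apply: (zL (- a) (- b)); rewrite !intrN -[z]opprK e; ring.
have [|m|d1 d10 [N1 H1]] := @prod_1B_away0 (fun m => qpow m * e2pi z) (abs (e2pi z)).
- by move=> m; rewrite absM abs_qpow mulrC.
- exact: ne.
have [|m|d2 d20 [N2 H2]] :=
  @prod_1B_away0 (fun m => qpow (Posz m.+1) * e2pi (- z)) (abs (e2pi (- z))).
- move=> m; rewrite absM abs_qpow mulrC ler_wpM2l ?abs_ge0 // exprS.
  by rewrite ler_piMl // ltW.
- exact: ne.
pose del := d ^+ 2 / D * (d1 * d2).
have del0 : 0 < del by rewrite mulr_gt0 ?divr_gt0 ?exprn_gt0 ?mulr_gt0.
apply/eqP => t0; have [N0 H] := (cvgC_abs _ _).1 (@theta_triple_prod z) _ del0.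
pose N := maxn N0 (maxn N1 N2).
have := H N (leq_maxl _ _); rewrite t0 subr0 ltNge => /negP; apply.
rewrite absM; apply: ler_pM.
- by rewrite divr_ge0 ?sqr_ge0 // ltW.
- by rewrite mulr_ge0 // ltW.
- rewrite absM absX absV; apply: ler_pM.
  + exact: sqr_ge0.
  + by rewrite invr_ge0 ltW.
  + by rewrite ler_pXn2r ?nnegrE ?abs_ge0 ?(ltW d0) //; case/andP: (dD N).
  + have /andP[h1 h2] := dD (2 * N)%N; rewrite lef_pV2 ?posrE // (lt_le_trans d0) //.
- rewrite /triple_prod big_split absM; apply: ler_pM; [exact: ltW|exact: ltW| |].
  + by apply: H1; rewrite /N !leq_max leqnn orbT.
  + by apply: H2; rewrite /N !leq_max leqnn !orbT.
Qed.

End TripleProduct.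

(** * Uniform first-order expansions *)

Section Tame.
Variable R : realType.
Local Notation C := R[i].
Implicit Types (f g h : C -> C) (z w : C).

(** A substitute for holomorphy: on each disc, bounds for h, its derivative dh and
    the remainder of the first-order expansion. It is elementary to check, holds
    for theta, and is all the analysis that the uniqueness of theta needs. *)
Definition tame_with (h dh : C -> C) := forall rho : R, exists2 K : R, 0 <= K &
  forall z w, abs z <= rho -> abs w <= rho ->
  [/\ abs (h z) <= K, abs (dh z) <= K &
      abs (h (z + w) - h z - w * dh z) <= K * abs w ^+ 2].

Definition tame h := exists dh, tame_with h dh.

Lemma tame_cst (c : C) : tame (fun=> c).
Proof.
exists (fun=> 0) => rho; exists (abs c); first exact: abs_ge0.
move=> z w _ _; split => //; rewrite ?abs0 ?abs_ge0 //.
by rewrite subrr mulr0 subrr abs0 mulr_ge0 ?sqr_ge0 ?abs_ge0.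
Qed.

Lemma tame_id : tame id.
Proof.
exists (fun=> 1) => rho; exists (`|rho| + 1) => [|z w zr _]; first by rewrite addr_ge0.
split; first by have := ler_norm rho; lra.
  by rewrite abs1 lerDr.
have -> : z + w - z - w * 1 = 0 by ring.
by rewrite abs0 mulr_ge0 ?sqr_ge0 ?addr_ge0.
Qed.

Lemma tameD f g : tame f -> tame g -> tame (fun z => f z + g z).
Proof.
move=> [df tf] [dg tg]; exists (fun z => df z + dg z) => rho.
have [K K0 HK] := tf rho; have [L L0 HL] := tg rho.
exists (K + L) => [|z w zr wr]; first exact: addr_ge0.
have [f1 f2 f3] := HK z w zr wr; have [g1 g2 g3] := HL z w zr wr.
split; try by apply: le_trans (absD _ _) _; apply: lerD.
have -> : f (z + w) + g (z + w) - (f z + g z) - w * (df z + dg z)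
  = (f (z + w) - f z - w * df z) + (g (z + w) - g z - w * dg z) by ring.
by apply: le_trans (absD _ _) _; rewrite mulrDl lerD.
Qed.

Lemma tameM f g : tame f -> tame g -> tame (fun z => f z * g z).
Proof.
move=> [df tf] [dg tg]; exists (fun z => df z * g z + f z * dg z) => rho.
have [K K0 HK] := tf rho; have [L L0 HL] := tg rho.
exists (K * L + K * L + (K * L + (K + K * `|rho|) * (L + L * `|rho|))).
  by rewrite !addr_ge0 ?mulr_ge0 ?addr_ge0 ?mulr_ge0.
move=> z w zr wr.
have [f1 f2 f3] := HK z w zr wr; have [g1 g2 g3] := HL z w zr wr.
have KL0 : 0 <= K * L by rewrite mulr_ge0.
have X0 : 0 <= (K + K * `|rho|) * (L + L * `|rho|).
  by rewrite mulr_ge0 ?addr_ge0 ?mulr_ge0.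
have w0 := abs_ge0 w.
have wr' : abs w <= `|rho| by apply: le_trans wr _; apply: ler_norm.
have ineq (a b : C) (x y : R) : 0 <= x -> 0 <= y -> abs a <= x -> abs b <= y ->
  abs (a * b) <= x * y by move=> *; rewrite absM ler_pM ?abs_ge0.
split.
- by apply: le_trans (ineq _ _ _ _ K0 L0 f1 g1) _; lra.
- apply: le_trans (absD _ _) _.
  have := ineq _ _ _ _ K0 L0 f2 g1; have := ineq _ _ _ _ K0 L0 f1 g2; lra.
set ef := f (z + w) - f z - w * df z in f3.
set eg := g (z + w) - g z - w * dg z in g3.
have -> : f (z + w) * g (z + w) - f z * g z - w * (df z * g z + f z * dg z)
  = ef * g z + f z * eg + (w * df z + ef) * (w * dg z + eg).
  by rewrite /ef /eg; ring.
have K20 : 0 <= K * abs w ^+ 2 by rewrite mulr_ge0 ?sqr_ge0.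
have L20 : 0 <= L * abs w ^+ 2 by rewrite mulr_ge0 ?sqr_ge0.
have a1 := ineq _ _ _ _ K20 L0 f3 g1.
have a2 := ineq _ _ _ _ K0 L20 f1 g3.
have lin e d M : 0 <= M -> abs d <= M -> abs e <= M * abs w ^+ 2 ->
   abs (w * d + e) <= abs w * (M + M * `|rho|).
  move=> M0 dM eM; apply: le_trans (absD _ _) _; rewrite absM mulrDr.
  apply: lerD; first by rewrite ler_wpM2l.
  apply: le_trans eM _; rewrite expr2 !mulrA mulrC -!mulrA ler_wpM2l //.
  by rewrite ler_wpM2l.
have b1 := lin _ _ _ K0 f2 f3; have b2 := lin _ _ _ L0 g2 g3.
have a3 := ineq _ _ _ _ (le_trans (abs_ge0 _) b1) (le_trans (abs_ge0 _) b2) b1 b2.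
apply: le_trans (absD _ _) _; apply: le_trans (lerD (absD _ _) (lexx _)) _.
apply: le_trans (lerD (lerD a1 a2) a3) _.
have w2 := sqr_ge0 (abs w).
have KLw : 0 <= K * L * abs w ^+ 2 by rewrite mulr_ge0.
rewrite !mulrDl; move: KLw w2 w0; rewrite !expr2; nra.
Qed.

Lemma tame_comp f g : tame f -> tame g -> tame (fun z => f (g z)).
Proof.
move=> [df tf] [dg tg]; exists (fun z => dg z * df (g z)) => rho.
have [L L0 HL] := tg rho.
pose M := L + L * `|rho|; have M0 : 0 <= M by rewrite addr_ge0 ?mulr_ge0.
have [K K0 HK] := tf (L + M * `|rho|).
exists (K + L * K + (K * M ^+ 2 + L * K)).
  by rewrite !addr_ge0 ?mulr_ge0 ?sqr_ge0.
move=> z w zr wr; have [g1 g2 g3] := HL z w zr wr.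
have w0 := abs_ge0 w.
have wr' : abs w <= `|rho| by apply: le_trans wr _; apply: ler_norm.
set v := g (z + w) - g z.
have vM : abs v <= M * abs w.
  have -> : v = w * dg z + (v - w * dg z) by ring.
  apply: le_trans (absD _ _) _; rewrite absM mulrDl.
  apply: lerD; first by rewrite mulrC ler_wpM2r.
  apply: le_trans g3 _; rewrite expr2 mulrA ler_wpM2r // ler_wpM2l //.
have rM : 0 <= M * `|rho| by rewrite mulr_ge0.
have [||f1 f2 f3] := HK (g z) v.
- by apply: le_trans g1 _; rewrite lerDl.
- apply: le_trans vM _; apply: le_trans (ler_wpM2l M0 wr') _; lra.
have LK : 0 <= L * K by rewrite mulr_ge0.
have KM : 0 <= K * M ^+ 2 by rewrite mulr_ge0 ?sqr_ge0.
split; first by lra.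
  by rewrite absM; apply: le_trans (ler_pM _ _ g2 f2) _; rewrite ?abs_ge0 //; lra.
have -> : f (g (z + w)) - f (g z) - w * (dg z * df (g z))
  = (f (g z + v) - f (g z) - v * df (g z)) + (v - w * dg z) * df (g z).
  have -> : g z + v = g (z + w) by rewrite /v; ring.
  by ring.
apply: le_trans (absD _ _) _.
have t1 : abs ((v - w * dg z) * df (g z)) <= L * abs w ^+ 2 * K.
  by rewrite absM ler_pM ?abs_ge0.
have t2 : abs (f (g z + v) - f (g z) - v * df (g z)) <= K * (M * abs w) ^+ 2.
  apply: le_trans f3 _; rewrite ler_wpM2l // ler_pXn2r ?nnegrE ?abs_ge0 //.
  by rewrite mulr_ge0.
apply: le_trans (lerD t2 t1) _.
have := sqr_ge0 (abs w); rewrite exprMn; nra.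
Qed.

Lemma tame_sum (I : Type) (r : seq I) (P : pred I) (F : I -> C -> C) :
  (forall i, P i -> tame (F i)) -> tame (fun z => \sum_(i <- r | P i) F i z).
Proof.
move=> H; elim: r => [|i r IH].
  rewrite (_ : (fun z => _) = (fun=> 0)); first exact: tame_cst.
  by apply/funext => z; rewrite big_nil.
have [Pi|Pi] := boolP (P i).
  rewrite (_ : (fun z => _) = (fun z => F i z + \sum_(i <- r | P i) F i z)).
    by apply: tameD => //; apply: H.
  by apply/funext => z; rewrite big_cons Pi.
rewrite (_ : (fun z => _) = (fun z => \sum_(i <- r | P i) F i z)) //.
by apply/funext => z; rewrite big_cons (negbTE Pi).
Qed.

Lemma tame_prod (I : Type) (r : seq I) (P : pred I) (F : I -> C -> C) :
  (forall i, P i -> tame (F i)) -> tame (fun z => \prod_(i <- r | P i) F i z).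
Proof.
move=> H; elim: r => [|i r IH].
  rewrite (_ : (fun z => _) = (fun=> 1)); first exact: tame_cst.
  by apply/funext => z; rewrite big_nil.
have [Pi|Pi] := boolP (P i).
  rewrite (_ : (fun z => _) = (fun z => F i z * \prod_(i <- r | P i) F i z)).
    by apply: tameM => //; apply: H.
  by apply/funext => z; rewrite big_cons Pi.
rewrite (_ : (fun z => _) = (fun z => \prod_(i <- r | P i) F i z)) //.
by apply/funext => z; rewrite big_cons (negbTE Pi).
Qed.

Lemma tame_affine f (a b : C) : tame f -> tame (fun z => f (a * z + b)).
Proof.
move=> tf; apply: (tame_comp tf (g := fun z => a * z + b)).
by apply: tameD; [apply: tameM; [exact: tame_cst|exact: tame_id]|exact: tame_cst].
Qed.

Lemma tame_e2pi : tame (@e2pi R).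
Proof.
exists (fun z => twopii R * e2pi z) => rho.
pose r : R := `|rho|; have r0 : 0 <= r := normr_ge0 _.
have p0 := @pi_ge0 R.
pose E := expR (2 * pi * r); have E0 : 0 <= E := expR_ge0 _.
have eE z : abs z <= rho -> abs (e2pi z) <= E.
  move=> zr; rewrite abs_e2pi ler_expR; apply: le_trans (ler_norm _) _.
  rewrite normrN normrM ger0_norm ?mulr_ge0 // ler_wpM2l ?mulr_ge0 //.
  by apply: le_trans (Im_abs _) _; apply: le_trans zr (ler_norm _).
exists (E + 2 * pi * E + E * (5 * (2 * pi) ^+ 2 * E)).
  by rewrite !addr_ge0 ?mulr_ge0 ?sqr_ge0.
move=> z w zr wr; have e1 := eE z zr.
have h1 : 0 <= 2 * pi * E by rewrite !mulr_ge0.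
have h2 : 0 <= E * (5 * (2 * pi) ^+ 2 * E) by rewrite !mulr_ge0 ?sqr_ge0.
split; first by lra.
  rewrite absM abs_twopii; have := ler_wpM2l (mulr_ge0 (ler0n R 2) p0) e1; lra.
have -> : e2pi (z + w) - e2pi z - w * (twopii R * e2pi z)
  = e2pi z * (e2pi w - 1 - twopii R * w) by rewrite e2piD; ring.
rewrite absM.
apply: le_trans (_ : E * (5 * (2 * pi) ^+ 2 * E) * abs w ^+ 2 <= _); last first.
  by rewrite ler_wpM2r ?sqr_ge0 //; lra.
rewrite -mulrA; apply: ler_pM; rewrite ?abs_ge0 //.
apply: le_trans (e2pi_taylor w) _; rewrite exprMn.
have : expR (2 * pi * abs w) <= E.
  by rewrite ler_expR ler_wpM2l ?mulr_ge0 // (le_trans wr) // ler_norm.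
have q0 : 0 <= 5 * ((2 * pi) ^+ 2 * abs w ^+ 2).
  by rewrite mulr_ge0 // mulr_ge0 ?sqr_ge0.
move=> le; apply: le_trans (ler_wpM2l q0 le) _; lra.
Qed.

Lemma gauss_mono (A B t : R) m : A <= B -> gauss A t m <= gauss B t m.
Proof. by move=> AB; rewrite ler_expR lerD2r ler_wpM2r. Qed.

(** A polynomial factor in m costs one unit of A, since k <= exp k and
    k^2 <= 2 exp k. *)
Lemma gauss_absorb (A B t : R) m : A + 1 <= B ->
  `|m|%N%:R * gauss A t m <= gauss B t m /\
  `|m|%N%:R ^+ 2 * gauss A t m <= 2 * gauss B t m.
Proof.
move=> AB; pose k : R := `|m|%N%:R; have k0 : 0 <= k by rewrite ler0n.
have AE : expR k * gauss A t m <= gauss B t m.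
  rewrite /gauss -expRD ler_expR -/k addrA lerD2r.
  by have := ler_wpM2r k0 AB; lra.
have g0 : 0 <= gauss A t m := expR_ge0 _.
split.
  apply: le_trans AE; rewrite ler_wpM2r //.
  by have := expR_ge1Dx k; rewrite -/k; lra.
apply: le_trans (ler_wpM2l (ler0n R 2) AE); rewrite mulrA ler_wpM2r //.
have := expR_ge1Dxn 1 k0; rewrite -/k.
by have -> : (2`!)%:R = 2 :> R by []; lra.
Qed.

(** The expansion of each term of the series, summed; all bounds are dominated by
    a single Gaussian. *)
Lemma tame_theta (tau : C) : 0 < complex.Im tau -> tame (theta tau).
Proof.
move=> t0; set t := complex.Im tau in t0.
pose d z (m : int) : C := twopii R * m%:~R * tterm tau z m.
exists (fun z => bisum (d z)) => rho.
pose r : R := `|rho|; have r0 : 0 <= r := normr_ge0 _.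
have p0 := @pi_ge0 R.
(* 4 pi r since |z + w| <= 2 r; the unit absorbs factors m and m^2. K0 collects
   the constants of the bounds for h, dh and the remainder. *)
pose A : R := 4 * pi * r + 1.
pose K0 : R := 1 + 2 * pi + 40 * pi ^+ 2.
have pp : 0 <= pi ^+ 2 :> R := sqr_ge0 _.
have K00 : 0 <= K0 by rewrite /K0; lra.
pose g (m : int) := K0 * gauss A t m.
have sg : wsummable g by apply: wsummableZ => //; apply: wsummable_gauss.
have G0 m : 0 <= gauss A t m := expR_ge0 _.
have gA m : gauss A t m <= g m by rewrite ler_peMl // /K0; lra.
have [g0 [B HB]] := sg.
have tl z m (s : R) : abs z <= s -> abs (tterm tau z m) <= gauss (2 * pi * s) t m.
  move=> zs; apply: tterm_le; rewrite ler_wpM2l ?mulr_ge0 //.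
  exact: le_trans (Im_abs _) zs.
have tb z m : abs z <= rho -> abs (tterm tau z m) <= g m.
  move=> zr; apply: le_trans (gA m).
  apply: le_trans (tl z m r (le_trans zr (ler_norm _))) _; apply: gauss_mono.
  by rewrite /A; have := mulr_ge0 p0 r0; lra.
have db z m : abs z <= rho -> abs (d z m) <= g m.
  move=> zr; rewrite /d absM (absM (twopii R)) abs_twopii abs_int.
  have h := tl z m r (le_trans zr (ler_norm _)).
  have [|h1 _] := @gauss_absorb (2 * pi * r) A t m.
    by rewrite /A; have := mulr_ge0 p0 r0; lra.
  rewrite -mulrA; apply: le_trans (_ : 2 * pi * gauss A t m <= _).
    rewrite ler_wpM2l ?mulr_ge0 //; apply: le_trans h1.
    by rewrite ler_wpM2l.
  by rewrite ler_wpM2r // /K0; lra.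
exists (`|B|) => // z w zr wr.
have zr' : abs z <= r := le_trans zr (ler_norm _).
have wr' : abs w <= r := le_trans wr (ler_norm _).
have BB := ler_norm B.
split.
- apply: le_trans BB; apply: (abs_bisum g0 HB) => m; exact: tb.
- apply: le_trans BB; apply: (abs_bisum g0 HB) => m; exact: db.
have zw m : abs (tterm tau (z + w) m) <= g m.
  apply: le_trans (gA m).
  apply: le_trans (tl (z + w) m (r + r) _) _.
    by apply: le_trans (absD _ _) _; apply: lerD.
  by apply: gauss_mono; rewrite /A; lra.
have sg3 : wsummable (fun m => 2 * g m) by apply: wsummableZ.
have zw0 m : abs (-1 * tterm tau z m + tterm tau (z + w) m) <= 2 * g m.
  apply: le_trans (absD _ _) _; rewrite absM absN abs1 mul1r mulrDl mul1r.
  by apply: lerD; [exact: tb | exact: zw].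
have g2 m : g m <= 2 * g m by have := g0 m; lra.
have -> : theta tau (z + w) - theta tau z - w * bisum (d z) =
  bisum (fun m => - w * d z m + (-1 * tterm tau z m + tterm tau (z + w) m)).
  rewrite (bisum_linear _ sg3) //; last by move=> m; apply: le_trans (g2 m); apply: db.
  rewrite (bisum_linear _ sg) //; last by move=> m; apply: tb.
  by rewrite -!thetaE; ring.
apply: le_trans (_ : B * abs w ^+ 2 <= _); last by rewrite ler_wpM2r ?sqr_ge0.
apply: (@abs_bisum _ _ (fun m => abs w ^+ 2 * g m)).
- by move=> m; rewrite mulr_ge0 ?sqr_ge0.
- move=> M; rewrite [leRHS]mulrC; apply: le_trans (ler_wpM2l (sqr_ge0 _) (HB M)).
  by rewrite /wsum mulrDr !mulr_sumr.
move=> m.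
have -> : - w * d z m + (-1 * tterm tau z m + tterm tau (z + w) m)
  = tterm tau z m * (e2pi (m%:~R * w) - 1 - twopii R * (m%:~R * w)).
  have -> : tterm tau (z + w) m = tterm tau z m * e2pi (m%:~R * w).
    by rewrite /tterm -[RHS]mulrA -e2piD; congr (_ * e2pi _); ring.
  by rewrite /d; ring.
rewrite absM; have tay := e2pi_taylor (m%:~R * w).
rewrite absM abs_int in tay.
set k : R := `|m|%N%:R in tay.
have k0 : 0 <= k by rewrite ler0n.
have w0 := abs_ge0 w.
have h1 := tl z m r zr'.
have h2 : gauss (2 * pi * r) t m * expR (2 * pi * (k * abs w))
   <= gauss (4 * pi * r) t m.
  rewrite /gauss -expRD ler_expR -/k addrAC lerD2r.
  have : pi * k * abs w <= pi * k * r by rewrite ler_wpM2l // mulr_ge0.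
  lra.
have [|_ h3] := @gauss_absorb (4 * pi * r) A t m; first by rewrite /A.
apply: le_trans (ler_pM (abs_ge0 _) (abs_ge0 _) h1 tay) _.
have -> : gauss (2 * pi * r) t m * (5 * (2 * pi * (k * abs w)) ^+ 2 *
    expR (2 * pi * (k * abs w))) = abs w ^+ 2 * (20 * pi ^+ 2 * (k ^+ 2 *
    (gauss (2 * pi * r) t m * expR (2 * pi * (k * abs w))))) by ring.
rewrite ler_wpM2l ?sqr_ge0 //.
apply: le_trans (_ : 20 * pi ^+ 2 * (k ^+ 2 * gauss (4 * pi * r) t m) <= _).
  by rewrite ler_wpM2l ?mulr_ge0 // ler_wpM2l ?sqr_ge0.
apply: le_trans (_ : 20 * pi ^+ 2 * (2 * gauss A t m) <= _).
  by rewrite ler_wpM2l ?mulr_ge0.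
rewrite /g /K0 mulrA ler_wpM2r //; lra.
Qed.

End Tame.

(** * Discrete Fourier coefficients *)

Section DiscreteFourier.
Variable R : realType.
Local Notation C := R[i].
Implicit Types (f g h : C -> C) (z w x : C).

(** Riemann sums, over a period, of the mean value of a 1-periodic function. *)
Definition avg (N : nat) (f : C -> C) z : C :=
  N%:R^-1 * \sum_(j < N) f (z + j%:R / N%:R).

Lemma natC_neq0 (N : nat) : (0 < N)%N -> (N%:R : C) != 0.
Proof. by rewrite pnatr_eq0 -lt0n. Qed.

Lemma sumr_cst_ord (x : R) N : \sum_(j < N) x = x * N%:R.
Proof. by rewrite sumr_const card_ord mulr_natr. Qed.

(** Moving the base point by w / N changes the Riemann sum, to first order, by
    w / N times the Riemann sum of f'; so does moving it by 1 / N, up to the factor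
    w, and then the increments telescope to 0 over a period. *)
Lemma avg_step f : tame f -> (forall z, f (z + 1) = f z) ->
  forall (rho : R) (w : C), exists2 K : R, 0 <= K & forall N z, (0 < N)%N ->
  abs z <= rho ->
  abs (avg N f (z + w / N%:R) - avg N f z) <= K / N%:R ^+ 2.
Proof.
move=> [df tf] per rho w.
pose r : R := `|rho| + abs w + 1.
have [K K0 HK] := tf r.
have w0 := abs_ge0 w.
exists (K * abs w ^+ 2 + abs w * K); first by rewrite addr_ge0 ?mulr_ge0 ?sqr_ge0.
move=> N z N0 zr; have Nn := natC_neq0 N0.
have NR : (0 : R) < N%:R by rewrite ltr0n.
have Ni : (N%:R : R)^-1 <= 1 by rewrite invf_le1 // ler1n.
have Ni0 : 0 < (N%:R : R)^-1 by rewrite invr_gt0.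
pose y (j : nat) : C := z + j%:R / N%:R.
have yr (j : 'I_N) : abs (y j) <= r.
  apply: le_trans (absD _ _) _; rewrite absM absV !abs_nat /r.
  have : (j%:R : R) / N%:R <= 1 by rewrite ler_pdivrMr // mul1r ler_nat ltnW.
  by have := ler_norm rho; lra.
have tel : \sum_(j < N) (f (y j + N%:R^-1) - f (y j)) = 0.
  have -> : \sum_(j < N) (f (y j + N%:R^-1) - f (y j))
     = \sum_(0 <= j < N) (f (y j.+1) - f (y j)).
    rewrite big_mkord; apply: eq_bigr => j _; congr (f _ - _).
    by rewrite /y -addn1 natrD mulrDl mul1r addrA.
  by rewrite telescope_sumr // /y mulfV // mul0r addr0 per subrr.
have -> : avg N f (z + w / N%:R) - avg N f z = N%:R^-1 *
  \sum_(j < N) ((f (y j + w / N%:R) - f (y j) - w / N%:R * df (y j))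
     - w * (f (y j + N%:R^-1) - f (y j) - N%:R^-1 * df (y j))).
  rewrite /avg -mulrBr -sumrB; congr (_ * _).
  transitivity (\sum_(j < N) (f (z + w / N%:R + j%:R / N%:R) - f (z + j%:R / N%:R))
      - w * \sum_(j < N) (f (y j + N%:R^-1) - f (y j))).
    by rewrite tel mulr0 subr0.
  rewrite mulr_sumr -sumrB; apply: eq_bigr => j _; rewrite /y.
  have -> : z + w / N%:R + j%:R / N%:R = z + j%:R / N%:R + w / N%:R by ring.
  by field.
rewrite absM absV abs_nat mulrC ler_pdivrMr //.
apply: le_trans (abs_sum _ _ _) _.
have -> : (K * abs w ^+ 2 + abs w * K) / N%:R ^+ 2 * N%:R =
  \sum_(j < N) ((K * abs w ^+ 2 + abs w * K) / N%:R ^+ 2).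
  by rewrite sumr_cst_ord.
apply: ler_sum => j _.
have wN : abs (w / N%:R) = abs w / N%:R by rewrite absM absV abs_nat.
have wr : abs (w / N%:R) <= r.
  by rewrite wN; apply: le_trans (ler_piMr w0 Ni) _; rewrite /r; have := normr_ge0 rho; lra.
have Nr : abs (N%:R^-1) <= r.
  by rewrite absV abs_nat; apply: le_trans Ni _; rewrite /r; have := normr_ge0 rho; lra.
have [_ _ h1] := HK _ _ (yr j) wr; have [_ _ h2] := HK _ _ (yr j) Nr.
rewrite wN expr_div_n in h1; rewrite absV abs_nat in h2.
apply: le_trans (absB _ _) _; rewrite mulrDl; apply: lerD.
  by apply: le_trans h1 _; rewrite mulrA.
by rewrite absM -mulrA ler_wpM2l // -exprVn.
Qed.

(** N steps of size (z' - z) / N, each with an error O(1 / N^2). In the limit this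
    is the independence of the mean value from the base point, which replaces a
    contour shift. *)
Lemma avg_shift_bound f : tame f -> (forall z, f (z + 1) = f z) ->
  forall z z', exists2 K : R, 0 <= K & forall N, (0 < N)%N ->
  abs (avg N f z' - avg N f z) <= K / N%:R.
Proof.
move=> tf per z z'; pose w := z' - z.
have [K K0 HK] := avg_step tf per (abs z + abs w) w.
exists K => // N N0; have NR : (0 : R) < N%:R by rewrite ltr0n.
have Nn := natC_neq0 N0.
pose p (i : nat) := z + i%:R * w / N%:R.
have -> : avg N f z' - avg N f z =
    \sum_(0 <= i < N) (avg N f (p i.+1) - avg N f (p i)).
  rewrite telescope_sumr // /p mul0r mul0r addr0 mulrAC mulfV // mul1r.
  by have -> : z + w = z' by rewrite /w; ring.
rewrite big_mkord; apply: le_trans (abs_sum _ _ _) _.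
have -> : K / N%:R = \sum_(i < N) (K / N%:R ^+ 2).
  by rewrite sumr_cst_ord; field; rewrite gt_eqF.
apply: ler_sum => i _.
have -> : p i.+1 = p i + w / N%:R by rewrite /p -addn1 natrD; ring.
apply: HK => //; rewrite /p; apply: le_trans (absD _ _) _; rewrite lerD2l.
rewrite !absM absV !abs_nat mulrAC ler_piMl ?abs_ge0 //.
by rewrite ler_pdivrMr // mul1r ler_nat ltnW.
Qed.

Lemma wsum_e2pi x M : (e2pi x - 1) * wsum (fun m : int => e2pi (m%:~R * x)) M
  = e2pi (M.+1%:R * x) - e2pi (- (M%:R * x)).
Proof.
elim: M => [|M IH].
  rewrite /wsum big_ord_recl !big_ord0 /= !mul0r oppr0 e2pi0 !addr0 mulr1.
  by rewrite mul1r.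
rewrite wsumS mulrDr IH NegzE mulrDr !mulrBl !mul1r -!e2piD.
have -> : x + (Posz M.+1)%:~R * x = M.+2%:R * x by rewrite -[(Posz _)%:~R]/(M.+1%:R) -(addn1 M.+1) natrD; ring.
have -> : x + (- (Posz M.+1))%:~R * x = - (M%:R * x).
  by rewrite mulrNz -[(Posz _)%:~R]/(M.+1%:R) -(addn1 M) natrD; ring.
by rewrite mulrNz -[(Posz _)%:~R]/(M.+1%:R) mulNr; ring.
Qed.

(** The m-th discrete Fourier coefficient of x |-> h (z + x). *)
Definition dcoef N h z (m : int) : C :=
  N%:R^-1 * \sum_(j < N) h (z + j%:R / N%:R) * e2pi (- (m%:~R * (j%:R / N%:R))).

(** Discrete Fourier inversion at x = 0, with N = 2 M + 1 odd to use a window. *)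
Lemma dcoef_inv h z M : h z = wsum (dcoef (2 * M).+1 h z) M.
Proof.
set N := (2 * M).+1; have Nn : (N%:R : C) != 0 by rewrite natC_neq0.
pose S (j : nat) : C := wsum (fun m : int => e2pi (- (m%:~R * (j%:R / N%:R)))) M.
have -> : wsum (dcoef N h z) M = N%:R^-1 * \sum_(j < N) h (z + j%:R / N%:R) * S j.
  rewrite /dcoef wsumZ; congr (_ * _); rewrite /wsum /S.
  under [RHS]eq_bigr => j _ do rewrite mulrDr !mulr_sumr.
  by rewrite big_split /= exchange_big [X in _ + X]exchange_big.
rewrite big_ord_recl big1 => [|i _]; last first.
  suff -> : S (lift ord0 i) = 0 by rewrite mulr0.
  set j := lift ord0 i; pose x : C := - (j%:R / N%:R).
  have SE : S j = wsum (fun m : int => e2pi (m%:~R * x)) M.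
    by apply: eq_wsum => m _; rewrite /x mulrN.
  have : (e2pi x - 1) * S j = 0.
    rewrite SE wsum_e2pi; have -> : M.+1%:R * x = - (M%:R * x) + (- (Posz j))%:~R.
      rewrite mulrNz -[(Posz _)%:~R]/(j%:R) /x -addn1 natrD.
      have -> : (M%:R : C) = (N%:R - 1) / 2 by rewrite /N -addn1 natrD natrM; field.
      by field.
    by rewrite e2piDint subrr.
  move/eqP; rewrite mulf_eq0 subr_eq0 => /orP[/eqP/e2pi_eq1[m em]|/eqP//].
  have : (j%:R : C) = (- m)%:~R * N%:R by rewrite intrN -em /x; field.
  rewrite -[j%:R]/((Posz j)%:~R) -[N%:R]/((Posz N)%:~R) -intrM => /eqP.
  rewrite eqr_int => /eqP jm; exfalso.
  have jN : (j < N)%N by [].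
  have j0 : (0 < j)%N by [].
  by move: jm; case: (- m) => k; [case: k => [|k]|]; nia.
rewrite /= mul0r !addr0 /S /=.
have -> : wsum (fun m : int => e2pi (- (m%:~R * (0 / N%:R)))) M = N%:R :> C.
  rewrite (@eq_wsum _ _ (fun=> 1)) => [|m _]; last by rewrite mul0r mulr0 oppr0 e2pi0.
  by rewrite /wsum !sumr_const !card_ord -natrD; congr _%:R; rewrite /N; lia.
by rewrite mulrCA mulVf ?mulr1.
Qed.

Lemma sin_lower (y : R) : 0 <= y <= pi / 2 -> y / 8 <= sin y.
Proof.
move=> /andP[y0 y1]; have p2 := @pi_ge2 R.
have p4 : pi <= 4 :> R by have [/andP[_ ?] _] := pihalf_02_cos_pihalf R; lra.
have [y2|y2] := leP y (1 / 2).
  have := normr_sinB y; rewrite ler_norml => /andP[h _].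
  have : y ^+ 2 <= y / 2 by rewrite expr2; nra.
  lra.
have h1 := normr_sinB (1 / 2 : R); move: h1; rewrite ler_norml => /andP[h _].
have : sin (1 / 2) <= sin y.
  apply: ltW; rewrite ltr_sin // in_itv /=; apply/andP; split; lra.
rewrite expr2 in h; lra.
Qed.

Lemma abs_e2piB1 (x : R) : `|x| <= 1 / 2 -> `|x| / 2 <= abs (e2pi x%:C - 1).
Proof.
move=> x1.
have E : abs (e2pi x%:C - 1) ^+ 2 = (2 * sin (pi * x)) ^+ 2.
  rewrite abs_sqr e2pi_real /= oppr0 addr0.
  have := one_minus_cos (2 * pi * x); have := cos2Dsin2 (2 * pi * x).
  have -> : 2 * pi * x / 2 = pi * x by field.
  rewrite !expr2; nra.
have p0 := @pi_gt0 R; have p2 := @pi_ge2 R.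
have s : `|x| / 2 <= `|2 * sin (pi * x)|.
  have -> : `|2 * sin (pi * x)| = 2 * `|sin (pi * `|x|)|.
    rewrite normrM (ger0_norm (x := 2)) //; congr (_ * _).
    by have [x0|x0] := leP 0 x; rewrite ?(ger0_norm x0) ?(ltr0_norm x0) // mulrN sinN normrN.
  have := ler_norm (sin (pi * `|x|)).
  have := @sin_lower (pi * `|x|); rewrite mulr_ge0 ?(ltW p0) //=.
  have -> : pi * `|x| <= pi / 2 by rewrite ler_pM2l //; lra.
  move=> /(_ isT); have := normr_ge0 x; nra.
rewrite -(@ler_pXn2r _ 2%N) ?nnegrE ?abs_ge0 ?divr_ge0 // E.
by rewrite -[leRHS]real_normK ?num_real // ler_pXn2r ?nnegrE ?divr_ge0.
Qed.

(** Two summations by parts: multiplication by zeta + zeta^-1 - 2 turns h into its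
    second differences, which are O(1 / N^2). *)
Lemma dcoef_decay h : tame h -> (forall z, h (z + 1) = h z) ->
  forall z, exists2 K : R, 0 <= K & forall M (m : int), (`|m| <= M)%N ->
    abs (dcoef (2 * M).+1 h z m) * `|m|%N%:R ^+ 2 <= K /\
    abs (dcoef (2 * M).+1 h z m) <= K.
Proof.
move=> [dh th] per z.
pose rho : R := abs z + 1.
have [K K0 HK] := th rho.
exists (8 * K); first by rewrite mulr_ge0.
move=> M m mM; set N := (2 * M).+1.
have Nn : (N%:R : C) != 0 by rewrite natC_neq0.
have NR : (0 : R) < N%:R by rewrite ltr0n.
have Ni : (N%:R : R)^-1 <= 1 by rewrite invf_le1 // ler1n.
pose y (j : nat) : C := z + j%:R / N%:R.
pose zeta : C := e2pi (- (m%:~R / N%:R)).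
have zN : zeta ^+ N = 1.
  rewrite /zeta -e2piMn.
  have -> : - (m%:~R / N%:R) *+ N = (- m)%:~R :> C by rewrite intrN -mulr_natr; field.
  exact: e2pi_int.
have z0 : zeta != 0 := e2pi_neq0 _.
have absz : abs zeta = 1.
  have : abs zeta ^+ N = 1 by rewrite -absX zN abs1.
  by move/eqP; rewrite pexpr_eq1 ?abs_ge0 // => /eqP.
have DE : dcoef N h z m = N%:R^-1 * \sum_(j < N) h (y j) * zeta ^+ j.
  congr (_ * _); apply: eq_bigr => j _; congr (_ * _).
  by rewrite /zeta -e2piMn -mulr_natr; congr e2pi; field.
have yr (j : 'I_N) : abs (y j) <= rho.
  apply: le_trans (absD _ _) _; rewrite absM absV !abs_nat /rho lerD2l.
  by rewrite ler_pdivrMr // mul1r ler_nat ltnW.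
have b1 : abs (dcoef N h z m) <= K.
  rewrite DE absM absV abs_nat mulrC ler_pdivrMr // -sumr_cst_ord.
  apply: le_trans (abs_sum _ _ _) _; apply: ler_sum => j _.
  rewrite absM absX absz expr1n mulr1.
  by have [|//] := HK (y j) 0 (yr j); rewrite abs0 /rho; have := abs_ge0 z; lra.
split; last by lra.
have rot (F : nat -> C) : F N = F 0%N -> \sum_(j < N) F j.+1 = \sum_(j < N) F j.
  move=> FN; have := big_ord_recl N (fun j : 'I_N.+1 => F j) (op := +%R).
  move=> /(_ 0); rewrite big_ord_recr /= FN addrC => /addrI ->.
  by apply: eq_bigr.
have yN j : h (y (j + N)%N) = h (y j).
  by rewrite /y natrD mulrDl mulfV // addrA per.
pose d2 (j : nat) : C := h (y j + N%:R^-1) + h (y j - N%:R^-1) - 2 * h (y j).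
have E2 : (zeta + zeta^-1 - 2) * dcoef N h z m
    = N%:R^-1 * \sum_(j < N) d2 j * zeta ^+ j.
  rewrite DE mulrCA; congr (_ * _).
  pose F j := h (y j) * zeta ^+ j.
  have s1 : zeta^-1 * \sum_(j < N) F j = \sum_(j < N) h (y j + N%:R^-1) * zeta ^+ j.
    rewrite -(rot F); last by rewrite /F zN -[N]add0n yN expr0.
    rewrite mulr_sumr; apply: eq_bigr => j _; rewrite /F exprS.
    rewrite mulrCA mulKf //; congr (h _ * _).
    by rewrite /y -addn1 natrD mulrDl mul1r addrA.
  have s2 : zeta * \sum_(j < N) F j = \sum_(j < N) h (y j - N%:R^-1) * zeta ^+ j.
    pose G (j : nat) := h (y j - N%:R^-1) * zeta ^+ j.
    rewrite -[RHS](rot G); last first.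
      rewrite /G zN expr0; congr (_ * _).
      by rewrite -[RHS]per /y mul0r addr0 mulfV //; congr h; ring.
    rewrite mulr_sumr; apply: eq_bigr => j _; rewrite /F /G exprS mulrCA.
    by congr (h _ * _); rewrite /y -addn1 natrD mulrDl mul1r addrA addrK.
  rewrite -/(F _) mulrBl mulrDl s1 s2 mulr_sumr -big_split -sumrB /=.
  by apply: eq_bigr => j _; rewrite /d2 /F; ring.
have d2b (j : 'I_N) : abs (d2 j) <= 2 * K / N%:R ^+ 2.
  have Nr : abs (N%:R^-1 : C) <= rho.
    by rewrite absV abs_nat; apply: le_trans Ni _; rewrite /rho; have := abs_ge0 z; lra.
  have [_ _ h1] := HK _ _ (yr j) Nr.
  have [|_ _ h2] := HK (y j) (- N%:R^-1) (yr j); first by rewrite absN.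
  rewrite absN in h2; rewrite absV abs_nat exprVn in h1 h2.
  have -> : d2 j = (h (y j + N%:R^-1) - h (y j) - N%:R^-1 * dh (y j))
     + (h (y j - N%:R^-1) - h (y j) - - N%:R^-1 * dh (y j)).
    by rewrite /d2; ring.
  by apply: le_trans (absD _ _) _; lra.
have num : abs ((zeta + zeta^-1 - 2) * dcoef N h z m) <= 2 * K / N%:R ^+ 2.
  rewrite E2 absM absV abs_nat mulrC ler_pdivrMr // -sumr_cst_ord.
  apply: le_trans (abs_sum _ _ _) _; apply: ler_sum => j _.
  by rewrite absM absX absz expr1n mulr1.
(* |zeta - 1| >= |m| / (2 N) because |m| / N <= 1 / 2. *)
have den : `|m|%N%:R ^+ 2 / (4 * N%:R ^+ 2) <= abs (zeta + zeta^-1 - 2).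
  have -> : zeta + zeta^-1 - 2 = zeta^-1 * (zeta - 1) ^+ 2 by field.
  rewrite absM absV absz invr1 mul1r absX.
  pose x : R := - (m%:~R / N%:R).
  have zx : zeta = e2pi x%:C.
    by rewrite /zeta /x rmorphN fmorph_div /= rmorph_int rmorph_nat.
  have nx : `|x| = `|m|%N%:R / N%:R.
    by rewrite normrN normrM normfV normr_intz ger0_norm // ler0n.
  have x2 : `|x| <= 1 / 2.
    rewrite nx ler_pdivrMr //; have : (`|m|%N%:R : R) <= M%:R by rewrite ler_nat.
    by rewrite /N -(addn1 (2 * M)) natrD natrM; lra.
  have := abs_e2piB1 x2; rewrite -zx nx => le.
  have -> : `|m|%N%:R ^+ 2 / (4 * N%:R ^+ 2) = (`|m|%N%:R / N%:R / 2) ^+ 2 :> R.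
    by field; rewrite gt_eqF.
  by rewrite ler_pXn2r ?nnegrE ?abs_ge0 ?divr_ge0 ?ler0n.
rewrite absM in num.
have := le_trans (ler_wpM2r (abs_ge0 (dcoef N h z m)) den) num.
have N2 : 0 < (N%:R : R) ^+ 2 by rewrite exprn_gt0.
rewrite mulrAC ler_pdivrMr ?mulr_gt0 // mulrC => le.
apply: le_trans le _; rewrite le_eqVlt; apply/orP; left; apply/eqP.
by field; rewrite gt_eqF.
Qed.

Lemma sum_tele_le M : \sum_(k < M) (k.+1%:R * k.+2%:R)^-1 <= 1 :> R.
Proof.
suff -> : \sum_(k < M) (k.+1%:R * k.+2%:R)^-1 = 1 - M.+1%:R^-1 :> R.
  by rewrite lerBlDr lerDl invr_ge0.
elim: M => [|M IH]; first by rewrite big_ord0 invr1 subrr.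
rewrite big_ord_recr /= IH -(addn1 M.+1) natrD.
have : (M.+1%:R : R) > 0 by rewrite ltr0n.
by move: (M.+1%:R : R) => x x0; field; apply/andP; split; lra.
Qed.

(** Dominates the minimum of 1 and 1 / m^2 and has telescoping sums; 6 is the
    largest value of (k + 1) (k + 2) / k^2 for k >= 1. *)
Definition quad_decay (m : int) : R := 6 / (`|m|%N.+1%:R * `|m|%N.+2%:R).

Lemma wsummable_quad_decay : wsummable quad_decay.
Proof.
split=> [m|]; first by rewrite divr_ge0.
exists 12 => M; rewrite /wsum /quad_decay.
have h : 6 * \sum_(k < M.+1) (k.+1%:R * k.+2%:R)^-1 <= 6 * 1 :> R.
  by rewrite ler_wpM2l // sum_tele_le.
have h' : 6 * \sum_(k < M) (k.+1%:R * k.+2%:R)^-1 <= 6 * 1 :> R.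
  by rewrite ler_wpM2l // sum_tele_le.
rewrite !mulr_sumr in h h'.
apply: le_trans (_ : 6 * 1 + 6 * 1 <= _); last lra.
apply: lerD; first exact: h.
apply: le_trans h'; apply: ler_sum => k _.
rewrite NegzE abszN absz_nat ler_pM2l // lef_pV2 ?posrE ?mulr_gt0 ?ltr0n //.
by rewrite -!natrM ler_nat leq_mul.
Qed.

Lemma quad_decay_bound (K x : R) (m : int) : 0 <= K -> 0 <= x ->
  x * `|m|%N%:R ^+ 2 <= K -> x <= K -> x <= K * quad_decay m.
Proof.
move=> K0 x0; rewrite /quad_decay; case: (`|m|%N) => [|k] h1 h2.
  by apply: le_trans h2 _; rewrite ler_peMr //; lra.
rewrite mulrA ler_pdivlMr ?mulr_gt0 ?ltr0n //.
rewrite (natrD _ 2 k) (natrD _ 3 k); rewrite -(addn1 k) natrD in h1.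
have : (0 : R) <= k%:R by rewrite ler0n.
by move: (k%:R : R) h1 => y h1 y0; rewrite !expr2 in h1 *; nra.
Qed.

Lemma half_notin_lattice (tau : C) : 0 < complex.Im tau ->
  forall a b : int, 2%:R^-1 <> a%:~R + b%:~R * tau :> C.
Proof.
move=> t0 a b e.
have ImE : complex.Im (a%:~R + b%:~R * tau) = b%:~R * complex.Im tau.
  by rewrite -!(rmorph_int (real_complex R)); case: (tau) => x y /=; ring.
have Im0 : complex.Im (2%:R^-1 : C) = 0.
  by rewrite -(rmorph_nat (real_complex R)) -fmorphV.
move: (ImE); rewrite -e Im0 => /esym/eqP.
rewrite mulf_eq0 (gt_eqF t0) orbF intr_eq0 => /eqP b0.
move: e; rewrite b0 mul0r addr0 => e.
have : (1 : C) = (a * 2)%:~R by rewrite intrM -e; field.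
by rewrite -[1]/(1%:~R) => /eqP; rewrite eqr_int => /eqP; lia.
Qed.

End DiscreteFourier.

(** * Uniqueness of theta *)

Section ThetaUnique.
Variable R : realType.
Local Notation C := R[i].
Implicit Types (h : C -> C) (z x : C).

(** The classical argument compares Fourier coefficients: quasi-periodicity gives
    them the recursion that the coefficients of theta satisfy. Here it is made
    with discrete coefficients: a M m z is the m-th one at level N = 2 M + 1, it
    depends on z in general, and only its limit does not. Discrete inversion and
    the quadratic decay then yield h z = lim (a M 0 0) theta z. *)
Lemma theta_unique (tau : C) h : 0 < complex.Im tau -> tame h ->
  (forall z, h (z + 1) = h z) -> (forall z, h (z + tau) = - e2pi (- z) * h z) ->
  exists c, forall z, h z = c * theta tau z.
Proof.
move=> t0 th per qper.
pose N M := (2 * M).+1.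
pose a M (m : int) z := avg (N M) (fun x => h x * e2pi (- (m%:~R * x))) z.
have aE M m z : dcoef (N M) h z m = e2pi (m%:~R * z) * a M m z.
  rewrite /dcoef /a /avg [RHS]mulrCA; congr (_ * _); rewrite mulr_sumr.
  apply: eq_bigr => j _; rewrite (mulrCA (e2pi _) (h _)); congr (_ * _).
  by rewrite -e2piD; congr e2pi; ring.
(* The recursion holds exactly, at the price of moving the base point by tau. *)
have arec M m z : a M (m + 1) z = - e2pi (m%:~R * tau) * a M m (z + tau).
  rewrite /a /avg [RHS]mulrCA; congr (_ * _); rewrite mulr_sumr; apply: eq_bigr => j _.
  have -> : z + tau + j%:R / (N M)%:R = z + j%:R / (N M)%:R + tau by ring.
  set x := z + _; rewrite qper !mulNr mulrN opprK.
  rewrite [e2pi (- x) * h x]mulrC -[h x * _ * _]mulrA (mulrCA (e2pi _) (h x)).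
  by congr (_ * _); rewrite -!e2piD; congr e2pi; rewrite intrD; ring.
pose a0 M := a M 0 0.
have base z : (fun M => a M 0 z - a0 M) @ \oo --> (0 : C).
  have E M x : a M 0 x = avg (N M) h x.
    by rewrite /a /avg; congr (_ * _); apply: eq_bigr => j _; rewrite mul0r oppr0 e2pi0 mulr1.
  have [K K0 HK] := avg_shift_bound th per 0 z.
  apply: (@cvgC_bound _ _ _ K) => M; rewrite subr0 /a0 !E.
  apply: le_trans (HK _ _) _ => //; rewrite ler_wpM2l // lef_pV2 ?posrE ?ltr0n //.
  by rewrite ler_nat /N; lia.
pose c m := tterm tau 0 m.
have crec m : c (m + 1) = - e2pi (m%:~R * tau) * c m.
  rewrite /c /tterm exprzDr ?unitrN1 // expr1z mulrN1 !mulNr (mulrCA (e2pi _) ((-1) ^ m)) -e2piD.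
  by congr (- (_ * e2pi _)); rewrite !intrM intrB intrD; field.
have conv m : forall z, (fun M => a M m z - c m * a0 M) @ \oo --> (0 : C).
  elim: m => [|m IH|m IH] z.
  - have c0 : c 0 = 1 by rewrite /c /tterm expr0z !mul0r addr0 e2pi0 mulr1.
    by under eq_fun do rewrite c0 mul1r; apply: base.
  - have E M : a M (Posz m.+1) z - c (Posz m.+1) * a0 M =
      - e2pi ((Posz m)%:~R * tau) * (a M m (z + tau) - c m * a0 M).
      have -> : Posz m.+1 = Posz m + 1 by rewrite -addn1 PoszD.
      by rewrite arec crec; ring.
    under eq_fun do rewrite E.
    by have := cvgM (cvg_cst (- e2pi ((Posz m)%:~R * tau))) (IH (z + tau)); rewrite mulr0; apply.
  - set k := - Posz m.+1.
    have kE : - Posz m = k + 1 by rewrite /k -addn1 PoszD; ring.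
    have e0 : - e2pi (k%:~R * tau) != 0 by rewrite oppr_eq0 e2pi_neq0.
    have E M : a M k z - c k * a0 M =
      (- e2pi (k%:~R * tau))^-1 * (a M (- Posz m) (z - tau) - c (- Posz m) * a0 M).
      by rewrite kE arec crec subrK -[_ * c k * a0 M]mulrA -mulrBr mulKf.
    under eq_fun do rewrite E.
    by have := cvgM (cvg_cst (- e2pi (k%:~R * tau))^-1) (IH (z - tau)); rewrite mulr0; apply.
have [K1 K10 HK1] := dcoef_decay th per 0.
have a0b M : abs (a0 M) <= K1.
  have [|_] := HK1 M 0; first by [].
  by rewrite -/(N M) aE mul0r e2pi0 mul1r.
have lim z : (fun M => h z - a0 M * wsum (tterm tau z) M) @ \oo --> (0 : C).
  have [K2 K20 HK2] := dcoef_decay th per z.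
  pose v M m := dcoef (N M) h z m - a0 M * tterm tau z m.
  pose g m := K2 * quad_decay R m + K1 * gauss (2 * pi * abs z) (complex.Im tau) m.
  have sg : wsummable g.
    have [p0 [B1 hB1]] := wsummableZ K20 (wsummable_quad_decay R).
    have [q0 [B2 hB2]] := wsummableZ K10 (wsummable_gauss (2 * pi * abs z) t0).
    split=> [m|]; first by rewrite addr_ge0.
    by exists (B1 + B2) => M; rewrite wsumD lerD.
  have vE M : wsum (v M) M = h z - a0 M * wsum (tterm tau z) M.
    by rewrite /v wsumB (wsumZ (a0 M)); congr (_ - _); exact: esym (dcoef_inv h z M).
  have := @wsum_tannery _ g v (fun=> 0) sg.
  have -> : (fun M => wsum (v M) M - wsum (fun=> 0) M)
     = (fun M => h z - a0 M * wsum (tterm tau z) M).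
    by apply/funext => M; rewrite vE (@wsum_eq0 _ (fun=> 0)) ?subr0.
  apply => [M m mM|m|m].
  - apply: le_trans (absB _ _) _; apply: lerD.
      have [h1 h2] := HK2 M m mM.
      by apply: quad_decay_bound; rewrite ?abs_ge0.
    by rewrite absM; apply: ler_pM; rewrite ?abs_ge0 ?tterm_le0.
  - by rewrite abs0; case: sg.
  - have E M : v M m = e2pi (m%:~R * z) * (a M m z - c m * a0 M).
      have tE : tterm tau z m = e2pi (m%:~R * z) * c m.
        rewrite /c /tterm (mulrCA (e2pi _) ((-1) ^ m)) -e2piD.
        by congr (_ * e2pi _); ring.
      by rewrite /v aE tE; ring.
    under eq_fun do rewrite E.
    by have := cvgM (cvg_cst (e2pi (m%:~R * z))) (conv m z); rewrite mulr0; apply.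
have lim2 z : (fun M => h z - a0 M * theta tau z) @ \oo --> (0 : C).
  apply/cvgC_abs => e e0; have e2 : 0 < e / 2 by lra.
  have [M1 H1] := (cvgC_abs _ _).1 (lim z) _ e2.
  have e3 : 0 < e / 2 / (K1 + 1) by rewrite divr_gt0 //; lra.
  have [M2 H2] := (cvgC_abs _ _).1 (@theta_cvg _ tau z t0) _ e3.
  exists (maxn M1 M2) => M; rewrite geq_max => /andP[/H1 h1 /H2 h2].
  rewrite subr0 in h1; rewrite subr0.
  have -> : h z - a0 M * theta tau z = (h z - a0 M * wsum (tterm tau z) M)
     + a0 M * (wsum (tterm tau z) M - theta tau z) by ring.
  apply: le_lt_trans (absD _ _) _; rewrite [e]splitr; apply: ltr_leD => //.
  rewrite absM; apply: le_trans (ler_pM _ _ (a0b M) (ltW h2)) _; rewrite ?abs_ge0 //.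
  rewrite mulrA ler_pdivrMr; last lra.
  by rewrite mulrC ler_wpM2l; lra.
(* The limit of a0 exists because theta does not vanish at 1/2. *)
have tz : theta tau 2%:R^-1 != 0.
  by apply: theta_neq0 => // *; apply: half_notin_lattice.
have a0c : a0 @ \oo --> h 2%:R^-1 / theta tau 2%:R^-1.
  have H := cvgM (cvgB (cvg_cst (h 2%:R^-1)) (lim2 2%:R^-1))
    (cvg_cst (theta tau 2%:R^-1)^-1); rewrite subr0 in H.
  suff E M : a0 M = (h 2%:R^-1 - (h 2%:R^-1 - a0 M * theta tau 2%:R^-1))
      * (theta tau 2%:R^-1)^-1.
    have -> : a0 = (fun M => (h 2%:R^-1 - (h 2%:R^-1 - a0 M * theta tau 2%:R^-1))
      * (theta tau 2%:R^-1)^-1) by apply/funext.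
    exact: H.
  by move: (a0 M) => t; field.
exists (h 2%:R^-1 / theta tau 2%:R^-1) => z.
have l1 := lim2 z.
have l2 := cvgB (cvg_cst (h z)) (cvgM a0c (cvg_cst (theta tau z))).
apply/eqP; rewrite -subr_eq0; apply/eqP.
apply: (cvg_unique (@norm_hausdorff _ _) _ l1).
by have := l2; apply.
Qed.

End ThetaUnique.

(** * Theta functions of order n *)

Section ThetaLevel.
Variable R : realType.
Local Notation C := R[i].
Implicit Types (f g : C -> C) (z w x y tau : C).

(** The hypotheses say that f, after division by e2pi (a y), is a function of n y
    with the quasi-periods of theta at n tau, up to a translation; thus theta_unique
    applies to f and to g. *)
Lemma theta_level_unique (n : nat) tau (a : int) x f g :
  (0 < n)%N -> 0 < complex.Im tau -> tame f -> tame g ->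
  (forall y, f (y + n%:R^-1) = e2pi (a%:~R / n%:R) * f y) ->
  (forall y, f (y + tau) = - e2pi (- (n%:R * (y + x))) * f y) ->
  (forall y, g (y + n%:R^-1) = e2pi (a%:~R / n%:R) * g y) ->
  (forall y, g (y + tau) = - e2pi (- (n%:R * (y + x))) * g y) ->
  (exists y, g y != 0) -> exists c, forall y, f y = c * g y.
Proof.
move=> n0 t0 tf tg f1 f2 g1 g2 [y0 gy0].
have nn : (n%:R : C) != 0 by rewrite pnatr_eq0 -lt0n.
pose s := a%:~R * tau + n%:R * x.
pose tr h w := e2pi (- (a%:~R * ((w - s) / n%:R))) * h ((w - s) / n%:R) : C.
have tnt : 0 < complex.Im (n%:R * tau).
  rewrite -(rmorph_nat (real_complex R)); case: (tau) t0 => p q /= q0.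
  by rewrite mul0r addr0 mulr_gt0 ?ltr0n.
have key h : tame h -> (forall y, h (y + n%:R^-1) = e2pi (a%:~R / n%:R) * h y) ->
    (forall y, h (y + tau) = - e2pi (- (n%:R * (y + x))) * h y) ->
    exists c, forall y, h y = c * (e2pi (a%:~R * y) * theta (n%:R * tau) (n%:R * y + s)).
  move=> th h1 h2; have [|||c hc] := @theta_unique _ (n%:R * tau) (tr h) tnt.
  - have E w : (w - s) / n%:R = n%:R^-1 * w + - (s / n%:R) by ring.
    have -> : tr h = fun w => e2pi (- a%:~R * n%:R^-1 * w + a%:~R * (s / n%:R))
       * h (n%:R^-1 * w + - (s / n%:R)).
      by apply/funext => w; rewrite /tr E; congr (e2pi _ * _); ring.
    by apply: tameM; apply: tame_affine => //; apply: tame_e2pi.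
  - move=> w; rewrite /tr.
    have -> : (w + 1 - s) / n%:R = (w - s) / n%:R + n%:R^-1 by ring.
    by rewrite h1 mulrA -e2piD; congr (e2pi _ * _); ring.
  - move=> w; rewrite /tr.
    have -> : (w + n%:R * tau - s) / n%:R = (w - s) / n%:R + tau by field.
    rewrite h2 !mulNr mulrN [in RHS]mulrA [in LHS]mulrA -!e2piD; congr (- (e2pi _ * _)).
    by rewrite /s; field.
  exists c => y; have := hc (n%:R * y + s); rewrite /tr.
  have -> : (n%:R * y + s - s) / n%:R = y by field.
  move=> e.
  rewrite mulrCA -e mulrA -e2piD; have -> : a%:~R * y + - (a%:~R * y) = 0 by ring.
  by rewrite e2pi0 mul1r.
have [cf hf] := key f tf f1 f2; have [cg hg] := key g tg g1 g2.
have cg0 : cg != 0 by apply: contraNneq gy0 => c0; rewrite hg c0 mul0r.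
by exists (cf / cg) => y; rewrite hf hg (mulrA (cf / cg)) mulfVK.
Qed.

Lemma Im_inv_gt0 tau : 0 < complex.Im tau -> 0 < complex.Im (- tau^-1).
Proof.
case: tau => p q /= q0; rewrite opprK divr_gt0 //.
by rewrite ltr_wpDl ?sqr_ge0 // exprn_gt0.
Qed.

Lemma upper_neq0 tau : 0 < complex.Im tau -> tau != 0.
Proof. by apply: contraTneq => -> /=; rewrite ltxx. Qed.

(** Divided by the Gaussian factor, z |-> theta (-1/tau) (z / tau) has the
    quasi-periods of theta tau; its value at tau / 2 shows that the constant is not 0. *)
Lemma theta_inversion tau : 0 < complex.Im tau -> exists2 c : C, c != 0 &
  forall z, theta (- tau^-1) (z / tau)
    = c * e2pi (z ^+ 2 / (2 * tau) - z / 2 + z / (2 * tau)) * theta tau z.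
Proof.
move=> t0; have tn := upper_neq0 t0; have t0' := Im_inv_gt0 t0.
pose q z := z ^+ 2 / (2 * tau) - z / 2 + z / (2 * tau) : C.
pose h z := e2pi (- q z) * theta (- tau^-1) (z / tau).
have h1' z : h (z - 1) = h z.
  rewrite /h; have -> : (z - 1) / tau = z / tau + - tau^-1 by ring.
  rewrite thetaDtau // mulrA mulrN -e2piD mulNr.
  have -> : - q (z - 1) + - (z / tau) = - q z + 2%:R^-1 + (-1)%:~R by rewrite /q; field.
  by rewrite e2piDint e2piD e2pi_half mulrN1 mulNr opprK.
have h1 z : h (z + 1) = h z by rewrite -h1' addrK.
have h2 z : h (z + tau) = - e2pi (- z) * h z.
  rewrite /h mulrDl mulfV // thetaD1 mulrA; congr (_ * _).
  rewrite mulNr -e2piD -[RHS]mulN1r -e2pi_half -e2piD -[RHS](e2piDint _ (-1)).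
  by congr e2pi; rewrite /q; field.
have th : tame h.
  apply: tameM.
    apply: (tame_comp (g := fun z => - q z) (tame_e2pi R)).
    have -> : (fun z => - q z) = fun z => (- (2 * tau)^-1) * (z * z)
        + ((2^-1 - (2 * tau)^-1) * z + 0).
      by apply/funext => z; rewrite /q; field.
    apply: tameD; first by apply: tameM; [exact: tame_cst | apply: tameM; exact: tame_id].
    exact: (tame_affine _ _ (tame_id R)).
  have -> : (fun z => theta (- tau^-1) (z / tau)) =
     fun z => theta (- tau^-1) (tau^-1 * z + 0).
    by apply/funext => z; rewrite addr0 mulrC.
  by apply: tame_affine; apply: tame_theta.
have [c hc] := theta_unique t0 th h1 h2.
have E z : theta (- tau^-1) (z / tau) = c * e2pi (q z) * theta tau z.
  rewrite mulrAC -hc /h mulrAC -e2piD addNr e2pi0 mul1r //.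
exists c => //; apply/eqP => c0.
have := E (2%:R^-1 * tau); rewrite c0 !mul0r mulfK //; apply/eqP.
by apply: theta_neq0 => // *; apply: half_notin_lattice.
Qed.

(** The product in theta_, whose factors are permuted by translations by 1 / n. *)
Definition btheta (n : nat) tau x : C := \prod_(m < n) theta tau (x + m%:R / n%:R).

Lemma periodic_ordS (p : C -> C) (n : nat) y (l : 'I_n) :
  (forall z, p (z + 1) = p z) ->
  p (y + n%:R^-1 + l%:R / n%:R) = p (y + (ordS l)%:R / n%:R).
Proof.
move=> p1; case: n l => [[//]|n] l /=.
have nn : (n.+1%:R : C) != 0 by rewrite pnatr_eq0.
have [ln|ln] := ltnP l n.
  rewrite modn_small // -(addn1 l) natrD; congr p; ring.
have -> : l = n :> nat by apply/eqP; rewrite eqn_leq ln -ltnS ltn_ord.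
rewrite modnn -[RHS]p1; congr p; rewrite -[n.+1]addn1 natrD.
by field; rewrite -natr1 in nn.
Qed.

Lemma bthetaD1n n tau x : btheta n tau (x + n%:R^-1) = btheta n tau x.
Proof.
rewrite /btheta [RHS](reindex_inj (@ordS_inj n)).
by apply: eq_bigr => l _; apply: periodic_ordS; apply: thetaD1.
Qed.

Lemma bthetaDint n tau x (a : int) : btheta n tau (x + a%:~R / n%:R) = btheta n tau x.
Proof.
case: a => a; rewrite ?NegzE.
  elim: a => [|a IH]; first by rewrite mul0r addr0.
  by rewrite -addn1 PoszD intrD mulrDl mul1r addrA bthetaD1n.
rewrite -(addn1 a); elim: a => [|a IH].
  by rewrite -bthetaD1n mulNr mul1r subrK.
have -> : - Posz (a.+1 + 1) = - Posz (a + 1) - 1 by lia.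
by rewrite intrD mulrDl addrA -[LHS]bthetaD1n mulN1r subrK.
Qed.

Lemma e2pi_prod (I : Type) (r : seq I) (P : pred I) (F : I -> C) :
  \prod_(i <- r | P i) e2pi (F i) = e2pi (\sum_(i <- r | P i) F i).
Proof. by apply/esym/big_morph; [exact: e2piD | exact: e2pi0]. Qed.

Lemma sum_ordR (n : nat) : \sum_(m < n) (m%:R : C) = n%:R * (n%:R - 1) / 2.
Proof.
elim: n => [|n IH]; first by rewrite big_ord0 !mul0r.
by rewrite big_ord_recr /= IH -(addn1 n) natrD; field.
Qed.

Lemma opp_e2pi y : - e2pi y = e2pi (2%:R^-1 + y) :> C.
Proof. by rewrite e2piD e2pi_half mulN1r. Qed.

Lemma prod_quasi (n : nat) y : (0 < n)%N ->
  \prod_(m < n) - e2pi (- (y + m%:R / n%:R)) = - e2pi (- (n%:R * y)) :> C.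
Proof.
move=> n0; have nn : (n%:R : C) != 0 by rewrite pnatr_eq0 -lt0n.
have -> : \prod_(m < n) - e2pi (- (y + m%:R / n%:R))
   = \prod_(m < n) e2pi (2%:R^-1 - y - m%:R / n%:R) :> C.
  by apply: eq_bigr => m _; rewrite opp_e2pi; congr e2pi; ring.
rewrite e2pi_prod sumrB sumr_const card_ord -mulr_suml sum_ordR -mulr_natr.
by rewrite opp_e2pi; congr e2pi; field.
Qed.

Lemma bthetaDtau n tau x : (0 < n)%N -> 0 < complex.Im tau ->
  btheta n tau (x + tau) = - e2pi (- (n%:R * x)) * btheta n tau x.
Proof.
move=> n0 t0; rewrite -prod_quasi // /btheta -big_split; apply: eq_bigr => m _ /=.
by rewrite addrAC thetaDtau.
Qed.

Lemma theta_E n tau (a : int) z : theta_ n tau a z =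
  e2pi (a%:~R * z + a%:~R / (2 * n)%:R + (a * (a - n%:Z))%:~R / (2 * n)%:R * tau)
  * btheta n tau (z + a%:~R / n%:R * tau).
Proof. by congr (_ * _); apply: eq_bigr => m _; rewrite addrAC. Qed.

Variables (n : nat) (n_gt0 : (0 < n)%N).
Let nn : (n%:R : C) != 0. Proof. by rewrite pnatr_eq0 -lt0n. Qed.

Lemma theta_D1n tau a z :
  theta_ n tau a (z + n%:R^-1) = e2pi (a%:~R / n%:R) * theta_ n tau a z.
Proof.
by rewrite !theta_E (addrAC z) bthetaD1n mulrA -e2piD; congr (e2pi _ * _); ring.
Qed.

Lemma theta_Dtau tau a z : 0 < complex.Im tau ->
  theta_ n tau a (z + tau) = - e2pi (- (n%:R * z)) * theta_ n tau a z.
Proof.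
move=> t0; rewrite !theta_E (addrAC z) bthetaDtau // mulrA [in RHS]mulrA.
by rewrite mulrN !mulNr -!e2piD; congr (- (e2pi _ * _)); rewrite natrM; field.
Qed.

Lemma theta_add tau (a b : int) z : theta_ n tau (a + b) z =
  e2pi (b%:~R * z + b%:~R / (2 * n)%:R + (b * (b - n%:Z))%:~R / (2 * n)%:R * tau)
  * theta_ n tau a (z + b%:~R / n%:R * tau).
Proof.
rewrite !theta_E mulrA -e2piD natrM; congr (e2pi _ * btheta _ _ _).
  by rewrite !(intrM, intrD, intrN) -[(n%:Z)%:~R]/(n%:R); field.
by rewrite intrD; ring.
Qed.

Lemma theta_addn tau (a : int) z : 0 < complex.Im tau ->
  theta_ n tau (a + n%:Z) z = theta_ n tau a z.
Proof.
move=> t0; rewrite theta_add; have -> : (n%:Z)%:~R / n%:R * tau = tau.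
  by rewrite -[(n%:Z)%:~R]/(n%:R) mulfV // mul1r.
rewrite theta_Dtau // subrr mulr0 mul0r mul0r addr0 mulrA.
have -> : e2pi ((n%:Z)%:~R * z + (n%:Z)%:~R / (2 * n)%:R) = - e2pi (n%:R * z) :> C.
  rewrite -[(n%:Z)%:~R]/(n%:R) e2piD natrM.
  have -> : n%:R / (2 * n%:R) = 2^-1 :> C by field.
  by rewrite e2pi_half mulrN1.
by rewrite mulrNN -e2piD subrr e2pi0 mul1r.
Qed.

Lemma theta_addMn tau (a k : int) z : 0 < complex.Im tau ->
  theta_ n tau (a + k * n%:Z) z = theta_ n tau a z.
Proof.
move=> t0; case: k => k; rewrite ?NegzE.
  elim: k => [|k IH]; first by rewrite mul0r addr0.
  by rewrite -addn1 PoszD mulrDl mul1r addrA theta_addn.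
elim: k => [|k IH].
  by rewrite -(theta_addn (a + _)) // mulN1r subrK.
rewrite -IH -[LHS]theta_addn //; congr (theta_ n tau _ z).
by rewrite -(addn1 k.+1) PoszD opprD mulrDl mulN1r addrA subrK.
Qed.

Lemma theta_modn tau (a b : int) z : 0 < complex.Im tau ->
  (a = b %[mod n%:Z])%Z -> theta_ n tau a z = theta_ n tau b z.
Proof.
move=> t0 ab; rewrite (divz_eq a n%:Z) (divz_eq b n%:Z) ab.
by rewrite addrC theta_addMn // addrC theta_addMn.
Qed.

(** The factors of theta_ only depend on tau through the translation by a tau / n,
    which becomes a permutation of the factors for tau + 1; the exponential in
    front gives the phase. *)
Lemma theta_tauD1_level tau a z : theta_ n (tau + 1) a z =
  e2pi ((a * (a - n%:Z))%:~R / (2 * n)%:R) * theta_ n tau a z.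
Proof.
rewrite !theta_E.
have -> : btheta n (tau + 1) (z + a%:~R / n%:R * (tau + 1))
   = btheta n tau (z + a%:~R / n%:R * tau).
  have -> : z + a%:~R / n%:R * (tau + 1) = z + a%:~R / n%:R * tau + a%:~R / n%:R by ring.
  by rewrite bthetaDint; apply: eq_bigr => m _; rewrite theta_tauD1.
by rewrite mulrA -e2piD; congr (e2pi _ * _); ring.
Qed.

Lemma theta_1n_neq0 tau z : 0 < complex.Im tau -> ~ frac_lattice n tau z ->
  forall m b : int, theta tau (z + m%:~R / n%:R + b%:~R / n%:R * tau) != 0.
Proof.
move=> t0 zL m b; apply: theta_neq0 => // p q e; apply: zL.
exists (p * n%:Z - m), (q * n%:Z - b).
rewrite !intrB !intrM -[(n%:Z)%:~R]/(n%:R).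
have -> : z = (p%:~R + q%:~R * tau) - m%:~R / n%:R - b%:~R / n%:R * tau.
  by rewrite -e; ring.
by field.
Qed.

Lemma btheta_neq0 tau z (b : int) : 0 < complex.Im tau -> ~ frac_lattice n tau z ->
  btheta n tau (z + b%:~R / n%:R * tau) != 0.
Proof.
move=> t0 zL; apply/prodf_neq0 => m _; rewrite addrAC.
exact: (theta_1n_neq0 t0 zL (Posz m) b).
Qed.

Lemma theta__neq0 tau z a : 0 < complex.Im tau -> ~ frac_lattice n tau z ->
  theta_ n tau a z != 0.
Proof.
by move=> t0 zL; rewrite theta_E mulf_neq0 ?e2pi_neq0 // btheta_neq0.
Qed.

Lemma Im_lattice (a b : int) tau :
  complex.Im (a%:~R + b%:~R * tau) = b%:~R * complex.Im tau.
Proof.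
by rewrite -!(rmorph_int (real_complex R)); case: tau => x y /=; ring.
Qed.

Lemma theta__0_neq0 tau (a : nat) : 0 < complex.Im tau -> (0 < a < n)%N ->
  theta_ n tau a 0 != 0.
Proof.
move=> t0 /andP[a0 an]; rewrite theta_E mulf_neq0 ?e2pi_neq0 //.
apply/prodf_neq0 => m _; apply: theta_neq0 => // p q.
rewrite add0r addrC => /(congr1 (fun u => u * n%:R)).
have -> : (m%:R / n%:R + a%:~R / n%:R * tau) * n%:R
   = (Posz m)%:~R + (Posz a)%:~R * tau by rewrite /= ; field.
have -> : (p%:~R + q%:~R * tau) * n%:R = (p * n%:Z)%:~R + (q * n%:Z)%:~R * tau.
  by rewrite !intrM -[(n%:Z)%:~R]/(n%:R); ring.
move=> /(congr1 (@complex.Im R)); rewrite !Im_lattice.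
move=> /(mulIf (lt0r_neq0 t0))/eqP; rewrite eqr_int => /eqP.
by case: q => q; [case: q => [|q]|]; nia.
Qed.

Lemma tame_theta_ tau a : 0 < complex.Im tau -> tame (theta_ n tau a).
Proof.
move=> t0; apply: tameM.
  rewrite (_ : (fun z => _) = (fun z => e2pi (a%:~R * z + (a%:~R / (2 * n)%:R
     + (a * (a - n%:Z))%:~R / (2 * n)%:R * tau)))).
    by apply: tame_affine; apply: tame_e2pi.
  by apply/funext => z; rewrite addrA.
apply: tame_prod => m _.
rewrite (_ : (fun z => _) = (fun z => theta tau (1 * z + (m%:R / n%:R
     + a%:~R / n%:R * tau)))).
  by apply: tame_affine; apply: tame_theta.
by apply/funext => z; rewrite addrA mul1r.
Qed.

End ThetaLevel.

(** * The kernel of R under inversion *)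

Section ThetaKernel.
Variable R : realType.
Local Notation C := R[i].
Implicit Types (z w x y tau : C).
Variables (n : nat) (n_gt0 : (0 < n)%N).
Let nn : (n%:R : C) != 0. Proof. by rewrite pnatr_eq0 -lt0n. Qed.

(** The Kronecker function, up to the factor theta'(0). It transforms simply under
    tau |-> -1/tau, and kern is a finite Fourier transform of it. *)
Definition kron tau x y : C := theta tau (x + y) / (theta tau x * theta tau y).

(** The coefficients of R: x and y stand for -z and eta. *)
Definition kern tau (a b : int) x y : C :=
  theta_ n tau (a + b) (x + y) / (theta_ n tau a x * theta_ n tau b y).

Definition theta_const tau : C :=
  \prod_(l < n | l != 0 :> nat) theta tau (l%:R / n%:R).

Lemma theta_const_neq0 tau : 0 < complex.Im tau -> theta_const tau != 0.
Proof.
move=> t0; apply/prodf_neq0 => l l0; apply: theta_neq0 => // p q.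
move=> /(congr1 (fun u => u * n%:R)); rewrite mulfVK // mulrDl => e.
have := congr1 (@complex.Im R) e.
have -> : (l%:R : C) = (Posz l)%:~R + 0%:~R * tau by rewrite mul0r addr0.
have -> : p%:~R * n%:R + q%:~R * tau * n%:R = (p * n%:Z)%:~R + (q * n%:Z)%:~R * tau.
  by rewrite !intrM -[(n%:Z)%:~R]/(n%:R); ring.
rewrite !Im_lattice => /(mulIf (lt0r_neq0 t0))/eqP; rewrite eqr_int => /eqP q0.
have {}q0 : q = 0 by move: q0 n_gt0; case: (q) => k; [case: k => [|k]|]; nia.
move: e; rewrite q0 !mul0r addr0 -[l%:R]/((Posz l)%:~R) -[n%:R]/((Posz n)%:~R) -intrM.
move=> /eqP; rewrite eqr_int => /eqP.
have ln := ltn_ord l.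
by case: (p) => k; [case: k => [|k]|]; nia.
Qed.

Lemma ordS_bij_reindex (F : 'I_n -> C) : \sum_(l < n) F (ordS l) = \sum_(l < n) F l.
Proof. by rewrite [RHS](reindex_inj (@ordS_inj n)). Qed.

Lemma e2pi_ordS (a : int) (l : 'I_n) :
  e2pi (- (a%:~R * l%:R / n%:R)) = e2pi (a%:~R / n%:R) * e2pi (- (a%:~R * (ordS l)%:R / n%:R)) :> C.
Proof.
pose p z : C := e2pi (- (a%:~R * z)).
have p1 z : p (z + 1) = p z.
  have -> : p (z + 1) = e2pi (- (a%:~R * z) + (- a)%:~R).
    by rewrite /p intrN; congr e2pi; ring.
  by rewrite e2piDint.
have := periodic_ordS 0 l p1; rewrite /p !add0r => h.
have -> : a%:~R * (ordS l)%:R / n%:R = a%:~R * ((ordS l)%:R / n%:R) :> C by rewrite mulrA.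
by rewrite -h -e2piD; congr e2pi; ring.
Qed.

(** Both sides, as functions of y, are multiplied by the same factors under 1 / n and
    tau, hence are proportional by theta_level_unique; at y = 0 only the term
    l = 0 of the left-hand side survives. *)
Lemma theta_interpolation tau (a : int) x y : 0 < complex.Im tau ->
  theta_ n tau a x != 0 ->
  \sum_(l < n) e2pi (- (a%:~R * l%:R / n%:R)) * (theta tau (n%:R * x + y + l%:R / n%:R)
     * \prod_(i < n | i != l) theta tau (y + i%:R / n%:R))
  = theta tau (n%:R * x) * theta_const tau * theta_ n tau a (x + y) / theta_ n tau a x.
Proof.
move=> t0 ax0.
pose f y : C := \sum_(l < n) e2pi (- (a%:~R * l%:R / n%:R)) *
  (theta tau (n%:R * x + y + l%:R / n%:R)
   * \prod_(i < n | i != l) theta tau (y + i%:R / n%:R)).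
rewrite -/(f y).
have tt := tame_theta t0.
have sh (b : C) : tame (fun y => theta tau (y + b)).
  have -> : (fun y => theta tau (y + b)) = (fun y => theta tau (1 * y + b)).
    by apply/funext => u; rewrite mul1r.
  exact: tame_affine.
have [|||||||c hc] := @theta_level_unique _ n tau a x f (fun y => theta_ n tau a (x + y)) n_gt0 t0.
- apply: tame_sum => l _; apply: tameM; first exact: tame_cst.
  apply: tameM.
    rewrite (_ : (fun z => _) = (fun z => theta tau (z + (n%:R * x + l%:R / n%:R)))) //.
    by apply/funext => z; congr theta; ring.
  by apply: tame_prod => i _.
- rewrite (_ : (fun z => _) = (fun z => theta_ n tau a (1 * z + x))).
    by apply: tame_affine; apply: tame_theta_.
  by apply/funext => z; rewrite mul1r addrC.
- move=> {}y; rewrite /f mulr_sumr.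
  rewrite -[RHS]ordS_bij_reindex; apply: eq_bigr => l _.
  rewrite e2pi_ordS -mulrA; congr (_ * (_ * (_ * _))).
    by rewrite addrA periodic_ordS //; apply: thetaD1.
  rewrite [RHS](reindex_inj (@ordS_inj n)) /=.
  apply: eq_big => [i|i _]; first by rewrite (inj_eq (@ordS_inj n)).
  by apply: periodic_ordS; apply: thetaD1.
- move=> {}y; rewrite /f mulr_sumr; apply: eq_bigr => l _.
  rewrite [RHS]mulrCA; congr (_ * _).
  have -> : n%:R * x + (y + tau) + l%:R / n%:R = (n%:R * x + y + l%:R / n%:R) + tau by ring.
  rewrite thetaDtau //.
  have -> : - e2pi (- (n%:R * (y + x))) = e2pi (- (n%:R * x)) * - e2pi (- (n%:R * y)) :> C.
    by rewrite mulrN -e2piD; congr (- e2pi _); ring.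
  rewrite -prod_quasi // [\prod_(m < n) - e2pi _](bigD1 l) //=.
  have -> : \prod_(i < n | i != l) theta tau (y + tau + i%:R / n%:R)
   = (\prod_(i < n | i != l) - e2pi (- (y + i%:R / n%:R)))
     * \prod_(i < n | i != l) theta tau (y + i%:R / n%:R).
    by rewrite -big_split; apply: eq_bigr => i _ /=; rewrite addrAC thetaDtau.
  have -> : - e2pi (- (n%:R * x + y + l%:R / n%:R))
    = e2pi (- (n%:R * x)) * - e2pi (- (y + l%:R / n%:R)) :> C.
    by rewrite mulrN -e2piD; congr (- e2pi _); ring.
  by ring.
- by move=> {}y; rewrite addrA theta_D1n.
- by move=> {}y; rewrite addrA theta_Dtau // (addrC x y).
- by exists 0; rewrite addr0.
have f0 : f 0 = theta tau (n%:R * x) * theta_const tau.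
  have n0 := n_gt0; pose o : 'I_n := Ordinal n0.
  rewrite /f (bigD1 o) //= [X in _ + X]big1 ?addr0 => [|l lo]; last first.
    by rewrite (bigD1 o) 1?eq_sym //= mul0r addr0 theta0 // mul0r !mulr0.
  rewrite !mul0r mulr0 !mul0r oppr0 e2pi0 mul1r !addr0; congr (_ * _).
  by apply: eq_bigr => i _; rewrite add0r.
have c0 : c = theta tau (n%:R * x) * theta_const tau / theta_ n tau a x.
  by rewrite -f0 hc addr0 mulfK.
by rewrite hc c0 mulrAC.
Qed.

Lemma theta_natM_neq0 tau x : 0 < complex.Im tau -> ~ frac_lattice n tau x ->
  theta tau (n%:R * x) != 0.
Proof.
move=> t0 xL; apply: theta_neq0 => // c d e; apply: xL.
by exists c, d; rewrite -e mulrAC mulfV // mul1r.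
Qed.

(** theta_interpolation divided by theta (n x) theta_0 (y). *)
Lemma kern0_kron tau (a : int) x y : 0 < complex.Im tau ->
  ~ frac_lattice n tau x -> ~ frac_lattice n tau y ->
  theta_const tau * kern tau a 0 x y =
  \sum_(l < n) e2pi (- (a%:~R * l%:R / n%:R)) * kron tau (n%:R * x) (y + l%:R / n%:R).
Proof.
move=> t0 xL yL.
have ax := theta__neq0 n_gt0 a t0 xL.
have tx := theta_natM_neq0 t0 xL.
have ty (l : 'I_n) : theta tau (y + l%:R / n%:R) != 0.
  by have := theta_1n_neq0 n_gt0 t0 yL (Posz l) 0; rewrite mul0r mul0r addr0.
have b0 : theta_ n tau 0 y = btheta n tau y.
  by rewrite theta_E !mul0r !addr0 e2pi0 mul1r.
have by0 : btheta n tau y != 0 by apply/prodf_neq0 => l _; apply: ty.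
have := theta_interpolation y t0 ax => e.
rewrite /kern addr0 b0.
have -> : theta_const tau * (theta_ n tau a (x + y) / (theta_ n tau a x * btheta n tau y))
  = (theta tau (n%:R * x) * theta_const tau * theta_ n tau a (x + y) / theta_ n tau a x)
    / (theta tau (n%:R * x) * btheta n tau y).
  by field; rewrite tx ax by0.
rewrite -e mulr_suml; apply: eq_bigr => l _; rewrite -[LHS]mulrA; congr (_ * _).
have -> : btheta n tau y = theta tau (y + l%:R / n%:R)
    * \prod_(i < n | i != l) theta tau (y + i%:R / n%:R).
  by rewrite /btheta (bigD1 l).
rewrite /kron (addrA _ y).
field; rewrite tx ty /=; apply/prodf_neq0 => i _; exact: ty.
Qed.

Lemma frac_lattice_shift tau y (b : int) :
  ~ frac_lattice n tau y -> ~ frac_lattice n tau (y + b%:~R / n%:R * tau).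
Proof.
move=> yL [c [d e]]; apply: yL; exists c, (d - b); rewrite intrB.
have -> : y = (c%:~R + d%:~R * tau) / n%:R - b%:~R / n%:R * tau by rewrite -e addrK.
by ring.
Qed.

(** theta_b is theta_0 translated by b tau / n, up to an exponential. *)
Lemma kern_shift tau (a b : int) x y :
  kern tau a b x y = e2pi (b%:~R * x) * kern tau a 0 x (y + b%:~R / n%:R * tau).
Proof.
rewrite /kern addr0 theta_add // -[b in theta_ n tau b y]add0r theta_add //.
rewrite addrA; set A := theta_ n tau a _; set B := theta_ n tau a x; set D := theta_ n tau 0 _.
pose q : C := b%:~R / (2 * n)%:R + (b * (b - n%:Z))%:~R / (2 * n)%:R * tau.
have -> : e2pi (b%:~R * (x + y) + b%:~R / (2 * n)%:R
   + (b * (b - n%:Z))%:~R / (2 * n)%:R * tau)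
  = e2pi (b%:~R * x) * e2pi (b%:~R * y + q) :> C.
  by rewrite -e2piD /q; congr e2pi; ring.
have -> : e2pi (b%:~R * y + b%:~R / (2 * n)%:R
   + (b * (b - n%:Z))%:~R / (2 * n)%:R * tau) = e2pi (b%:~R * y + q) :> C.
  by rewrite /q addrA.
have e0 : e2pi (b%:~R * y + q) != 0 := e2pi_neq0 _.
set u := e2pi (b%:~R * y + q) in e0 *; set v := e2pi _.
transitivity (u / u * (v * (A / (B * D)))); first by rewrite !invfM; ring.
by rewrite mulfV // mul1r.
Qed.

Lemma kern_kron tau (a b : int) x y : 0 < complex.Im tau ->
  ~ frac_lattice n tau x -> ~ frac_lattice n tau y ->
  theta_const tau * kern tau a b x y = e2pi (b%:~R * x) *
  \sum_(l < n) e2pi (- (a%:~R * l%:R / n%:R))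
     * kron tau (n%:R * x) (y + b%:~R / n%:R * tau + l%:R / n%:R).
Proof.
move=> t0 xL yL; rewrite kern_shift mulrCA kern0_kron //.
exact: frac_lattice_shift.
Qed.

Lemma sum_e2pi_ord (m : int) :
  \sum_(l < n) e2pi (m%:~R * l%:R / n%:R) = (if (n%:Z %| m)%Z then n%:R else 0) :> C.
Proof.
case: ifP => mn.
  rewrite (eq_bigr (fun=> 1)) => [|l _]; first by rewrite sumr_const card_ord.
  have /dvdzP[k ->] := mn; rewrite intrM -[(n%:Z)%:~R]/(n%:R).
  have -> : k%:~R * n%:R * l%:R / n%:R = (k * Posz l)%:~R :> C.
    by rewrite intrM -[(Posz l)%:~R]/(l%:R); field.
  exact: e2pi_int.
pose zeta : C := e2pi (m%:~R / n%:R).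
have E (l : 'I_n) : e2pi (m%:~R * l%:R / n%:R) = zeta ^+ l.
  by rewrite -e2piMn -mulr_natr; congr e2pi; ring.
under eq_bigr do rewrite E.
have : (zeta - 1) * \sum_(l < n) zeta ^+ l = 0.
  rewrite -subrX1 -e2piMn; have -> : m%:~R / n%:R *+ n = m%:~R :> C.
    by rewrite -mulr_natr mulfVK.
  by rewrite e2pi_int subrr.
move=> /eqP; rewrite mulf_eq0 subr_eq0 => /orP[/eqP/e2pi_eq1[k]|/eqP//].
move=> /(congr1 (fun u => u * n%:R)); rewrite mulfVK // -[n%:R]/((n%:Z)%:~R) -intrM.
move=> /eqP; rewrite eqr_int => /eqP e; move: mn; rewrite e.
by have -> : (n%:Z %| k * n%:Z)%Z by apply/dvdzP; exists k.
Qed.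

(** The inverse finite Fourier transform of kern_kron in the index a, for l in the
    place of b. *)
Lemma kron_kern tau (l b : int) x y : 0 < complex.Im tau ->
  ~ frac_lattice n tau x -> ~ frac_lattice n tau y ->
  n%:R * (e2pi (l%:~R * x) * kron tau (n%:R * x) (y + l%:~R / n%:R * tau - b%:~R / n%:R))
  = theta_const tau *
    \sum_(al < n) e2pi (- (al%:R * b%:~R / n%:R)) * kern tau (Posz al) l x y.
Proof.
move=> t0 xL yL.
pose G (j : C) := kron tau (n%:R * x) (y + l%:~R / n%:R * tau + j).
rewrite mulr_sumr.
have -> : \sum_(al < n) theta_const tau * (e2pi (- (al%:R * b%:~R / n%:R))
      * kern tau (Posz al) l x y) = e2pi (l%:~R * x) *
   \sum_(j < n) (\sum_(al < n) e2pi ((- (b + Posz j))%:~R * al%:R / n%:R)) * G (j%:R / n%:R).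
  under eq_bigr => al _ do rewrite mulrCA kern_kron // mulrCA.
  rewrite -mulr_sumr; congr (_ * _).
  under eq_bigr => al _ do rewrite mulr_sumr.
  rewrite exchange_big /=; apply: eq_bigr => j _; rewrite mulr_suml.
  apply: eq_bigr => al _; rewrite mulrA -e2piD; congr (e2pi _ * _).
  by rewrite intrN intrD -[(Posz j)%:~R]/(j%:R) -[(Posz al)%:~R]/(al%:R); ring.
under eq_bigr => j _ do rewrite sum_e2pi_ord.
have nz : (n%:Z != 0) by case: (n) n_gt0.
(* The only j that contributes is the residue of -b. *)
pose j0 := `|((- b) %% n%:Z)%Z|%N.
have j0E : Posz j0 = ((- b) %% n%:Z)%Z by rewrite /j0 gez0_abs // modz_ge0.
have j0n : (j0 < n)%N by rewrite -ltz_nat j0E ltz_pmod.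
rewrite (bigD1 (Ordinal j0n)) //= big1 => [|j jj]; last first.
  rewrite ifN ?mul0r // ; apply: contraNN jj.
  move=> /dvdzP[k e]; apply/eqP/val_inj => /=; apply/eqP.
  rewrite -eqz_nat j0E; have -> : - b = k * n%:Z + Posz j by rewrite -e; ring.
  by rewrite modzMDl modz_small // ltz_nat ltn_ord.
rewrite ifT; last first.
  rewrite j0E; have := divz_eq (- b) n%:Z => e.
  apply/dvdzP; exists ((- b) %/ n%:Z)%Z.
  by move: e; set p := _ * _; set r := (_ %% _)%Z; lia.
rewrite addr0 mulrCA; congr (_ * (_ * _)); rewrite /G.
have -> : (j0%:R : C) = (- b)%:~R - ((- b) %/ n%:Z)%Z%:~R * n%:R.
  rewrite -[j0%:R]/((Posz j0)%:~R) j0E -[n%:R]/((n%:Z)%:~R) -intrM -intrB.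
  by congr (_%:~R); rewrite {2}(divz_eq (- b) n%:Z) addrAC subrr add0r.
set k := ((- b) %/ n%:Z)%Z.
have -> : y + l%:~R / n%:R * tau + ((- b)%:~R - k%:~R * n%:R) / n%:R
  = (y + l%:~R / n%:R * tau - b%:~R / n%:R) + (- k)%:~R.
  by rewrite !intrN; field.
move: (y + _ - _) => Y; by rewrite /kron addrA !thetaDint.
Qed.

Lemma kron_inversion tau : 0 < complex.Im tau -> exists2 c : C, c != 0 &
  forall x y, kron (- tau^-1) (x / tau) (y / tau) = c * e2pi (x * y / tau) * kron tau x y.
Proof.
move=> t0; have [c c0 hc] := theta_inversion t0; have tn := upper_neq0 t0.
exists c^-1; first by rewrite invr_eq0.
move=> x y; rewrite /kron -mulrDl !hc.
pose q z : C := z ^+ 2 / (2 * tau) - z / 2 + z / (2 * tau).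
rewrite -!/(q _).
have -> : e2pi (q (x + y)) = e2pi (x * y / tau) * (e2pi (q x) * e2pi (q y)).
  by rewrite -!e2piD; congr e2pi; rewrite /q; field.
have ex : e2pi (q x) != 0 := e2pi_neq0 _; have ey : e2pi (q y) != 0 := e2pi_neq0 _.
set w := e2pi (x * y / tau); set u := e2pi (q x) in ex *; set v := e2pi (q y) in ey *.
move: (theta tau _) (theta tau x) (theta tau y) => A B D.
transitivity (c / c * (u / u) * (v / v) * (c^-1 * w * (A / (B * D)))).
  by rewrite !invfM; ring.
by rewrite !mulfV // !mul1r.
Qed.

Lemma frac_lattice_inv tau z : tau != 0 ->
  frac_lattice n (- tau^-1) (z / tau) <-> frac_lattice n tau z.
Proof.
move=> tn; split=> [[a [b e]]|[a [b e]]].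
  exists (- b), a; rewrite intrN.
  have -> : z = (a%:~R + b%:~R * - tau^-1) / n%:R * tau by rewrite -e mulfVK.
  by field; rewrite tn nn.
by exists b, (- a); rewrite e intrN; field; rewrite tn nn.
Qed.

(** Inversion exchanges the translations by 1 / n and tau / n. Expand the left-hand
    side by kern_kron, invert kron, and collect the result by kron_kern. *)
Lemma kern_inversion tau : 0 < complex.Im tau -> exists2 c : C, c != 0 &
  forall (a b : int) x y, ~ frac_lattice n tau x -> ~ frac_lattice n tau y ->
  kern (- tau^-1) a b (x / tau) (y / tau) = c * e2pi (n%:R * x * y / tau) *
   \sum_(l < n) \sum_(al < n) e2pi (- ((a%:~R * l%:R + b%:~R * al%:R) / n%:R))
      * kern tau (Posz al) (Posz l) x y.
Proof.
move=> t0; have [c c0 hc] := kron_inversion t0; have tn := upper_neq0 t0.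
have t0' := Im_inv_gt0 t0; have P0 := theta_const_neq0 t0.
have P0' := theta_const_neq0 t0'.
exists (c * theta_const tau / (n%:R * theta_const (- tau^-1))).
  by rewrite !mulf_neq0 // ?invr_eq0 ?mulf_neq0.
move=> a b x y xL yL.
have xL' : ~ frac_lattice n (- tau^-1) (x / tau) by rewrite frac_lattice_inv.
have yL' : ~ frac_lattice n (- tau^-1) (y / tau) by rewrite frac_lattice_inv.
apply: (mulfI P0'); rewrite kern_kron //.
have E (l : 'I_n) : kron (- tau^-1) (n%:R * (x / tau))
    (y / tau + b%:~R / n%:R * - tau^-1 + l%:R / n%:R)
  = c * e2pi (n%:R * x * y / tau - b%:~R * x / tau) *
    (e2pi ((Posz l)%:~R * x) *
      kron tau (n%:R * x) (y + (Posz l)%:~R / n%:R * tau - b%:~R / n%:R)).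
  have -> : n%:R * (x / tau) = n%:R * x / tau by rewrite mulrA.
  have -> : y / tau + b%:~R / n%:R * - tau^-1 + l%:R / n%:R
     = (y + (Posz l)%:~R / n%:R * tau - b%:~R / n%:R) / tau.
    by rewrite -[(Posz l)%:~R]/(l%:R); field; rewrite tn nn.
  rewrite hc mulrA -[c * _ * e2pi _]mulrA -e2piD; congr (c * e2pi _ * _).
  by field; rewrite tn nn.
under eq_bigr => l _ do rewrite E.
have K (l : 'I_n) : e2pi ((Posz l)%:~R * x) *
      kron tau (n%:R * x) (y + (Posz l)%:~R / n%:R * tau - b%:~R / n%:R)
  = theta_const tau / n%:R * \sum_(al < n) e2pi (- (al%:R * b%:~R / n%:R))
     * kern tau (Posz al) (Posz l) x y.
  by apply: (mulfI nn); rewrite kron_kern // mulrA; congr (_ * _); field.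
under eq_bigr => l _ do rewrite K.
have ee : e2pi (b%:~R * (x / tau)) * e2pi (n%:R * x * y / tau - b%:~R * x / tau)
   = e2pi (n%:R * x * y / tau) :> C.
  by rewrite -e2piD; congr e2pi; ring.
have -> : theta_const (- tau^-1) * (c * theta_const tau / (n%:R * theta_const (- tau^-1))
   * e2pi (n%:R * x * y / tau) *
   \sum_(l < n) \sum_(al < n) e2pi (- ((a%:~R * l%:R + b%:~R * al%:R) / n%:R))
      * kern tau (Posz al) (Posz l) x y)
  = e2pi (b%:~R * (x / tau)) * (c * e2pi (n%:R * x * y / tau - b%:~R * x / tau)
     * (theta_const tau / n%:R) * \sum_(l < n) \sum_(al < n)
        e2pi (- ((a%:~R * l%:R + b%:~R * al%:R) / n%:R))
        * kern tau (Posz al) (Posz l) x y).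
  by rewrite -ee; field; rewrite nn P0'.
congr (_ * _); rewrite mulr_sumr; apply: eq_bigr => l _.
have -> : \sum_(al < n) e2pi (- ((a%:~R * l%:R + b%:~R * al%:R) / n%:R))
      * kern tau (Posz al) (Posz l) x y
  = e2pi (- (a%:~R * l%:R / n%:R)) * \sum_(al < n) e2pi (- (al%:R * b%:~R / n%:R))
     * kern tau (Posz al) (Posz l) x y.
  rewrite mulr_sumr; apply: eq_bigr => al _; rewrite mulrA -e2piD.
  by congr (e2pi _ * _); ring.
by ring.
Qed.

(** The shape of all factors of automorphy below; such functions are entire and have
    no zeros. *)
Definition qexp (s : C -> C) := exists k a b : C, k != 0 /\
  forall z, s z = k * e2pi (a * z ^+ 2 + b * z).

Lemma qexpM s t : qexp s -> qexp t -> qexp (fun z => s z * t z).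
Proof.
move=> [k [a [b [k0 hs]]]] [l [c [d [l0 ht]]]].
exists (k * l), (a + c), (b + d); split; first by rewrite mulf_neq0.
move=> z; rewrite hs ht mulrACA -e2piD; congr (_ * e2pi _); ring.
Qed.

Lemma qexp_prod (I : Type) (r : seq I) (s : I -> C -> C) :
  (forall i, qexp (s i)) -> qexp (fun z => \prod_(i <- r) s i z).
Proof.
move=> hs; elim: r => [|i r IH].
  exists 1, 0, 0; split=> [|z]; first exact: oner_neq0.
  by rewrite big_nil !mul0r addr0 e2pi0 mulr1.
rewrite (_ : (fun z => _) = (fun z => s i z * \prod_(i <- r) s i z)).
  exact: qexpM.
by apply/funext => z; rewrite big_cons.
Qed.

Lemma qexp_quad k (a b c : C) : k != 0 ->
  qexp (fun z => k * e2pi (a * z ^+ 2 + b * z + c)).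
Proof.
move=> k0; exists (k * e2pi c), a, b; split; first by rewrite mulf_neq0 ?e2pi_neq0.
by move=> z; rewrite -mulrA -e2piD; congr (_ * e2pi _); rewrite addrC.
Qed.

Lemma btheta_rev tau x : \prod_(l < n) theta tau (x - l%:R / n%:R) = btheta n tau x.
Proof.
rewrite -(bthetaDint n tau x (1 - n%:Z)) /btheta (reindex_inj rev_ord_inj) /=.
apply: eq_bigr => l _; congr theta.
rewrite natrB // -natr1 intrB -[(n%:Z)%:~R]/(n%:R); ring.
Qed.

(** Up to exponentials the product runs over theta (z + m / n + a tau / n) for all
    residues m and a, a set of translations that inversion preserves. *)
Lemma prod_theta_inversion tau : 0 < complex.Im tau -> exists2 s, qexp s &
  forall z, \prod_(a < n) theta_ n (- tau^-1) a (z / tau)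
    = s z * \prod_(a < n) theta_ n tau a z.
Proof.
move=> t0; have [c c0 hc] := theta_inversion t0; have tn := upper_neq0 t0.
pose P tau z : C := \prod_(a < n) btheta n tau (z + a%:R / n%:R * tau).
have H1 tau' : exists2 s, qexp s &
    forall z, \prod_(a < n) theta_ n tau' a z = s z * P tau' z.
  exists (fun z => \prod_(a < n) e2pi ((Posz a)%:~R * z + (Posz a)%:~R / (2 * n)%:R
       + (Posz a * (Posz a - n%:Z))%:~R / (2 * n)%:R * tau')).
    apply: qexp_prod => a.
    rewrite (_ : (fun z => _) = (fun z => 1 * e2pi (0 * z ^+ 2 + (Posz a)%:~R * z +
       ((Posz a)%:~R / (2 * n)%:R
       + (Posz a * (Posz a - n%:Z))%:~R / (2 * n)%:R * tau')))).
      by apply: qexp_quad; apply: oner_neq0.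
    by apply/funext => z; rewrite mul1r mul0r add0r addrA.
  by move=> z; rewrite -big_split; apply: eq_bigr => a _; apply: theta_E.
have [s1 q1 h1] := H1 (- tau^-1); have [s2 [k [p [q [k0 hk]]]] h2] := H1 tau.
pose w z (a m : 'I_n) : C := z + m%:R / n%:R * tau - a%:R / n%:R.
pose quad z : C := z ^+ 2 / (2 * tau) - z / 2 + z / (2 * tau).
have H3 z : P (- tau^-1) (z / tau)
    = (\prod_(a < n) \prod_(m < n) (c * e2pi (quad (w z a m)))) * P tau z.
  have -> : P tau z = \prod_(a < n) \prod_(m < n) theta tau (w z a m).
    rewrite exchange_big; apply: eq_bigr => m _ /=; exact/esym/btheta_rev.
  rewrite -big_split; apply: eq_bigr => a _ /=; rewrite -big_split.
  apply: eq_bigr => m _ /=; rewrite -hc; congr theta.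
  by rewrite /w; field; rewrite tn nn.
pose s3 z := (\prod_(a < n) \prod_(m < n) (c * e2pi (quad (w z a m)))) : C.
have q3 : qexp s3.
  apply: qexp_prod => a; apply: qexp_prod => m.
  pose d : C := m%:R / n%:R * tau - a%:R / n%:R.
  rewrite (_ : (fun z => _) = (fun z => c * e2pi ((2 * tau)^-1 * z ^+ 2
     + (d / tau - 2^-1 + (2 * tau)^-1) * z + quad d))).
    exact: qexp_quad.
  by apply/funext => z; congr (_ * e2pi _); rewrite /quad /w /d; field; rewrite tn nn.
exists (fun z => s1 (z / tau) * (s3 z * (k^-1 * e2pi (- p * z ^+ 2 + - q * z)))).
  apply: qexpM.
    have [k1 [p1 [r1 [k10 hk1]]]] := q1.
    exists k1, (p1 / tau ^+ 2), (r1 / tau); split => // z; rewrite hk1.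
    by congr (_ * e2pi _); field.
  by apply: qexpM => //; exists k^-1, (- p), (- q); rewrite invr_eq0.
move=> z; rewrite h1 H3 -/(s3 z) h2 hk.
have ek : k^-1 * e2pi (- p * z ^+ 2 + - q * z) * (k * e2pi (p * z ^+ 2 + q * z)) = 1.
  rewrite mulrACA mulVf // mul1r -e2piD.
  have -> : - p * z ^+ 2 + - q * z + (p * z ^+ 2 + q * z) = 0 by ring.
  by rewrite e2pi0.
have -> : s1 (z / tau) * (s3 z * P tau z) =
  s1 (z / tau) * (s3 z * P tau z) * 1 by rewrite mulr1.
by rewrite -ek; ring.
Qed.

End ThetaKernel.

(** * Isomorphisms of quadratic algebras *)

Section GradedIso.
Variable K : fieldType.
Implicit Types A B : gradedAlg K.

Lemma graded_iso_refl A : graded_iso A A.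
Proof. by exists idfun; split=> [|//]; exists idfun. Qed.

Lemma graded_iso_trans A B D :
  graded_iso A B -> graded_iso B D -> graded_iso A D.
Proof.
move=> [f [bf df]] [g [bg dg]]; exists (g \o f : {lrmorphism A -> D}).
split; first exact: bij_comp.
by move=> d x; split=> [/df/dg//|/dg/df].
Qed.

Lemma graded_iso_sym A B : graded_iso A B -> graded_iso B A.
Proof.
move=> [f [[g fK gK] df]].
pose gA := GRing.isZmodMorphism.Build B A g (can2_zmod_morphism fK gK).
pose gM := GRing.isMonoidMorphism.Build B A g (can2_monoid_morphism fK gK).
pose gS := GRing.isScalable.Build K B A *:%R g (can2_scalable fK gK).
pose h : {lrmorphism B -> A} := HB.pack g gA gM gS.
exists h; split; first by exists f.
by move=> d x; rewrite (df d (g x)) gK.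
Qed.

End GradedIso.

Section QuotientMorphism.
Variables (K : fieldType) (A B : algType K).
Variables (I : twoSidedIdeal A) (J : twoSidedIdeal B) (f : {lrmorphism A -> B}).
Hypothesis fI : forall a, a \in (I : pred A) -> f a \in (J : pred B).

Definition quot_map (x : quot_alg I) : quot_alg J := quot_pi J (f (quot_repr x)).

Lemma quot_map_pi a : quot_map (quot_pi I a) = quot_pi J (f a).
Proof. by apply/quot_piP; rewrite -raddfB; apply: fI; apply: quot_repr_pi. Qed.

Lemma quot_map_zmod : zmod_morphism quot_map.
Proof.
move=> x y; rewrite -[x]quot_reprK -[y]quot_reprK.
by rewrite -(raddfB (quot_pi I)) !quot_map_pi (raddfB f) (raddfB (quot_pi J)).
Qed.

Lemma quot_map_monoid : monoid_morphism quot_map.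
Proof.
split=> [|x y].
  by rewrite -(rmorph1 (quot_pi I)) quot_map_pi (rmorph1 f) (rmorph1 (quot_pi J)).
rewrite -[x]quot_reprK -[y]quot_reprK.
by rewrite -(rmorphM (quot_pi I)) !quot_map_pi (rmorphM f) (rmorphM (quot_pi J)).
Qed.

Lemma quot_map_scalable : scalable quot_map.
Proof.
move=> c x; rewrite -[x]quot_reprK.
by rewrite -(linearZ_LR (quot_pi I)) !quot_map_pi (linearZ_LR f) (linearZ_LR (quot_pi J)).
Qed.

End QuotientMorphism.

Section QuotientIso.
Variables (K : fieldType) (A B : algType K).
Variables (I : twoSidedIdeal A) (J : twoSidedIdeal B).
Variables (f : {lrmorphism A -> B}) (g : {lrmorphism B -> A}).
Hypotheses (fI : forall a, a \in (I : pred A) -> f a \in (J : pred B))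
           (gJ : forall b, b \in (J : pred B) -> g b \in (I : pred A)).
Hypotheses (fK : cancel f g) (gK : cancel g f).
Variables (dA : nat -> set A) (dB : nat -> set B).
Hypotheses (fd : forall d a, dA d a -> dB d (f a))
           (gd : forall d b, dB d b -> dA d (g b)).

Lemma quot_iso : exists h : {lrmorphism quot_alg I -> quot_alg J},
  bijective h /\ forall d x, (quot_pi I @` dA d) x <-> (quot_pi J @` dB d) (h x).
Proof.
pose h : {lrmorphism quot_alg I -> quot_alg J} :=
  HB.pack (quot_map J f) (GRing.isZmodMorphism.Build _ _ _ (quot_map_zmod fI))
    (GRing.isMonoidMorphism.Build _ _ _ (quot_map_monoid fI))
    (GRing.isScalable.Build K _ _ *:%R _ (quot_map_scalable fI)).
have hE a : h (quot_pi I a) = quot_pi J (f a) by exact: (quot_map_pi fI).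
exists h; split.
  exists (quot_map I g) => x; rewrite -[x]quot_reprK.
    by rewrite hE (quot_map_pi gJ) fK.
  by rewrite (quot_map_pi gJ) hE gK.
move=> d x; split=> [[a ad <-]|[b bd bx]].
  by exists (f a); [exact: fd | rewrite hE].
exists (g b); first exact: gd.
by rewrite -(quot_map_pi gJ) bx -[x]quot_reprK hE (quot_map_pi gJ) fK.
Qed.

End QuotientIso.

Section TensorLift.
Variables (K : fieldType) (J : finType) (A : algType K) (v : J -> A).

Definition word_eval (w : fmonom J) : A := \prod_(i <- (w : seq J)) v i.

Lemma word_evalM : mmorphism word_eval.
Proof.
split=> [x y|]; first by rewrite /word_eval fmM big_cat.
by rewrite /word_eval fm1 big_nil.
Qed.
HB.instance Definition _ := isMultiplicative.Build (fmonom J) A word_eval word_evalM.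

Definition tensor_lift (u : tensor_alg K J) : A := mmap (in_alg A) word_eval u.

Lemma tensor_lift_zmod : zmod_morphism tensor_lift.
Proof. exact: (raddfB (mmap (in_alg A) word_eval)). Qed.
HB.instance Definition _ :=
  GRing.isZmodMorphism.Build (tensor_alg K J) A tensor_lift tensor_lift_zmod.

Lemma tensor_lift_monoid : monoid_morphism tensor_lift.
Proof.
have comm (g : tensor_alg K J) m m' :
    GRing.comm (in_alg A (mcoeff m g)) (word_eval m').
  by rewrite /GRing.comm /= mulr_algl mulr_algr.
by have [M U] := commr_mmap_is_multiplicative comm; split.
Qed.
HB.instance Definition _ :=
  GRing.isMonoidMorphism.Build (tensor_alg K J) A tensor_lift tensor_lift_monoid.

Lemma tensor_lift_scalable : scalable tensor_lift.
Proof. by move=> c u; rewrite /tensor_lift [LHS]mmapZ mulr_algl. Qed.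
HB.instance Definition _ :=
  GRing.isScalable.Build K (tensor_alg K J) A *:%R tensor_lift tensor_lift_scalable.

Lemma tensor_lift_gen j : tensor_lift (tensor_gen K j) = v j.
Proof.
by rewrite /tensor_lift /tensor_gen mmapU /= scale1r mul1r /word_eval fmU big_seq1.
Qed.

End TensorLift.

Section TensorLinear.
Variables (K : fieldType) (J : finType).

Lemma tensorE (u : tensor_alg K J) :
  u = \sum_(w <- msupp u) mcoeff w u *: \prod_(i <- (w : seq J)) tensor_gen K i.
Proof.
have wE (w : fmonom J) : (mkmalgU w 1 : tensor_alg K J)
    = \prod_(i <- (w : seq J)) tensor_gen K i.
  case: w => s; elim: s => [|j s IH]; first by rewrite big_nil -fmoneE.
  rewrite big_cons -IH /tensor_gen [RHS]malgME.
  rewrite !(msuppU, oner_eq0) /= !big_seq_fset1 !mcoeffUU mulr1; congr mkmalgU.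
  by apply/eqP; rewrite fmP fmM fmU.
rewrite {1}[u]monalgE; apply: eq_bigr => w _; rewrite -wE.
by apply/malgP => x; rewrite mcoeffZ !mcoeffU mulr_natr.
Qed.

Lemma tensor_lift_unique (A : algType K) (f g : {lrmorphism tensor_alg K J -> A}) :
  (forall j, f (tensor_gen K j) = g (tensor_gen K j)) -> f =1 g.
Proof.
move=> fg u; rewrite [u]tensorE !linear_sum; apply: eq_bigr => w _.
by rewrite !linearZ_LR !rmorph_prod; congr (_ *: _); apply: eq_bigr => i _; apply: fg.
Qed.

End TensorLinear.

(** The coordinates of the image of t under W (x) W. *)
Lemma congruence_sum (K : fieldType) (N : nat) (V : lmodType K)
    (e : 'I_N -> 'I_N -> V) (W t : 'M[K]_N) :
  \sum_i \sum_j t i j *: (\sum_a \sum_b (W i a * W j b) *: e a b)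
  = \sum_a \sum_b (W^T *m t *m W) a b *: e a b.
Proof.
transitivity (\sum_i \sum_j \sum_a \sum_b (W i a * t i j * W j b) *: e a b).
  apply: eq_bigr => i _; apply: eq_bigr => j _; rewrite scaler_sumr.
  apply: eq_bigr => a _; rewrite scaler_sumr; apply: eq_bigr => b _.
  by rewrite scalerA mulrCA mulrA.
under eq_bigr => i _ do rewrite exchange_big /=.
rewrite exchange_big; apply: eq_bigr => a _ /=.
under eq_bigr => i _ do rewrite exchange_big /=.
rewrite exchange_big; apply: eq_bigr => b _ /=.
rewrite mxE scaler_suml exchange_big; apply: eq_bigr => j _ /=.
by rewrite mxE mulr_suml scaler_suml; apply: eq_bigr => i _; rewrite mxE.
Qed.

Section LinearSubstitution.
Variables (K : fieldType) (N : nat).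
Local Notation T := (tensor_alg K 'I_N).
Implicit Types W t : 'M[K]_N.

Definition subst_gen W (i : 'I_N) : T := \sum_j W i j *: tensor_gen K j.

Definition tensor_subst W (u : T) : T := tensor_lift (subst_gen W) u.
HB.instance Definition _ W := GRing.isZmodMorphism.Build T T (tensor_subst W)
  (tensor_lift_zmod (subst_gen W)).
HB.instance Definition _ W := GRing.isMonoidMorphism.Build T T (tensor_subst W)
  (tensor_lift_monoid (subst_gen W)).
HB.instance Definition _ W := GRing.isScalable.Build K T T *:%R (tensor_subst W)
  (tensor_lift_scalable (subst_gen W)).

Lemma tensor_subst_gen W i :
  tensor_subst W (tensor_gen K i) = \sum_j W i j *: tensor_gen K j.
Proof. exact: tensor_lift_gen. Qed.

Lemma tensor_substM W W' u :
  tensor_subst W' (tensor_subst W u) = tensor_subst (W *m W') u.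
Proof.
pose f : {lrmorphism T -> T} := tensor_subst W' \o tensor_subst W.
apply: (tensor_lift_unique (f := f) (g := tensor_subst (W *m W'))) => i.
rewrite /f /= !tensor_subst_gen linear_sum /=.
under eq_bigr => j _ do rewrite linearZ_LR /= tensor_subst_gen scaler_sumr.
rewrite exchange_big; apply: eq_bigr => k _ /=; rewrite mxE scaler_suml.
by apply: eq_bigr => j _; rewrite scalerA.
Qed.

Lemma tensor_subst1 u : tensor_subst 1%:M u = u.
Proof.
apply: (tensor_lift_unique (f := tensor_subst 1%:M) (g := idfun)) => i /=.
rewrite tensor_subst_gen (bigD1 i) //= mxE eqxx scale1r big1 ?addr0 // => j ji.
by rewrite mxE eq_sym (negbTE ji) scale0r.
Qed.

Lemma tensor_gen_deg i : tensor_deg 1 (tensor_gen K i : T).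
Proof. by have := @tensor_degU K N (fmu i) 1; rewrite fmU. Qed.

Lemma tensor_degZ d c (u : T) : tensor_deg d u -> tensor_deg d (c *: u).
Proof.
by move=> ud; rewrite -[_ *: _]addr0; apply: tensor_degZD => //; apply: tensor_deg0.
Qed.

Lemma tensor_subst_deg W d u : tensor_deg d u -> tensor_deg d (tensor_subst W u).
Proof.
move=> ud; rewrite [u]tensorE linear_sum big_seq; apply: tensor_deg_sum => w w_in.
rewrite linearZ_LR rmorph_prod; apply: tensor_degZ.
have <- : size w = d by apply: ud; rewrite mcoeff_neq0.
elim: {w_in} (w : seq _) => [|i s IH]; first by rewrite big_nil; apply: tensor_deg1.
rewrite big_cons; apply: (@tensor_degM _ _ 1) => //.
rewrite [X in tensor_deg _ X](tensor_subst_gen W i); apply: tensor_deg_sum => j _.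
by apply: tensor_degZ; apply: tensor_gen_deg.
Qed.

Lemma tensor_subst2 W t : tensor_subst W (tensor2 t) = tensor2 (W^T *m t *m W).
Proof.
rewrite [RHS]/tensor2 -congruence_sum /tensor2 linear_sum.
apply: eq_bigr => i _; rewrite linear_sum; apply: eq_bigr => j _.
rewrite (linearZ_LR (tensor_subst W)) (rmorphM (tensor_subst W)) /=.
rewrite !tensor_subst_gen mulr_suml; congr (_ *: _); apply: eq_bigr => a _.
by rewrite mulr_sumr; apply: eq_bigr => b _; rewrite -scalerAl -scalerAr scalerA.
Qed.

Lemma tensor_subst_ideal W (E E' : 'M[K]_(N * N)) :
  (forall t, exists t', W^T *m vec_mx (mxvec t *m E') *m W = vec_mx (mxvec t' *m E)) ->
  forall u, u \in quad_ideal E' -> tensor_subst W u \in quad_ideal E.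
Proof.
move=> H u /asboolP[s [sS ->]]; apply/asboolP.
exists [seq ((tensor_subst W x.1.1, tensor_subst W x.1.2), tensor_subst W x.2) | x <- s].
split.
  move=> x /mapP[y /sS [t _ ty] ->] /=; rewrite -ty.
  have [t' e] := H t; exists t' => //.
  by rewrite tensor_subst2 e.
rewrite big_map linear_sum; apply: eq_bigr => x _ /=.
by rewrite !rmorphM.
Qed.

(** The substitution x_i |-> sum_j W i j x_j is an automorphism of the tensor
    algebra; it maps the relations of E' onto those of E. *)
Lemma quad_alg_iso W (E E' : 'M[K]_(N * N)) : W \in unitmx ->
  (forall t, exists t', W^T *m vec_mx (mxvec t *m E') *m W = vec_mx (mxvec t' *m E)) ->
  (forall t, exists t', W^T *m vec_mx (mxvec t' *m E') *m W = vec_mx (mxvec t *m E)) ->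
  graded_iso (quad_alg E') (quad_alg E).
Proof.
move=> Wu H1 H2.
have H2' t : exists t', (invmx W)^T *m vec_mx (mxvec t *m E) *m invmx W
    = vec_mx (mxvec t' *m E').
  have [t' <-] := H2 t; exists t'.
  rewrite !mulmxA -trmx_mul mulmxV // trmx1 mul1mx.
  by rewrite -!mulmxA mulmxV // mulmx1.
have WK u : tensor_subst (invmx W) (tensor_subst W u) = u.
  by rewrite tensor_substM mulmxV // tensor_subst1.
have WVK u : tensor_subst W (tensor_subst (invmx W) u) = u.
  by rewrite tensor_substM mulVmx // tensor_subst1.
exact: (quot_iso (tensor_subst_ideal H1) (tensor_subst_ideal H2') WK WVK
  (@tensor_subst_deg W) (@tensor_subst_deg (invmx W))).
Qed.

End LinearSubstitution.

(** * Entire extensions *)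

Section EntireExtension.
Variable R : realType.
Local Notation C := R[i].

(** The remainder of the expansion, divided by w, is O(|w|). *)
Lemma tame_entire (h : C -> C) : tame h -> entire (h : C -> C).
Proof.
move=> [dh th] z; have [K K0 HK] := th (1 + abs z).
apply/cvg_ex; exists (dh z); apply/cvgrPdist_le => /= e e0.
have eE : e = (abs e)%:C by rewrite absE gtr0_norm.
have ae : 0 < abs e by rewrite -ltcR -eE.
pose d : R := Num.min 1 (abs e / (K + 1)).
have d0 : 0 < d by rewrite lt_min ltr01 divr_gt0 // ltr_pwDr.
near=> w.
have w0 : w != 0 by near: w; apply: nbhs_dnbhs_neq.
have wd : abs w < d.
  rewrite -ltcR absE -[w]subr0 distrC; near: w.
  by apply: nbhs_dnbhs; apply: (@nbhsx_ballx _ _ (0 : C)); rewrite ltcR.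
have [w1 w2] : abs w <= 1 /\ abs w <= abs e / (K + 1).
  by move: wd; rewrite lt_min => /andP[/ltW ? /ltW ?].
have [||_ _ H] := HK z w; rewrite ?lerDr //.
  by rewrite (le_trans w1) // lerDl abs_ge0.
rewrite [w *: 1]mulr1 [w + z]addrC -absE eE lecR.
have -> : dh z - w^-1 *: (h (z + w) - h z) = - (w^-1 * (h (z + w) - h z - w * dh z)).
  rewrite -[_ *: _]/(_ * _); field; exact: w0.
rewrite absN absM absV; have aw : 0 < abs w by rewrite abs_gt0.
rewrite mulrC ler_pdivrMr //; apply: le_trans H _; rewrite expr2 mulrA ler_pM2r //.
move: w2; rewrite ler_pdivlMr ?ltr_pwDr // => w2.
by apply: le_trans w2; rewrite mulrC ler_pM2l // lerDl.
Unshelve. all: by end_near.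
Qed.

Lemma entire_cst (V : normedModType C) (a : V) : entire (fun=> a).
Proof. by move=> z; apply/derivable1_diffP; apply: differentiable_cst. Qed.

Lemma entireM (s f : C -> C) : entire s -> entire f -> entire (fun z => s z * f z).
Proof.
move=> es ef z; apply/derivable1_diffP.
by apply: (differentiableM (f := s) (g := f)); apply/derivable1_diffP.
Qed.

Lemma entire_sum (V : normedModType C) n (F : 'I_n -> C -> V) :
  (forall i, entire (F i)) -> entire (fun z => \sum_i F i z).
Proof.
move=> eF z; apply/derivable1_diffP.
have -> : (fun z => \sum_i F i z) = \sum_i F i by apply/funext => w; rewrite fct_sumE.
by apply: differentiable_sum => i; apply/derivable1_diffP; apply: eF.
Qed.

Lemma entire_mx m n (f : C -> 'M[C]_(m, n)) :
  (forall i j, entire (fun z => f z i j)) <-> entire f.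
Proof.
split=> [ef|ef i j z]; last first.
  apply/derivable1_diffP; apply: (differentiable_comp (f := f) (g := fun M => M i j)).
    exact/derivable1_diffP.
  exact: differentiable_coord.
have -> : f = (fun z => \sum_i \sum_j f z i j *: delta_mx i j).
  by apply/funext => z; apply: matrix_sum_delta.
apply: entire_sum => i; apply: entire_sum => j z; apply/derivable1_diffP.
by apply: differentiableZl; apply/derivable1_diffP/ef.
Qed.

Lemma entire_conj m n p q (s : C -> C) (f : C -> 'M[C]_(m, n))
    (A : 'M[C]_(p, m)) (B : 'M[C]_(n, q)) :
  entire s -> entire f -> entire (fun z => s z *: (A *m f z *m B)).
Proof.
move=> es /entire_mx ef; apply/entire_mx => i j.
rewrite (_ : (fun z => _) =
    fun z => s z * \sum_l (\sum_k A i k * f z k l) * B l j); last first.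
  by apply/funext => z; rewrite !mxE; under eq_bigr do rewrite mxE.
apply: (entireM es).
apply: (entire_sum (F := fun l z => (\sum_k A i k * f z k l) * B l j)) => l.
apply: (entireM (s := fun z => \sum_k A i k * f z k l)); last exact: entire_cst.
apply: (entire_sum (F := fun k z => A i k * f z k l)) => k.
by apply: (entireM (s := fun=> A i k) (f := fun z => f z k l)); [exact: entire_cst|exact: ef].
Qed.

Lemma entire_scale (V : normedModType C) (f : C -> V) (a : C) :
  entire f -> entire (fun z => f (a * z)).
Proof.
move=> ef z; apply/derivable1_diffP.
have ea : entire (fun z : C => a * z).
  by apply: tame_entire; apply: (tameM (f := fun=> a) (g := id)); [apply: tame_cst|apply: tame_id].
apply: (differentiable_comp (f := fun z : C => a * z) (g := f)).
  exact/derivable1_diffP/ea.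
exact/derivable1_diffP.
Qed.

Lemma qexp_entire (s : C -> C) : qexp s -> entire s.
Proof.
move=> [k [a [b [_ sE]]]]; rewrite (_ : s = fun z => k * e2pi (a * (z * z) + b * z)).
  apply/tame_entire/tameM; first exact: tame_cst.
  apply: (tame_comp (@tame_e2pi R) (g := fun z => a * (z * z) + b * z)); apply: tameD; apply: tameM.
  - exact: tame_cst.
  - by apply: tameM; apply: tame_id.
  - exact: tame_cst.
  - exact: tame_id.
by apply/funext.
Qed.

Lemma qexp_neq0 (s : C -> C) z : qexp s -> s z != 0.
Proof. by move=> [k [a [b [k0 ->]]]]; rewrite mulf_neq0 ?e2pi_neq0. Qed.

(** Continuous functions that agree off such a set D are equal. *)
Definition codense (D : set C) := forall z : C, exists2 t : nat -> C,
  t @ \oo --> (z : C) & forall m, ~ D (t m).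

Lemma entire_eq_off (V : normedModType C) D (f g : C -> V) : codense D ->
  entire f -> entire g -> (forall z, ~ D z -> f z = g z) -> f = g.
Proof.
move=> cD ef eg fg; apply/funext => z; have [t tz tD] := cD z.
have ft : (fun m => f (t m)) @ \oo --> f z.
  by apply: continuous_cvg => //; apply/differentiable_continuous/derivable1_diffP.
have gt : (fun m => g (t m)) @ \oo --> g z.
  by apply: continuous_cvg => //; apply/differentiable_continuous/derivable1_diffP.
have fgt : (fun m => f (t m)) = (fun m => g (t m)).
  by apply/funext => m; apply: fg.
rewrite fgt in ft; exact: (cvg_unique (@norm_hausdorff _ V) ft gt).
Qed.

Lemma entire_extE (V : normedModType C) D (f g : C -> V) : codense D ->
  entire g -> (forall z, ~ D z -> g z = f z) -> entire_ext D f = g.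
Proof.
move=> cD eg gf; apply: xget_unique => [//|h [eh hf]].
by apply: (entire_eq_off cD) => // z zD; rewrite hf ?gf.
Qed.

(** The relation between f and f' passes to their extensions. If f extends to g then
    f' extends to the transform of g, and conversely since the transformation is
    invertible; if neither extends, both sides are 0. *)
Lemma entire_ext_conj m n (D D' : set C) (f f' : C -> 'M[C]_(m, n)) (w : C)
    (s : C -> C) (A A' : 'M[C]_m) (B B' : 'M[C]_n) :
  codense D -> codense D' -> w != 0 -> (forall z : C, D' (z / w) <-> D z) ->
  qexp s -> A' *m A = 1%:M -> B *m B' = 1%:M ->
  (forall z : C, ~ D z -> f' (z / w) = s z *: (A *m f z *m B)) ->
  forall z : C, entire_ext D' f' (z / w) = s z *: (A *m entire_ext D f z *m B).
Proof.
move=> cD cD' w0 DD' qs AA BB ff z.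
have si : entire (fun z => (s z)^-1).
  have [k [a [b [k0 sE]]]] := qs; apply: qexp_entire.
  exists k^-1, (- a), (- b); split=> [|u]; first by rewrite invr_eq0.
  by rewrite sE invfM -e2piN; congr (_ * e2pi _); ring.
have sn := qexp_neq0 _ qs; have es := qexp_entire qs.
have [[g [eg gf]]|nog] := pselect (exists g, entire g /\ forall z, ~ D z -> g z = f z).
  rewrite (entire_extE cD eg gf).
  have eg' := entire_scale (a := w) (entire_conj (A := A) (B := B) es eg).
  rewrite (entire_extE cD' eg') ?[w * _]mulrC ?divfK // => u uD'.
  rewrite gf -?ff ?[w * u]mulrC ?mulfK // -DD' ?mulfK //.
have e0 : entire_ext D f = fun=> 0.
  by apply: xgetPN => g [eg gf]; apply: nog; exists g.
have e0' : entire_ext D' f' = fun=> 0.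
  apply: xgetPN => g [eg gf]; apply: nog.
  exists (fun z => (s z)^-1 *: (A' *m g (w^-1 * z) *m B')); split.
    apply: (entire_conj (s := fun z => (s z)^-1) (f := fun z => g (w^-1 * z)) si).
    exact: entire_scale.
  move=> u uD; rewrite mulrC gf ?DD' // ff // -!(scalemxAl, scalemxAr) scalerA.
  by rewrite mulVf ?sn // scale1r !mulmxA AA mul1mx -mulmxA BB mulmx1.
by rewrite e0 e0' mulmx0 mul0mx scaler0.
Qed.

(** A point of the lattice is the limit of its translates by 1 / (n (m + 2)), which
    lie strictly between two points of the lattice on a real line. *)
Lemma codense_frac_lattice n (tau : C) : (0 < n)%N -> 0 < complex.Im tau ->
  codense (frac_lattice n tau).
Proof.
move=> n0 t0 z.
have nn : n%:R != 0 :> C by rewrite pnatr_eq0 -lt0n.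
have [[a [b zE]]|zD] := pselect (frac_lattice n tau z); last first.
  by exists (fun=> z) => //; apply: cvg_cst.
exists (fun m => z + (n%:R * m.+2%:R)^-1).
  apply: (cvgC_bound (K := 1)) => m; rewrite [z + _]addrC addrK absV absM !abs_nat.
  rewrite invfM div1r -[leRHS]mul1r; apply: ler_pM; rewrite ?invr_ge0 ?ler0n //.
    by rewrite invf_le1 ?ler1n ?ltr0n.
  by rewrite lef_pV2 ?posrE ?ltr0n // ler_nat.
move=> m [a' [b' e]].
have e1 : m.+2%:R^-1 = (a' - a)%:~R + (b' - b)%:~R * tau.
  have -> : m.+2%:R^-1 = ((z + (n%:R * m.+2%:R)^-1) - z) * n%:R :> C.
    by rewrite [z + _]addrC addrK invfM mulrAC mulVf // mul1r.
  by rewrite e zE -mulrBl divfK // !rmorphB /=; ring.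
have eI : (b' - b)%:~R * complex.Im tau = 0.
  have <- := @Im_lattice R (a' - a) (b' - b) tau.
  by rewrite -e1 -(rmorph_nat (real_complex R)) -fmorphV.
have bb : b' - b = 0.
  by apply/eqP; move/eqP: eI; rewrite mulf_eq0 (gt_eqF t0) orbF intr_eq0.
move/eqP: e1; rewrite bb mul0r addr0 => /eqP e1.
have : (1 : C) = ((a' - a) * m.+2%:Z)%:~R.
  by rewrite rmorphM /= -e1 mulVf // pnatr_eq0.
rewrite -[1](rmorph1 (intmul 1)) => /intr_inj /esym.
by move=> /(congr1 absz)/eqP; rewrite abszM muln_eq1 => /andP[_].
Qed.

End EntireExtension.

(** * Change of basis in V (x) V *)

Section BasisMaps.
Variables (K : fieldType) (N : nat).
Implicit Types (W t : 'M[K]_N) (B : 'I_N -> 'I_N -> 'M[K]_N).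

(** The endomorphism of V (x) V that maps x_i (x) x_j to B i j. *)
Definition basis_map B t : 'M[K]_N := \sum_i \sum_j t i j *: B i j.

Lemma basis_map_linear B : linear (basis_map B).
Proof.
move=> c t u; rewrite /basis_map scaler_sumr -big_split; apply: eq_bigr => i _ /=.
rewrite scaler_sumr -big_split; apply: eq_bigr => j _ /=.
by rewrite !mxE scalerDl scalerA.
Qed.
HB.instance Definition _ B :=
  GRing.isLinear.Build K 'M[K]_N 'M[K]_N *:%R (basis_map B) (basis_map_linear B).

Definition conj_map W t : 'M[K]_N := W^T *m t *m W.

Lemma conj_map_linear W : linear (conj_map W).
Proof. by move=> c t u; rewrite /conj_map mulmxDr mulmxDl -scalemxAr -scalemxAl. Qed.
HB.instance Definition _ W :=
  GRing.isLinear.Build K 'M[K]_N 'M[K]_N *:%R (conj_map W) (conj_map_linear W).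

(** The operator W (x) W on V (x) V. *)
Definition tensor_square W : 'M[K]_(N * N) := lin_mx (conj_map W).

Lemma tensor_squareM W W' :
  tensor_square W *m tensor_square W' = tensor_square (W *m W').
Proof.
apply/row_matrixP => i; rewrite !rowE mulmxA -[delta_mx _ _]vec_mxK !mul_vec_lin /=.
by congr mxvec; rewrite /conj_map trmx_mul !mulmxA.
Qed.

Lemma tensor_square1 : tensor_square 1%:M = 1%:M.
Proof.
apply/row_matrixP => i; rewrite !rowE -[delta_mx _ _]vec_mxK !mul_vec_lin /=.
by rewrite /conj_map trmx1 mul1mx !mulmx1.
Qed.

Lemma basis_map_conj W W' B B' (c : K) : W *m W' = 1%:M ->
  (forall i j, W^T *m B' i j *m W
     = c *: \sum_a \sum_b (W i a * W j b) *: B a b) ->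
  lin_mx (basis_map B')
    = c *: (tensor_square W *m lin_mx (basis_map B) *m tensor_square W').
Proof.
move=> WW' H; rewrite scalemxAl.
have <- : lin_mx (basis_map B') *m tensor_square W
    = c *: (tensor_square W *m lin_mx (basis_map B)).
  apply/row_matrixP => i; rewrite !rowE -scalemxAr !mulmxA.
  rewrite -[delta_mx _ _]vec_mxK !mul_vec_lin /= -linearZ; congr mxvec.
  set t := vec_mx _; rewrite /conj_map /basis_map -congruence_sum scaler_sumr.
  rewrite mulmx_sumr mulmx_suml; apply: eq_bigr => a _.
  rewrite scaler_sumr mulmx_sumr mulmx_suml; apply: eq_bigr => b _.
  by rewrite -scalemxAr -scalemxAl H !scalerA mulrC.
by rewrite -mulmxA tensor_squareM WW' tensor_square1 mulmx1.
Qed.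

(** A non-zero scalar and a conjugation by W (x) W do not change the image of an
    operator, up to the change of basis W of V. *)
Lemma quad_alg_iso_conj W W' (E E' : 'M[K]_(N * N)) (c : K) :
  W *m W' = 1%:M -> c != 0 ->
  E' = c *: (tensor_square W *m E *m tensor_square W') ->
  graded_iso (quad_alg E') (quad_alg E).
Proof.
move=> WW' c0 EE'.
have E'W : E' *m tensor_square W = c *: (tensor_square W *m E).
  by rewrite EE' -scalemxAl -mulmxA tensor_squareM (mulmx1C WW') tensor_square1 mulmx1.
have key t : W^T *m vec_mx (mxvec t *m E') *m W
    = vec_mx (mxvec (c *: conj_map W t) *m E).
  apply: (can_inj mxvecK); rewrite vec_mxK -[LHS](mul_vec_lin (conj_map W)) vec_mxK.
  by rewrite -mulmxA E'W -scalemxAr mulmxA mul_vec_lin linearZ -scalemxAl.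
apply: (@quad_alg_iso K N W) => [|t|t]; first by case/mulmx1_unit: WW'.
  by exists (c *: conj_map W t).
exists (c^-1 *: conj_map W' t); rewrite key; congr (vec_mx (mxvec _ *m E)).
rewrite linearZ scalerA mulfV // scale1r.
rewrite -[LHS]/(W^T *m (W'^T *m t *m W') *m W).
rewrite !mulmxA -trmx_mul (mulmx1C WW') trmx1 mul1mx.
by rewrite -mulmxA (mulmx1C WW') mulmx1.
Qed.

End BasisMaps.

(** * Characters and quadratic phases on Z/n *)

Section Character.
Variables (R : realType) (p : nat).
Local Notation C := R[i].
Local Notation n := p.+2.
Implicit Types u v : 'Z_n.

Lemma Zp_intE u : u = (Posz u)%:~R.
Proof. exact/esym/natr_Zp. Qed.

Lemma Zp_int_modE (a : int) : (Posz (a%:~R : 'Z_n) = a %[mod n%:Z])%Z.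
Proof.
have nat_case (m : nat) : (Posz (m%:R : 'Z_n) = m %[mod n%:Z])%Z.
  by rewrite val_Zp_nat // -modz_nat modz_mod.
have [m aE] : exists m : nat, Posz m = a + n%:Z * `|a|%N.
  exists `|(a + n%:Z * `|a|%N)%R|%N; rewrite gez0_abs //; lia.
have <- : ((Posz m)%:~R : 'Z_n) = a%:~R.
  have n0 : (n%:Z)%:~R = 0 :> 'Z_n by apply: pchar_Zp.
  by rewrite aE rmorphD rmorphM /= n0 mul0r addr0.
by rewrite nat_case aE addrC mulrC modzMDl.
Qed.

Definition chi u : C := e2pi (- ((Posz u)%:~R / n%:R)).

Let nn : n%:R != 0 :> C. Proof. by rewrite pnatr_eq0. Qed.

Lemma chi_int (a : int) : chi a%:~R = e2pi (- (a%:~R / n%:R)).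
Proof.
have /eqP := Zp_int_modE a; rewrite eqz_mod_dvd => /dvdzP[q qE].
rewrite /chi -[in LHS](subrK a (Posz _)) qE.
rewrite -(e2piDint (- (a%:~R / n%:R)) (- q)); congr e2pi.
by rewrite rmorphD rmorphM rmorphN /=; field.
Qed.

Lemma chiD u v : chi (u + v) = chi u * chi v.
Proof.
rewrite [in LHS](Zp_intE u) [in LHS](Zp_intE v) -rmorphD chi_int rmorphD /=.
by rewrite mulrDl opprD e2piD.
Qed.

Lemma sum_chi u : \sum_(r : 'Z_n) chi (u * r) = if u == 0 then n%:R else 0.
Proof.
transitivity (\sum_(l < n) e2pi ((- Posz u)%:~R * l%:R / n%:R : C)).
  apply: eq_bigr => r _; rewrite [in LHS](Zp_intE u) [in LHS](Zp_intE r) -rmorphM chi_int.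
  by rewrite rmorphM rmorphN /= !mulNr.
rewrite sum_e2pi_ord // dvdzE abszN /=; congr (if _ then _ else _).
apply/idP/eqP => [|->//]; case: u => [[|u] lu] /=; first by move=> _; apply/val_inj.
by move/(dvdn_leq (ltn0Sn u)); rewrite leqNgt lu.
Qed.

(** theta_a acquires this factor for k = 1 under tau |-> tau + 1; it depends only on a
    modulo n because the product of two consecutive integers is even. *)
Definition quad_phase (k : nat) (a : int) : C :=
  e2pi (k%:R * (a * (a - n%:Z))%:~R / (2 * n)%:R).

Lemma quad_phase_mod k (a b : int) : (a = b %[mod n%:Z])%Z ->
  quad_phase k a = quad_phase k b.
Proof.
move=> /eqP; rewrite eqz_mod_dvd => /dvdzP[q qE].
have -> : a = b + q * n%:Z by rewrite -qE; ring.
have [h hE] : exists h : int, q * (q - 1) = h * 2.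
  have [r [->|->]] : exists r : int, q = 2 * r \/ q = 2 * r + 1.
    by exists (q %/ 2)%Z; lia.
    by exists (r * (2 * r - 1)); ring.
  by exists ((2 * r + 1) * r); ring.
rewrite /quad_phase -[RHS](e2piDint _ (k%:Z * (q * b + h * n%:Z))); congr e2pi.
have hC : (q%:~R : C) * (q%:~R - 1) = h%:~R * 2%:R.
  by have := congr1 (fun x : int => x%:~R : C) hE; rewrite !rmorphM rmorphB.
rewrite !(rmorphM, rmorphD, rmorphN, rmorphB) /= natrM.
have -> : h%:~R = (q%:~R : C) * (q%:~R - 1) / 2%:R by rewrite hC mulfK.
by field.
Qed.
End Character.

(** * R under translation of tau *)

Lemma delta_congr (K : fieldType) (N : nat) (W : 'M[K]_N) (u v a b : 'I_N) :
  (W^T *m delta_mx u v *m W) a b = W u a * W v b.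
Proof.
rewrite -(mul_delta_mx (0 : 'I_1)) !mulmxA -mulmxA -colE -rowE !mxE big_ord1.
by rewrite !mxE.
Qed.

Lemma diag_congr (K : fieldType) (N : nat) (d : 'I_N -> K) (I : finType)
    (f : K) (c c' : I -> K) (u v : I -> 'I_N) (i j : 'I_N) (B : 'I_N -> 'I_N -> 'M[K]_N) :
  let W := diag_mx (\row_i d i) in
  (forall r, c' r * (d (u r) * d (v r)) = d i * d j * c r) ->
  B i j = f *: \sum_r c r *: delta_mx (u r) (v r) ->
  W^T *m (f *: \sum_r c' r *: delta_mx (u r) (v r)) *m W
    = 1 *: \sum_a \sum_b (W i a * W j b) *: B a b.
Proof.
move=> W H Bij.
have Wij (w x a b : 'I_N) : W w a * W x b
    = d w * d x * ((w == a)%:R * (x == b)%:R).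
  by rewrite !mxE -(mulr_natr (d w)) -(mulr_natr (d x)) mulrACA.
have -> : \sum_a \sum_b (W i a * W j b) *: B a b = (d i * d j) *: B i j.
  rewrite (bigD1 i) //= [X in _ + X]big1 ?addr0; last first.
    move=> a ai; rewrite big1 // => b _.
    by rewrite Wij eq_sym (negbTE ai) mul0r mulr0 scale0r.
  rewrite (bigD1 j) //= [X in _ + X]big1 ?addr0; last first.
    by move=> b bj; rewrite Wij (eq_sym j) (negbTE bj) !mulr0 scale0r.
  by rewrite Wij !eqxx !mulr1.
rewrite scale1r Bij -scalemxAr -scalemxAl scalerA mulrC -scalerA; congr (_ *: _).
rewrite mulmx_sumr mulmx_suml scaler_sumr; apply: eq_bigr => r _.
rewrite -scalemxAr -scalemxAl scalerA -H.
apply/matrixP => a b; rewrite mxE delta_congr Wij !mxE.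
by rewrite (eq_sym a) (eq_sym b) -mulnb natrM; ring.
Qed.

Section RMatrix.
Variables (R : realType) (p k : nat).
Local Notation C := R[i].
Local Notation n := p.+2.
Local Notation N := (Zp_trunc n).+2.
Implicit Types (z eta tau : C).

Local Opaque e2pi cexp.

Let nn : n%:R != 0 :> C. Proof. by rewrite pnatr_eq0. Qed.
Let n_gt0 : (0 < n)%N. Proof. by []. Qed.

Definition R_factor tau z : C :=
  (\prod_(al : 'Z_n) thetaZ tau al (- z))
    / (\prod_(al : 'Z_n | al != 0) thetaZ tau al 0).

Definition R_coef tau (a b : 'Z_n) z eta : C := kern n tau (Posz a) (Posz b) (- z) eta.

Lemma thetaZ_int tau (a : int) z : 0 < complex.Im tau ->
  thetaZ tau (a%:~R : 'Z_n) z = theta_ n tau a z.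
Proof. by move=> t0; apply: theta_modn => //; apply: Zp_int_modE. Qed.

Lemma Rmx_basisE tau z eta (i j : 'Z_n) : 0 < complex.Im tau ->
  Rmx_basis k z eta tau i j = R_factor tau z *:
    \sum_(r : 'Z_n) R_coef tau (j - i - r) (k%:R * r) z eta *: delta_mx (j - r) (i + r).
Proof.
move=> t0; congr (_ *: _); apply: eq_bigr => r _; congr (_ *: _).
have -> : j - i + r * (k%:R - 1)
    = (Posz (j - i - r)%R + Posz (k%:R * r)%R)%:~R.
  by rewrite intrD -!Zp_intE; ring.
by rewrite thetaZ_int.
Qed.

Local Notation chi := (@chi R p).

(** The phases of theta_{a+b}, theta_a and theta_b differ by the bilinear form of the
    quadratic phase. *)
Lemma R_coefD1 tau (a b : 'Z_n) z eta :
  R_coef (tau + 1) a b z eta = chi (- (a * b)) * R_coef tau a b z eta.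
Proof.
have -> : chi (- (a * b)) = e2pi ((Posz a * Posz b)%:~R / n%:R).
  rewrite [in LHS](Zp_intE a) [in LHS](Zp_intE b) -rmorphM -rmorphN chi_int rmorphN /=.
  by rewrite mulNr opprK.
rewrite /R_coef /kern !theta_tauD1_level.
set A := Posz a; set B := Posz b.
have -> : e2pi (((A + B) * (A + B - n%:Z))%:~R / (2 * n)%:R) =
   e2pi ((A * B)%:~R / n%:R) * (e2pi ((A * (A - n%:Z))%:~R / (2 * n)%:R)
     * e2pi ((B * (B - n%:Z))%:~R / (2 * n)%:R)) :> C.
  rewrite -!e2piD; congr e2pi; rewrite natrM !(rmorphM, rmorphD, rmorphN, rmorphB) /=.
  by field.
have ea := e2pi_neq0 ((A * (A - n%:Z))%:~R / (2 * n)%:R : C).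
have eb := e2pi_neq0 ((B * (B - n%:Z))%:~R / (2 * n)%:R : C).
move: ea eb; set ea := e2pi (_ / _); set eb := e2pi (_ / _); set ec := e2pi _ => ea0 eb0.
set t1 := theta_ _ _ _ _; set t2 := theta_ _ _ _ _; set t3 := theta_ _ _ _ _.
rewrite [ea * t2 * _]mulrACA invfM [_^-1 * (t2 * t3)^-1]mulrC.
have eab : ea * eb != 0 by rewrite mulf_neq0.
move: (ea * eb) ((t2 * t3)^-1) eab => g x g0; rewrite -[RHS]mulr1 -(divff g0); ring.
Qed.

(** The phase of theta_0 is 1, so that the same phases occur in both products. *)
Lemma R_factorD1 tau z : R_factor (tau + 1) z = R_factor tau z.
Proof.
have [ph [ph0 phn thZ]] : exists ph : 'Z_n -> C, [/\ ph 0 = 1, forall al, ph al != 0 &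
    forall al y, thetaZ (tau + 1) al y = ph al * thetaZ tau al y].
  exists (fun al => e2pi ((Posz al * (Posz al - n%:Z))%:~R / (2 * n)%:R)); split.
  - by rewrite (_ : Posz _ * _ = 0) ?mul0r ?e2pi0 //; apply: mul0r.
  - by move=> al; apply: e2pi_neq0.
  - by move=> al y; apply: theta_tauD1_level.
have spl (P : pred 'Z_n) y : \prod_(al | P al) thetaZ (tau + 1) al y
    = (\prod_(al | P al) ph al) * \prod_(al | P al) thetaZ tau al y.
  by rewrite -big_split; apply: eq_bigr => al _; apply: thZ.
have spl0 : \prod_al ph al = \prod_(al | al != 0) ph al.
  by rewrite (bigD1 (0 : 'Z_n)) //= ph0 mul1r.
have phP : \prod_(al : 'Z_n | al != 0) ph al != 0.
  by apply/prodf_neq0 => i _; apply: phn.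
rewrite /R_factor (spl xpredT) (spl (fun al => al != 0)) spl0.
by rewrite -mulf_div divff // mul1r.
Qed.

Definition phase (u : 'Z_n) : C := quad_phase R p k (Posz u).

Lemma phase_int (a : int) : phase a%:~R = quad_phase R p k a.
Proof. exact/quad_phase_mod/Zp_int_modE. Qed.

(** The sum of squares (j - r)^2 + (i + r)^2 differs from i^2 + j^2 by
    -2 r (j - i - r), which is what the character compensates. *)
Lemma phase_shift (i j r : 'Z_n) :
  chi (- ((j - i - r) * (k%:R * r))) * (phase (j - r) * phase (i + r))
    = phase i * phase j.
Proof.
rewrite (Zp_intE i) (Zp_intE j) (Zp_intE r).
move: (Posz i) (Posz j) (Posz r) => a b c.
rewrite -[k%:R]/((k%:Z)%:~R) -!(rmorphB, rmorphD, rmorphM, rmorphN) /= chi_int !phase_int.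
rewrite /quad_phase -!e2piD; congr e2pi.
rewrite natrM !(rmorphM, rmorphD, rmorphN, rmorphB) /=; field.
by rewrite -natrD pnatr_eq0.
Qed.

Definition phase_mx : 'M[C]_N := diag_mx (\row_i phase i).
Definition phase_inv_mx : 'M[C]_N := diag_mx (\row_i (phase i)^-1).

Lemma phase_mxK : phase_mx *m phase_inv_mx = 1%:M.
Proof.
apply/matrixP => a b; rewrite mul_diag_mx !mxE; case: eqP => [->|_]; rewrite ?mulr0 //.
by rewrite mulr1n divff // e2pi_neq0.
Qed.

Lemma Rmx_basisD1 tau z eta (i j : 'Z_n) : 0 < complex.Im tau ->
  phase_mx^T *m Rmx_basis k z eta (tau + 1) i j *m phase_mx
  = 1 *: \sum_a \sum_b (phase_mx i a * phase_mx j b) *: Rmx_basis k z eta tau a b.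
Proof.
move=> t0; have t1 : 0 < complex.Im (tau + 1) by rewrite raddfD /= addr0.
rewrite (Rmx_basisE _ _ _ _ t1) R_factorD1.
apply: (diag_congr (c := fun r => R_coef tau (j - i - r) (k%:R * r) z eta)
  (B := Rmx_basis k z eta tau)); last exact: (Rmx_basisE _ _ _ _ t0).
move=> r; rewrite R_coefD1 -(phase_shift i j r).
by move: (chi _) (R_coef _ _ _ _ _) (phase (j - r)) (phase (i + r)) => *; ring.
Qed.

Lemma Rmx_formulaD1 tau z eta : 0 < complex.Im tau ->
  @Rmx_formula R n k z eta (tau + 1)
   = 1 *: (tensor_square phase_mx *m @Rmx_formula R n k z eta tau
       *m tensor_square phase_inv_mx).
Proof.
move=> t0; apply: (@basis_map_conj _ N phase_mx phase_inv_mx (Rmx_basis k z eta tau)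
  (Rmx_basis k z eta (tau + 1)) 1 phase_mxK) => i j.
exact: Rmx_basisD1.
Qed.
End RMatrix.

(** * R under inversion of tau *)

Section FourierConjugation.
Variables (R : realType) (p k : nat).
Local Notation C := R[i].
Local Notation n := p.+2.
Local Notation N := (Zp_trunc n).+2.
Local Notation chi := (@chi R p).
Local Opaque e2pi.
Implicit Types (a b i j r m l : 'Z_n).

Let kk : 'Z_n := k%:R.

(** The new basis of V: the s-th vector is the sum over i of e2pi (- k s i / n) x_i. *)
Definition fourier_mx : 'M[C]_N := \matrix_(s, i) chi (kk * s * i).

Definition fourier_inv_mx : 'M[C]_N := \matrix_(i, s) (n%:R^-1 * chi (- (kk * s * i))).

Lemma fourier_mxK : coprime n k -> fourier_mx *m fourier_inv_mx = 1%:M.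
Proof.
move=> nk; apply/matrixP => s t; rewrite !mxE.
under eq_bigr => i _ do rewrite !mxE mulrCA -chiD.
rewrite -mulr_sumr (eq_bigr (fun i => chi (kk * (s - t) * i))); last first.
  by move=> i _; congr chi; ring.
rewrite sum_chi; have -> : (kk * (s - t) == 0) = (s == t).
  by rewrite mulrI_eq0 ?subr_eq0 //; apply/mulrI; rewrite unitZpE.
by case: eqP => _; rewrite ?mulr0 // mulVf // pnatr_eq0.
Qed.

(** Both sides become the same single sum, on the left because summing over r a
    character of r forces l = k (m - a + b). *)
Lemma fourier_congr (g : C) (K K' : 'Z_n -> 'Z_n -> C) i j :
  (forall a b, K' a b = g * \sum_l \sum_m chi (a * l + b * m) * K m l) ->
  fourier_mx^T *m (\sum_r K' (j - i - r) (kk * r) *: delta_mx (j - r) (i + r))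
     *m fourier_mx
  = (n%:R * g) *: \sum_a \sum_b (fourier_mx i a * fourier_mx j b) *:
      \sum_r K (b - a - r) (kk * r) *: delta_mx (b - r) (a + r).
Proof.
move=> K'E; apply/matrixP => a b.
have -> : (fourier_mx^T *m (\sum_r K' (j - i - r) (kk * r) *: delta_mx (j - r) (i + r))
     *m fourier_mx) a b
   = \sum_r K' (j - i - r) (kk * r) * (chi (kk * (j - r) * a) * chi (kk * (i + r) * b)).
  rewrite mulmx_sumr mulmx_suml summxE; apply: eq_bigr => r _.
  by rewrite -scalemxAr -scalemxAl mxE delta_congr !mxE.
transitivity (n%:R * g * \sum_m K m (kk * (m - a + b)) *
    chi ((j - i) * (kk * (m - a + b)) + kk * j * a + kk * i * b)).
  transitivity (\sum_m \sum_l \sum_r (g * K m l *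
      chi ((j - i) * l + kk * j * a + kk * i * b)) * chi ((kk * (m - a + b) - l) * r)).
    rewrite exchange_big /=; under [RHS]eq_bigr do rewrite exchange_big /=.
    rewrite [RHS]exchange_big /=; apply: eq_bigr => r _; rewrite K'E -mulrA mulr_suml mulr_sumr.
    apply: eq_bigr => l _; rewrite mulr_suml mulr_sumr; apply: eq_bigr => m _.
    have -> : chi ((j - i - r) * l + kk * r * m) * K m l
         * (chi (kk * (j - r) * a) * chi (kk * (i + r) * b))
      = K m l * chi ((j - i - r) * l + kk * r * m + (kk * (j - r) * a + kk * (i + r) * b)).
      by rewrite -!chiD (mulrC (chi _) (K m l)) -(mulrA (K m l)) -chiD.
    rewrite -[RHS]mulrA -chiD -(mulrA g); congr (_ * (_ * chi _)); ring.
  rewrite mulr_sumr; apply: eq_bigr => m _.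
  under eq_bigr => l _ do rewrite -mulr_sumr sum_chi subr_eq0.
  rewrite (bigD1 (kk * (m - a + b))) //= eqxx big1 ?addr0.
    by move: (chi _) => *; ring.
  by move=> l ll; rewrite eq_sym (negbTE ll) mulr0.
rewrite mxE; congr (_ * _); rewrite summxE.
transitivity (\sum_r \sum_i0 \sum_j0 chi (kk * i * i0) * chi (kk * j * j0)
    * K (j0 - i0 - r) (kk * r) * ((a == j0 - r)%:R * (b == i0 + r)%:R)); last first.
  rewrite exchange_big; apply: eq_bigr => i0 _ /=; rewrite exchange_big summxE.
  apply: eq_bigr => j0 _ /=; rewrite mxE summxE mulr_sumr; apply: eq_bigr => r _.
  rewrite !mxE -mulnb natrM; exact/esym/mulrA.
rewrite (reindex_inj (addrI (a - b))) /=; apply: eq_bigr => r _.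
rewrite (bigD1 (b - r)) //=; set S := \sum_(j0 < N) _; rewrite big1 ?addr0 /S; last first.
  move=> i0 ii; have -> : (b == i0 + r) = false.
    by rewrite -subr_eq eq_sym; apply/negbTE.
  by rewrite big1 // => j0 _; rewrite !mulr0.
rewrite (bigD1 (a + r)) //= big1 ?addr0; last first.
  move=> j0 jj; have -> : (a == j0 - r) = false.
    by rewrite eq_sym subr_eq; apply/negbTE.
  by rewrite mul0r mulr0.
rewrite addrK subrK !eqxx !mulr1 -chiD mulrC; congr (chi _ * K _ (_ * _)); ring.
Qed.
End FourierConjugation.

Section RMatrixInversion.
Variables (R : realType) (p k : nat).
Local Notation C := R[i].
Local Notation n := p.+2.
Local Notation N := (Zp_trunc n).+2.
Local Notation chi := (@chi R p).
Local Opaque e2pi cexp.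
Implicit Types (z eta tau : C).

Let nn : n%:R != 0 :> C. Proof. by rewrite pnatr_eq0. Qed.
Let n_gt0 : (0 < n)%N. Proof. by []. Qed.

Lemma qexpZ (c : C) (s : C -> C) : c != 0 -> qexp s -> qexp (fun z => c * s z).
Proof.
move=> c0 [l [a [b [l0 sE]]]]; exists (c * l), a, b.
by split=> [|z]; rewrite ?mulf_neq0 // sE mulrA.
Qed.

Lemma frac_latticeN tau z : frac_lattice n tau (- z) -> frac_lattice n tau z.
Proof.
move=> [a [b e]]; exists (- a), (- b); rewrite -[z]opprK e.
by rewrite !rmorphN /= mulNr -opprD mulNr.
Qed.

Lemma R_coef_inversion tau : 0 < complex.Im tau -> exists2 c : C, c != 0 &
  forall z eta, ~ frac_lattice n tau z -> ~ frac_lattice n tau eta ->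
  forall a b : 'Z_n, R_coef (- tau^-1) a b (z / tau) (eta / tau)
    = c * e2pi (n%:R * - z * eta / tau)
      * \sum_(l : 'Z_n) \sum_(m : 'Z_n) chi (a * l + b * m) * R_coef tau m l z eta.
Proof.
move=> t0; have [c c0 H] := kern_inversion n_gt0 t0; exists c => //.
move=> z eta zD eD a b; rewrite /R_coef -mulNr H //; last by move=> /frac_latticeN.
congr (_ * _); apply: eq_bigr => l _; apply: eq_bigr => m _; congr (_ * _).
rewrite (Zp_intE a) (Zp_intE b) (Zp_intE l) (Zp_intE m) -!rmorphM -rmorphD chi_int.
by rewrite -!Zp_intE rmorphD !rmorphM.
Qed.

Lemma R_factor_inversion tau : 0 < complex.Im tau -> exists2 s : C -> C, qexp s &
  forall z, R_factor p (- tau^-1) (z / tau) = s z * R_factor p tau z.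
Proof.
move=> t0; have [s [c [a [b [c0 sE]]]] H] := prod_theta_inversion n_gt0 t0.
have ti := Im_inv_gt0 t0.
pose P0 tau' : C := \prod_(al : 'Z_n | al != 0) thetaZ tau' al 0.
have P0n tau' : 0 < complex.Im tau' -> P0 tau' != 0.
  move=> t'0; apply/prodf_neq0 => al al0; apply: theta__0_neq0 => //.
  by rewrite lt0n (ltn_ord al) andbT.
exists (fun z => (P0 tau / P0 (- tau^-1) * c) * e2pi (a * z ^+ 2 + (- b) * z)).
  exists (P0 tau / P0 (- tau^-1) * c), a, (- b); split=> //.
  by rewrite !mulf_neq0 ?invr_eq0 ?P0n.
move=> z; rewrite /R_factor -/(P0 tau) -/(P0 (- tau^-1)).
have -> : \prod_(al : 'Z_n) thetaZ (- tau^-1) al (- (z / tau))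
   = s (- z) * \prod_(al : 'Z_n) thetaZ tau al (- z) by rewrite -mulNr; apply: H.
rewrite sE sqrrN mulrN -mulNr.
move: (e2pi _) (\prod_(al : 'Z_n) _) => u v.
by field; rewrite !P0n.
Qed.

Lemma Rmx_basis_inversion tau : 0 < complex.Im tau ->
  exists2 s : C -> C, qexp s &
  forall z eta, ~ frac_lattice n tau z -> ~ frac_lattice n tau eta ->
  forall i j : 'Z_n,
  (fourier_mx R p k)^T *m Rmx_basis k (z / tau) (eta / tau) (- tau^-1) i j
     *m fourier_mx R p k
  = (e2pi (- n%:R / tau * z * eta) * s z)
    *: \sum_a \sum_b (fourier_mx R p k i a * fourier_mx R p k j b)
         *: Rmx_basis k z eta tau a b.
Proof.
move=> t0; have ti := Im_inv_gt0 t0.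
have [c c0 Hc] := R_coef_inversion t0; have [s qs Hs] := R_factor_inversion t0.
exists (fun z => n%:R * c * s z); first by apply: qexpZ => //; rewrite mulf_neq0.
move=> z eta zD eD i j.
rewrite (Rmx_basisE _ _ _ _ _ ti) Hs -scalemxAr -scalemxAl.
rewrite (fourier_congr _ _ _ (Hc z eta zD eD)).
under [in RHS]eq_bigr => a _ do under eq_bigr => b _ do
  rewrite (Rmx_basisE _ _ _ _ _ t0) scalerA mulrC -scalerA.
under [in RHS]eq_bigr => a _ do rewrite -scaler_sumr.
rewrite -scaler_sumr !scalerA; congr (_ *: _).
have -> : - n%:R / tau * z * eta = n%:R * - z * eta / tau by ring.
by move: (e2pi _) (s z) (R_factor _ _ _) => *; ring.
Qed.

Lemma Rmx_formula_inversion tau : coprime n k -> 0 < complex.Im tau ->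
  exists2 s : C -> C, qexp s &
  forall z eta, ~ frac_lattice n tau z -> ~ frac_lattice n tau eta ->
  @Rmx_formula R n k (z / tau) (eta / tau) (- tau^-1)
  = (e2pi (- n%:R / tau * z * eta) * s z) *:
    (tensor_square (fourier_mx R p k) *m @Rmx_formula R n k z eta tau
       *m tensor_square (fourier_inv_mx R p k)).
Proof.
move=> nk t0; have [s qs H] := Rmx_basis_inversion t0; exists s => // z eta zD eD.
apply: (@basis_map_conj _ N (fourier_mx R p k) (fourier_inv_mx R p k)
  (Rmx_basis k z eta tau) (Rmx_basis k (z / tau) (eta / tau) (- tau^-1)) _
  (fourier_mxK R nk)) => i j.
exact: H.
Qed.
End RMatrixInversion.

(** * The generators of the modular group *)

Section ModularGenerators.
Variables (R : realType) (p k : nat).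
Local Notation C := R[i].
Local Notation n := p.+2.
Local Notation N := (Zp_trunc n).+2.
Local Opaque e2pi cexp.
Implicit Types (z eta tau : C).

Let n_gt0 : (0 < n)%N. Proof. by []. Qed.

Lemma frac_latticeD1 tau z : frac_lattice n (tau + 1) (z / 1) <-> frac_lattice n tau z.
Proof.
rewrite divr1; split=> -[a [b ->]].
  by exists (a + b), b; congr (_ / _); rewrite rmorphD /=; ring.
by exists (a - b), b; congr (_ / _); rewrite rmorphB /=; ring.
Qed.

Lemma qexp1 : qexp (fun _ : C => 1).
Proof.
exists 1, 0, 0; split=> [|z]; first exact: oner_neq0.
by rewrite !mul0r addr0 e2pi0 mulr1.
Qed.

Lemma Qnk_conj eta tau eta' tau' (W W' : 'M[C]_N) (c : C) :
  W *m W' = 1%:M -> c != 0 ->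
  @Rmx_diag R n k eta' tau'
    = c *: (tensor_square W *m @Rmx_diag R n k eta tau *m tensor_square W') ->
  graded_iso (@Qnk R n k eta' tau') (@Qnk R n k eta tau).
Proof. exact: quad_alg_iso_conj. Qed.

(** Two extensions are made: of z |-> R(z, eta) for fixed eta, then of the diagonal.
    Each preserves the transformation law, the second one with the factor
    restricted to the diagonal. *)
Lemma Rmx_diag_transfer tau tau' (w : C) (s : C -> C -> C)
    (W W' : 'M[C]_N) :
  0 < complex.Im tau -> 0 < complex.Im tau' -> w != 0 ->
  (forall z, frac_lattice n tau' (z / w) <-> frac_lattice n tau z) ->
  (forall eta, qexp (s eta)) -> qexp (fun z => s z z) ->
  W *m W' = 1%:M ->
  (forall z eta, ~ frac_lattice n tau z -> ~ frac_lattice n tau eta ->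
    @Rmx_formula R n k (z / w) (eta / w) tau'
    = s eta z *: (tensor_square W *m @Rmx_formula R n k z eta tau *m tensor_square W')) ->
  forall eta, @Rmx_diag R n k (eta / w) tau'
    = s eta eta *: (tensor_square W *m @Rmx_diag R n k eta tau *m tensor_square W').
Proof.
move=> t0 t'0 w0 DD' qs qd WW' H.
have cD := codense_frac_lattice n_gt0 t0; have cD' := codense_frac_lattice n_gt0 t'0.
have sWW : tensor_square W' *m tensor_square W = 1%:M.
  by rewrite tensor_squareM (mulmx1C WW') tensor_square1.
have H2 eta : ~ frac_lattice n tau eta -> forall z, @Rmx R n k (z / w) (eta / w) tau'
    = s eta z *: (tensor_square W *m @Rmx R n k z eta tau *m tensor_square W').
  move=> eD; apply: (entire_ext_conj (f := fun z => @Rmx_formula R n k z eta tau)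
    (f' := fun z => @Rmx_formula R n k z (eta / w) tau') cD cD' w0 DD' (qs eta) sWW sWW).
  by move=> z zD; apply: H.
apply: (entire_ext_conj (f := fun z => @Rmx R n k z z tau)
  (f' := fun z => @Rmx R n k z z tau') cD cD' w0 DD' qd sWW sWW).
by move=> z zD; apply: H2.
Qed.

Lemma Qnk_translation eta tau : 0 < complex.Im tau ->
  graded_iso (@Qnk R n k eta (tau + 1)) (@Qnk R n k eta tau).
Proof.
move=> t0; have t1 : 0 < complex.Im (tau + 1) by rewrite raddfD /= addr0.
apply: (Qnk_conj (phase_mxK R p k) (oner_neq0 _)).
rewrite -[in LHS](divr1 eta).
apply: (@Rmx_diag_transfer tau (tau + 1) 1 (fun _ _ => 1)) => //.
- exact: frac_latticeD1.
- by move=> _; apply: qexp1.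
- exact: qexp1.
- exact: phase_mxK.
- by move=> z e _ _; rewrite !divr1 Rmx_formulaD1.
Qed.

Lemma Qnk_inversion eta tau : coprime n k -> 0 < complex.Im tau ->
  graded_iso (@Qnk R n k (eta / tau) (- tau^-1)) (@Qnk R n k eta tau).
Proof.
move=> nk t0; have [s qs H] := Rmx_formula_inversion nk t0.
have q1 (u : C) : qexp (fun z => e2pi (- n%:R / tau * z * u)).
  exists 1, 0, (- n%:R / tau * u); split=> [|z]; first exact: oner_neq0.
  by rewrite mul1r; congr e2pi; ring.
have q2 : qexp (fun z => e2pi (- n%:R / tau * z * z)).
  exists 1, (- n%:R / tau), 0; split=> [|z]; first exact: oner_neq0.
  by rewrite mul1r; congr e2pi; ring.
have c0 : e2pi (- n%:R / tau * eta * eta) * s eta != 0.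
  by rewrite mulf_neq0 ?e2pi_neq0 ?qexp_neq0.
apply: (Qnk_conj (fourier_mxK R nk) c0).
apply: (@Rmx_diag_transfer tau (- tau^-1) tau
  (fun e z => e2pi (- n%:R / tau * z * e) * s z)) => //.
- exact: Im_inv_gt0.
- exact: upper_neq0.
- by move=> z; apply: frac_lattice_inv => //; apply: upper_neq0.
- by move=> e; apply: qexpM.
- exact: qexpM.
- exact: fourier_mxK.
Qed.

End ModularGenerators.

(** * The modular group *)

Section Modular.
Variables (R : realType).
Local Notation C := R[i].
Implicit Types (z eta tau : C) (a b c d : int).

Lemma moebius_den_neq0 tau a b c d : 0 < complex.Im tau -> a * d - b * c = 1 ->
  c%:~R * tau + d%:~R != 0.
Proof.
move=> t0 det; apply/eqP => e.
have eI : c%:~R * complex.Im tau = 0 by rewrite -(Im_lattice d c tau) addrC e.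
have c0 : c = 0.
  by apply/eqP; move/eqP: eI; rewrite mulf_eq0 (gt_eqF t0) orbF intr_eq0.
move: e; rewrite c0 mul0r add0r => /eqP; rewrite intr_eq0 => /eqP d0.
by move: det; rewrite c0 d0 !mulr0 subrr => /esym/eqP; rewrite oner_eq0.
Qed.

Lemma int_mul_eq1 a d : a * d = 1 -> a = d /\ (d = 1 \/ d = -1).
Proof.
move=> e; have /(congr1 absz)/eqP := e; rewrite abszM muln_eq1 => /andP[/eqP ? /eqP ?].
have [aE|aE] : a = 1 \/ a = -1 by lia.
  by move: e; rewrite aE mul1r => ->; split; last left.
by move: e; rewrite aE mulN1r => /(congr1 -%R); rewrite opprK => ->; split; last right.
Qed.

(** For c != 0 the image of tau is a / c - 1 / (c (c tau + d)), with c (c tau + d) in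
    the upper half plane. *)
Lemma moebius_Im_gt0 tau a b c d : 0 < complex.Im tau -> a * d - b * c = 1 ->
  0 < complex.Im ((a%:~R * tau + b%:~R) / (c%:~R * tau + d%:~R)).
Proof.
move=> t0 det; have den := moebius_den_neq0 t0 det.
have ImZ (r : R) z : complex.Im (z + r%:C) = complex.Im z by rewrite raddfD /= addr0.
have [c0|c0] := eqVneq c 0.
  move: det; rewrite c0 mulr0 subr0 => /int_mul_eq1[-> [->|->]].
    by rewrite mul0r add0r divr1 mul1r -(rmorph_int (real_complex R)) ImZ.
  rewrite mul0r add0r rmorphN /= invrN invr1 !mulN1r mulrN1 opprD opprK.
  by rewrite -mulrNz -(rmorph_int (real_complex R)) ImZ.
have cC : c%:~R != 0 :> C by rewrite intr_eq0.
have s0 : 0 < complex.Im (c%:~R * (c%:~R * tau + d%:~R)).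
  have -> : c%:~R * (c%:~R * tau + d%:~R) = (d * c)%:~R + (c * c)%:~R * tau :> C.
    by rewrite !rmorphM /=; ring.
  by rewrite Im_lattice mulr_gt0 // ltr0z -expr2 exprn_even_gt0.
have -> : (a%:~R * tau + b%:~R) / (c%:~R * tau + d%:~R)
   = - (c%:~R * (c%:~R * tau + d%:~R))^-1 + (a%:~R / c%:~R)%:C.
  rewrite fmorph_div !rmorph_int /=.
  have detC : b%:~R = (a%:~R * d%:~R - 1) / c%:~R :> C.
    have e : a%:~R * d%:~R - b%:~R * c%:~R = 1 :> C.
      by rewrite -!rmorphM -rmorphB det.
    by move/eqP: e; rewrite subr_eq => /eqP->; rewrite addrAC subrr add0r mulfK.
  by rewrite detC; field; rewrite cC den.
by rewrite ImZ Im_inv_gt0.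
Qed.

Section Iso.
Variables (p k : nat).
Local Notation n := p.+2.
Hypothesis nk : coprime n k.
Local Notation Q := (@Qnk R n k).

Lemma Qnk_translation_int eta tau (m : int) : 0 < complex.Im tau ->
  graded_iso (Q eta (tau + m%:~R)) (Q eta tau).
Proof.
have nat_case (l : nat) t : 0 < complex.Im t -> graded_iso (Q eta (t + l%:R)) (Q eta t).
  move=> t0; elim: l => [|l IH]; first by rewrite addr0; apply: graded_iso_refl.
  rewrite -natr1 addrA; apply: graded_iso_trans IH; apply: Qnk_translation.
  by rewrite raddfD /= -(rmorph_nat (real_complex R)) addr0.
move=> t0; case: m => l; first exact: nat_case.
apply: graded_iso_sym; rewrite NegzE rmorphN /=.
have {1}-> : tau = tau - l.+1%:R + l.+1%:R by rewrite subrK.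
apply: nat_case; rewrite raddfB /= -(rmorph_nat (real_complex R)) subr0 //.
Qed.

(** The square of the inversion is minus the identity matrix. *)
Lemma Qnk_opp eta tau : 0 < complex.Im tau -> graded_iso (Q (- eta) tau) (Q eta tau).
Proof.
move=> t0; have tn := upper_neq0 t0.
apply: graded_iso_trans (Qnk_inversion eta nk t0).
have := Qnk_inversion (eta / tau) nk (Im_inv_gt0 t0).
have -> : eta / tau / - tau^-1 = - eta by rewrite invrN invrK mulrN divfK.
by rewrite invrN invrK opprK.
Qed.

(** Euclidean descent on |c|: writing a = q c + r, the matrix is T^q S times the matrix
    with rows (-c, -d) and (r, b - q d), up to sign. *)
Lemma Qnk_modular eta tau a b c d : 0 < complex.Im tau -> a * d - b * c = 1 ->
  graded_iso (Q (eta / (c%:~R * tau + d%:~R))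
                ((a%:~R * tau + b%:~R) / (c%:~R * tau + d%:~R)))
             (Q eta tau).
Proof.
move=> t0; have [M cM] := ubnP `|c|%N; elim: M => // M IH in a b c d cM *.
move=> det; have [c0|c0] := eqVneq c 0.
  move: det; rewrite c0 mulr0 subr0 => /int_mul_eq1[-> [->|->]].
    rewrite mul0r add0r !divr1 mul1r; exact: Qnk_translation_int.
  rewrite mul0r add0r rmorphN /= invrN invr1 mulN1r !mulrN1 opprD opprK -rmorphN.
  exact: graded_iso_trans (Qnk_translation_int _ _ t0) (Qnk_opp _ t0).
pose q := (a %/ c)%Z; pose r := a - q * c; pose b' := b - q * d.
have rE : r = (a %% c)%Z by rewrite /r /q {1}(divz_eq a c) addrC addKr.
have det' : r * d - b' * c = 1 by rewrite -det /r /b'; ring.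
have det2 : - c * b' - - d * r = 1 by rewrite -det'; ring.
have rM : (`|r| < M)%N.
  rewrite rE; have := modz_ge0 a c0; have := ltz_mod a c0; move: cM; lia.
have den := moebius_den_neq0 t0 det; have den2 := moebius_den_neq0 t0 det2.
have dd : c%:~R * tau + d%:~R != 0 by [].
set den1 := c%:~R * tau + d%:~R in den *.
pose sig : C := (r%:~R * tau + b'%:~R) / den1.
have sig0 : 0 < complex.Im sig by apply: moebius_Im_gt0.
have -> : (a%:~R * tau + b%:~R) / den1 = sig + q%:~R.
  rewrite /sig /r /b' -[q%:~R](mulfK den) -mulrDl; congr (_ / _).
  by rewrite /den1 !rmorphB !rmorphM /=; ring.
apply: graded_iso_trans (Qnk_translation_int _ _ sig0) _.
apply: graded_iso_trans (IH _ _ _ _ rM det2).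
set tau' := (X in graded_iso _ (Q _ X)); set eta' := (X in graded_iso _ (Q X _)).
have tau'0 : 0 < complex.Im tau' by apply: moebius_Im_gt0.
apply: graded_iso_trans (Qnk_inversion eta' nk tau'0).
apply: graded_iso_sym.
have -> : - tau'^-1 = sig.
  rewrite /tau' /sig invf_div /den1 !rmorphN /=; field.
  by rewrite dd ?den2 mulNr -opprD oppr_eq0 dd.
have -> : eta' / tau' = - (eta / den1).
  rewrite /tau' /eta' /den1 !rmorphN /=; field.
  by rewrite dd ?den2 mulNr -opprD oppr_eq0 dd.
exact: Qnk_opp.
Qed.
End Iso.
End Modular.

Theorem theorem1p1 (R : realType) (n k : nat)
    (hk : (1 <= k)%N) (hkn : (k < n)%N) (hnk : coprime n k)
    (eta tau : R[i]) (htau : 0 < complex.Im tau)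
    (a b c d : int) (hdet : a * d - b * c = 1) :
  graded_iso
    (Qnk n k (eta / (c%:~R * tau + d%:~R))
       ((a%:~R * tau + b%:~R) / (c%:~R * tau + d%:~R)))
    (Qnk n k eta tau).
Proof.
case: n hkn hnk => [|[|p]] kn nk; [by []|by move: kn; rewrite ltnS leqNgt hk|].
exact: Qnk_modular.
Qed.
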